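(* Let $1<p<2$. There exists a positive number $C_p$ such that for all $x,y\in\mathbb{R}^n$, $$|x|^{p}+C_p\frac{|y|^{2}}{(|x|+|y|)^{2-p}}+p|x|^{p-2}x\cdot y\le|x+y|^{p}.$$ In turn, the following holds. Let $\mathbb{G}$ be a stratified group and let $0\le\rho\in C^1(\mathbb{G})$. Let $0\le F\in C^\infty(\mathbb{G})$ and $0\le\eta\in L^1_{loc}(\mathbb{G})$ be such that $$\eta F^{p-1}\le-\mathcal{L}_{p,\rho}F\quad\text{a.e. in }\mathbb{G}.$$ Then $$\|\eta^{1/p}f\|_{L^p(\mathbb{G})}^p+C_p\left\|\rho^{1/2}\left(\left|\frac fF\nabla_HF\right|+F\left|\nabla_H\frac fF\right|\right)^{\frac{p-2}{2}}|F|\,\nabla_H\frac fF\right\|_{L^2(\mathbb{G})}^2\le\|\rho^{1/p}\nabla_Hf\|_{L^p(\mathbb{G})}^p$$ for all real-valued $f\in C_0^\infty(\mathbb{G})$.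
   Context: A stratified group (homogeneous Carnot group) is a Lie group $\mathbb{G}=(\mathbb{R}^n,\circ)$ such that: (a) for some natural numbers $N=N_1,N_2,\dots,N_r$ with $N_1+\dots+N_r=n$, writing $\mathbb{R}^n=\mathbb{R}^{N}\times\mathbb{R}^{N_2}\times\dots\times\mathbb{R}^{N_r}$, for every $\lambda>0$ the dilation $\delta_\lambda(x',x^{(2)},\dots,x^{(r)})=(\lambda x',\lambda^2x^{(2)},\dots,\lambda^r x^{(r)})$ is an automorphism of $\mathbb{G}$, where $x'\in\mathbb{R}^N$ and $x^{(k)}\in\mathbb{R}^{N_k}$; (b) if $X_1,\dots,X_N$ are the left-invariant vector fields on $\mathbb{G}$ with $X_k(0)=\partial/\partial x'_k|_0$, then the iterated commutators of $X_1,\dots,X_N$ span the Lie algebra of $\mathbb{G}$ (rank $n$ at every point). $\nabla_H=(X_1,\dots,X_N)$ is the horizontal gradient, $|\nabla_H f|=(\sum_k|X_kf|^2)^{1/2}$, and $\mathrm{div}_Hv=\sum_{k=1}^NX_kv_k$. The weighted $p$-sub-Laplacian is $\mathcal{L}_{p,\rho}F=\mathrm{div}_H(\rho(x)|\nabla_HF|^{p-2}\nabla_HF)$. $L^p(\mathbb{G})$ is with respect to Lebesgue measure $dx$ on $\mathbb{R}^n$ (the Haar measure of $\mathbb{G}$); the norm of a vector-valued function is that of its Euclidean length. $C_0^\infty(\mathbb{G})$ denotes smooth compactly supported functions.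
   Formalization: It is additionally assumed that F is nonzero almost everywhere, so that f/F is defined; for F = 0 the hypothesis on η is void, f/F is undefined, and the inequality fails for large η. *)

(* Defs.v *)
From HB Require Import structures.
From mathcomp Require Import all_boot all_order all_algebra.
From mathcomp Require Import all_classical all_reals all_analysis.

Set Implicit Arguments.
Unset Strict Implicit.
Unset Printing Implicit Defensive.

Import Order.TTheory GRing.Theory Num.Theory.
Import numFieldNormedType.Exports.

Local Open Scope classical_set_scope.
Local Open Scope ring_scope.

(* The sigma-algebra generated by the coordinates, i.e. the Borel sets; same
   construction as the library's one on [n.-tuple T]. *)
Section measurable_rV.
Context {R : realType} (n : nat).

Let coors : 'I_n -> 'rV[R]_n -> R := fun i v => v ord0 i.

Let rV_set0 : g_sigma_preimage coors set0.
Proof. exact: sigma_algebra0. Qed.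

Let rV_setC A : g_sigma_preimage coors A -> g_sigma_preimage coors (~` A).
Proof. exact: sigma_algebraC. Qed.

Let rV_bigcup (F : _^nat) : (forall i, g_sigma_preimage coors (F i)) ->
  g_sigma_preimage coors (\bigcup_i (F i)).
Proof. exact: sigma_algebra_bigcup. Qed.

HB.instance Definition _ := @isMeasurable.Build default_measure_display
  'rV[R]_n (g_sigma_preimage coors) rV_set0 rV_setC rV_bigcup.

End measurable_rV.

Section measurable_fun_rV.
Context {R : realType}.

Lemma measurable_coord_rV n (i : 'I_n) :
  measurable_fun [set: 'rV[R]_n] (fun v : 'rV[R]_n => v ord0 i).
Proof.
move=> _ Y mY; rewrite setTI; apply: sub_sigma_algebra => /=.
rewrite -bigcup_seq/=; exists i => /=; first by rewrite mem_index_enum.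
by exists Y => //; rewrite setTI.
Qed.

Lemma measurable_fun_rVP d (T : measurableType d) n (f : T -> 'rV[R]_n) :
  (forall i, measurable_fun [set: T] (fun t => f t ord0 i)) ->
  measurable_fun [set: T] f.
Proof.
move=> mf.
have H : g_sigma_preimage (fun i => (fun v : 'rV[R]_n => v ord0 i) \o f)
    `<=` measurable.
  apply: smallest_sub; first exact: sigma_algebra_measurable.
  case: n => [|n] in f mf *; first by rewrite big_ord0.
  rewrite -bigcup_mkord_ord; apply: bigcup_sub => i Ii.
  by move=> A [B mB <-]; exact: mf.
move: H; rewrite g_sigma_preimage_comp => prefS _ A mA.
by apply: prefS; exists A.
Qed.

End measurable_fun_rV.

Section lebesgue_rV.
Context {R : realType}.

Section step.
Variable n : nat.

Definition cons_rV (z : measurableTypeR R * 'rV[R]_n) : 'rV[R]_n.+1 :=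
  row_mx (z.1 : R)%:M z.2.

Definition uncons_rV (v : 'rV[R]_n.+1) : measurableTypeR R * 'rV[R]_n :=
  (v ord0 ord0, rsubmx (v : 'rV[R]_(1 + n))).

Lemma cons_rV_head z : cons_rV z ord0 ord0 = z.1.
Proof.
have -> : (ord0 : 'I_n.+1) = lshift n (ord0 : 'I_1) by exact: val_inj.
by rewrite (@row_mxEl _ 1 1 n) mxE mulr1n.
Qed.

Lemma cons_rVK : cancel cons_rV uncons_rV.
Proof.
move=> [a v]; rewrite /uncons_rV cons_rV_head /=; congr pair.
exact: row_mxKr.
Qed.

Lemma uncons_rVK : cancel uncons_rV cons_rV.
Proof.
move=> v; rewrite /cons_rV /= -[RHS](@hsubmxK _ 1 1 n).
suff -> : (v ord0 ord0)%:M = lsubmx (v : 'rV[R]_(1 + n)) by [].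
apply/matrixP => i j; rewrite !mxE !ord1 mulr1n; congr (v _ _).
exact: val_inj.
Qed.

Lemma measurable_cons_rV : measurable_fun setT cons_rV.
Proof.
apply: measurable_fun_rVP => i.
have [->|[j ->]] : i = ord0 \/ exists j, i = rshift 1 j.
  case: (split_ordP (i : 'I_(1 + n))) => j ->; last by right; exists j.
  by left; apply: val_inj; rewrite ord1.
  under eq_fun do rewrite cons_rV_head.
  exact: measurable_fst.
under eq_fun do rewrite /cons_rV (@row_mxEr _ 1 1 n).
by apply: (@measurableT_comp _ _ _ _ _ _ (fun v : 'rV[R]_n => v ord0 j)) => //;
  exact: measurable_coord_rV.
Qed.

Lemma measurable_uncons_rV : measurable_fun setT uncons_rV.
Proof.
apply/measurable_fun_pairP; split => /=; first exact: measurable_coord_rV.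
apply: measurable_fun_rVP => i /=.
under eq_fun do rewrite mxE.
exact: measurable_coord_rV.
Qed.

Variable mu : {sigma_finite_measure set 'rV[R]_n -> \bar R}.

Definition lebesgue_cons : set 'rV[R]_n.+1 -> \bar R :=
  pushforward (lebesgue_measure \x mu)%E cons_rV.

Let lebesgue_cons0 : lebesgue_cons set0 = 0%E.
Proof. by rewrite /lebesgue_cons /pushforward preimage_set0 measure0. Qed.

Let lebesgue_cons_ge0 A : (0 <= lebesgue_cons A)%E.
Proof.
exact: (measure_ge0 (product_measure1 lebesgue_measure mu)).
Qed.

Let lebesgue_cons_sigma_additive : semi_sigma_additive lebesgue_cons.
Proof.
have mpre A : measurable A -> measurable (cons_rV @^-1` A).
  by move=> mA; rewrite -[X in measurable X]setTI; exact: measurable_cons_rV.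
move=> F mF tF mUF; rewrite /lebesgue_cons /pushforward preimage_bigcup.
apply: measure_semi_sigma_additive => [k||]; first exact: mpre.
- apply/trivIsetP => /= i j _ _ ij; rewrite -preimage_setI.
  by move/trivIsetP : tF => /(_ _ _ _ _ ij) ->//; rewrite preimage_set0.
- by rewrite -preimage_bigcup; exact: mpre.
Qed.

HB.instance Definition _ := isMeasure.Build _ _ _ lebesgue_cons
  lebesgue_cons0 lebesgue_cons_ge0 lebesgue_cons_sigma_additive.

Let lebesgue_cons_sigma_finite : sigma_finite setT lebesgue_cons.
Proof.
have /sigma_finiteP[F [TF ndF Foo]] :=
  sigma_finiteT (@lebesgue_measure R : {sigma_finite_measure set _ -> \bar R}).
have /sigma_finiteP[G [TG ndG Goo]] := sigma_finiteT mu.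
exists (fun k => uncons_rV @^-1` (F k `*` G k)).
  rewrite -preimage_bigcup -[LHS](preimage_setT uncons_rV); congr (_ @^-1` _).
  rewrite -setXTT TF TG predeqE => -[x y]; split.
    move=> [/= [i _ Fix] [k _ Gky]]; exists (maxn i k) => //; split.
    - by move: x Fix; exact/subsetPset/ndF/leq_maxl.
    - by move: y Gky; exact/subsetPset/ndG/leq_maxr.
  by move=> [i _ []/= ? ?]; split; exists i.
move=> k; have [mF Fk] := Foo k; have [mG Gk] := Goo k; split.
  rewrite -[X in measurable X]setTI; apply: measurable_uncons_rV => //.
  exact: measurableX.
rewrite /lebesgue_cons /pushforward -comp_preimage.
rewrite (_ : uncons_rV \o cons_rV = id); last first.
  by apply/funext => z; exact: cons_rVK.
by rewrite preimage_id product_measure1E// lte_mul_pinfty// ge0_fin_numE.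
Qed.

HB.instance Definition _ := Measure_isSigmaFinite.Build _ _ _ lebesgue_cons
  lebesgue_cons_sigma_finite.

End step.

Let dirac_sigma_finite : sigma_finite setT (@dirac _ 'rV[R]_0 0 R).
Proof.
apply: fin_num_fun_sigma_finite; first by rewrite measure0.
by move=> A mA; rewrite diracE.
Qed.

Definition lebesgue_rV0 : set 'rV[R]_0 -> \bar R := @dirac _ 'rV[R]_0 0 R.

HB.instance Definition _ := Measure.on lebesgue_rV0.
HB.instance Definition _ := Measure_isSigmaFinite.Build _ _ _ lebesgue_rV0
  dirac_sigma_finite.

(* [n]-fold product of the one-dimensional Lebesgue measure. *)
Fixpoint lebesgue_rV n : {sigma_finite_measure set 'rV[R]_n -> \bar R} :=
  if n is m.+1 then lebesgue_cons (lebesgue_rV m) else lebesgue_rV0.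

Lemma lebesgue_rV_box n (A : 'I_n -> set (measurableTypeR R)) :
  (forall i, measurable (A i)) ->
  lebesgue_rV n [set v | forall i, A i (v ord0 i)] =
  (\prod_i lebesgue_measure (A i))%E.
Proof.
elim: n A => [|n IHn] A mA.
  by rewrite big_ord0 /= /lebesgue_rV0 diracE mem_set// => -[].
have mB : measurable
    [set v : 'rV[R]_n | forall i, A (lift ord0 i) (v ord0 i)].
  rewrite (_ : mkset _ = \big[setI/setT]_(i < n)
      ((fun v : 'rV[R]_n => v ord0 i) @^-1` A (lift ord0 i))).
    apply: bigsetI_measurable => i _.
    rewrite -[X in measurable X]setTI.
    exact: (measurable_coord_rV i measurableT (mA (lift ord0 i))).
  rewrite -bigcap_seq; apply/seteqP; split=> v /= Av i.
    by move=> _; exact: Av.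
  by apply: (Av i); rewrite /= mem_index_enum.
rewrite big_ord_recl -IHn// -product_measure1E//.
rewrite /= /lebesgue_cons /pushforward; congr (product_measure1 _ _ _).
apply/seteqP; split=> -[a v] /= Av.
  split; first by have := Av ord0; rewrite cons_rV_head.
  move=> i; have := Av (lift ord0 i); rewrite /cons_rV.
  have -> : lift ord0 i = rshift 1 i by exact: val_inj.
  by rewrite (@row_mxEr _ 1 1 n).
case: Av => Aa Av i; case: (unliftP ord0 i) => [j|] ->.
  have := Av j; rewrite /cons_rV.
  have -> : lift ord0 j = rshift 1 j by exact: val_inj.
  by rewrite (@row_mxEr _ 1 1 n).
by rewrite cons_rV_head.
Qed.

End lebesgue_rV.

Section euclidean.
Context {R : realType} {n : nat}.
Implicit Types u v : 'rV[R]_n.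

Definition dotv u v : R := \sum_i u ord0 i * v ord0 i.

(* The library norm [`|u|] on row vectors is the sup norm. *)
Definition enorm u : R := Num.sqrt (dotv u u).

End euclidean.

Section smooth.
Context {R : realType} {V W : normedModType R}.

Fixpoint Ck (k : nat) (f : V -> W) : Prop :=
  if k is k'.+1 then
    [/\ continuous f, forall x v, derivable f x v & forall v, Ck k' ('D_v f)]
  else continuous f.

Definition smooth (f : V -> W) : Prop := forall k, Ck k f.

End smooth.

Definition compactly_supported {R : realType} {V : normedModType R}
    (f : V -> R) : Prop :=
  compact (closure [set x | f x != 0]).

Definition L1loc {R : realType} {n : nat} (g : 'rV[R]_n -> R) : Prop :=
  forall K : set 'rV[R]_n, compact K ->
    (lebesgue_rV n).-integrable K (EFin \o g).

(* The layers have dimensions [N :: Ns], so the dimension of the group is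
   [N + sumn Ns] and its first [N] coordinates are the horizontal ones. *)
Section stratified.
Context {R : realType} {N : nat} {Ns : seq nat}.

Local Notation V := 'rV[R]_(N + sumn Ns).

(* [reshape_index] gives the (0-based) layer of a coordinate. *)
Definition weight (i : 'I_(N + sumn Ns)) : nat :=
  (reshape_index (N :: Ns) i).+1.

Definition dilation (lam : R) (x : V) : V :=
  \row_i (lam ^+ weight i * x ord0 i).

Definition horizontal_basis (k : 'I_N) : V :=
  delta_mx ord0 (lshift (sumn Ns) k).

(* A vector field is identified with the map giving its value at each point.
   This is the left-invariant field with value d/dx_k at 0: its value at [x]
   is the image of d/dx_k under the differential at 0 of the left
   translation [op x]. *)
Definition left_invariant_field (op : V -> V -> V) (k : 'I_N) : V -> V :=
  fun x => 'D_(horizontal_basis k) (op x) 0.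

Definition bracket (X Y : V -> V) : V -> V :=
  fun x => 'D_(X x) Y x - 'D_(Y x) X x.

Inductive iterated_commutator (X : 'I_N -> V -> V) : (V -> V) -> Prop :=
| iterated_commutator_gen k : iterated_commutator X (X k)
| iterated_commutator_bracket Y Z :
    iterated_commutator X Y -> iterated_commutator X Z ->
    iterated_commutator X (bracket Y Z).

End stratified.

(* The neutral element is fixed by all dilations, hence it is 0. *)
Record stratified_group (R : realType) (N : nat) (Ns : seq nat) :=
  StratifiedGroup {
  sg_op : 'rV[R]_(N + sumn Ns) -> 'rV[R]_(N + sumn Ns) ->
    'rV[R]_(N + sumn Ns) ;
  sg_inv : 'rV[R]_(N + sumn Ns) -> 'rV[R]_(N + sumn Ns) ;
  sg_opA : associative sg_op ;
  sg_op0x : left_id 0 sg_op ;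
  sg_opx0 : right_id 0 sg_op ;
  sg_opVx : left_inverse 0 sg_inv sg_op ;
  sg_opxV : right_inverse 0 sg_inv sg_op ;
  sg_op_smooth : smooth (fun z => sg_op z.1 z.2) ;
  sg_inv_smooth : smooth sg_inv ;
  sg_dilation : forall lam : R, 0 < lam ->
    {morph dilation lam : x y / sg_op x y} ;
  sg_rank : forall x : 'rV[R]_(N + sumn Ns),
    exists Z : 'I_(N + sumn Ns) -> 'rV[R]_(N + sumn Ns) ->
      'rV[R]_(N + sumn Ns),
      (forall i, iterated_commutator (left_invariant_field sg_op) (Z i)) /\
      \rank (\matrix_i Z i x) = (N + sumn Ns)%N }.

Section horizontal.
Context {R : realType} {N : nat} {Ns : seq nat} (G : stratified_group R N Ns).

Local Notation V := 'rV[R]_(N + sumn Ns).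

Definition hfield (k : 'I_N) : V -> V := left_invariant_field (sg_op G) k.

Definition hgrad (f : V -> R) (x : V) : 'rV[R]_N :=
  \row_k 'D_(hfield k x) f x.

Definition hdiv (v : V -> 'rV[R]_N) (x : V) : R :=
  \sum_k 'D_(hfield k x) (fun z => v z ord0 k) x.

(* [0 `^ (p - 2) = 0] for [p != 2], so the flux vanishes where the horizontal
   gradient does. *)
Definition p_flux (p : R) (rho F : V -> R) (x : V) : 'rV[R]_N :=
  (rho x * enorm (hgrad F x) `^ (p - 2)) *: hgrad F x.

Definition p_sub_laplacian (p : R) (rho F : V -> R) : V -> R :=
  hdiv (p_flux p rho F).

(* All the derivatives in [p_sub_laplacian p rho F x] exist; without this the
   value of the total operator ['D] carries no information. *)
Definition p_sub_laplacian_exists (p : R) (rho F : V -> R) (x : V) : Prop :=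
  forall k, derivable (fun z => p_flux p rho F z ord0 k) x (hfield k x).

End horizontal.

(* Main.v *)
(** The constant is C_p = p (p - 1) / 2: for fixed norms the pointwise inequality
    is reduced to a one-dimensional one, where it is a second-order Taylor bound.

    The coefficients of X_k are homogeneous, and the derivative of the j-th one
    in the j-th coordinate is continuous and homogeneous of degree -1, hence
    zero: X_k is divergence free and integrates test functions to 0.

    The flux rho |grad F|^(p-2) grad F is only Hoelder continuous on the critical
    set, so integrating the a.e. inequality by parts is not immediate.  For a
    smooth u and q = 1/m, the function |u|^(q-1) |d_j u| is locally integrable,
    by induction on m: with s = u^2 + d^2, b = s^((1-q)/2) and w = d_j u, the
    regularisation |w| / b is bounded, up to the analogous expression for w with
    1/(m-1) in place of 1/m, by the derivative of u / b times
    w / sqrt (w^2 + b^2).  This dominates the divergences of the fluxes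
    regularised by |grad F|^2 + e^2.  On {grad F = 0} almost every point is flat
    to all orders, so that the sub-Laplacian vanishes there.

    The theorem follows by testing the weak inequality with
    |f|^p / (F + e)^(p-1), applying the pointwise inequality to
    x = f / (F + e) grad F and y = grad f - x, and letting e go to 0 with Fatou's
    lemma.  *)

Require Import Defs.
From mathcomp Require Import all_boot all_order all_algebra.
From mathcomp Require Import all_classical all_reals all_analysis.
From mathcomp Require Import measurable_realfun ring lra.

Set Implicit Arguments.
Unset Strict Implicit.
Unset Printing Implicit Defensive.

Import Order.TTheory GRing.Theory Num.Theory.
Import numFieldNormedType.Exports.

Local Open Scope classical_set_scope.
Local Open Scope ring_scope.

(** * The pointwise inequality *)

(** The hypothesis on F bounds a classical divergence at almost every point, and such a bound says
    nothing about a singular part of the distributional divergence; the flux has to be shown to have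
    none. Its formal divergence contains |grad F|^(p-2) times second derivatives of F. For p < 2
    this weight blows up at critical points, and for a merely smooth F nothing relates its growth to
    the decay of the second derivatives. The quantity |u|^(q-1) |d_j u|, used with u = X_i F, is up
    to the factor 1/q the derivative of the root |u|^q; the exponents q = 1/m suffice because some
    1/m is at most p - 1.

    The critical set needs flatness twice, in different strength. Vanishing second derivatives
    already annihilate the regularised divergences. The unregularised flux, however, is only of size
    |grad F|^(p-1), and its derivative is seen to vanish only at points where X_i F is flat to an
    order that grows as p tends to 1.

    The quotient f / F is meaningful only off the zeros of F, and no measurability of its gradient
    is established; the terms containing it are therefore compared through lower integrals. *)

Lemma MVT_between (R : realType) (f df : R -> R) (x y : R) :
  (forall s, Num.min x y <= s <= Num.max x y -> is_derive s 1 f (df s)) ->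
  exists c, [/\ Num.min x y <= c <= Num.max x y, 0 <= (c - x) * (y - x) &
    f y - f x = df c * (y - x)].
Proof.
wlog xy : x y / x <= y => [hw|].
  case/orP: (le_total x y) => [|yx]; first exact: hw.
  rewrite minC maxC => /(hw _ _ yx)[c [cyx c0 e]]; exists c; split => //.
    have /andP[] := cyx; rewrite (min_idPl yx) (max_idPr yx) => yc cx.
    by rewrite mulr_le0// subr_le0.
  by rewrite -opprB e; ring.
rewrite (min_idPl xy) (max_idPr xy) => fd.
have [||c] := @MVT_segment _ f df x y xy.
- by move=> s; rewrite in_itv/= => /andP[? ?]; apply: fd; apply/andP; split; exact: ltW.
- apply: derivable_within_continuous => s; rewrite in_itv/= => sxy.
  by have [] := fd s sxy.
- rewrite in_itv/= => cxy e; exists c; split => //.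
  by case/andP: cxy => ? ?; rewrite mulr_ge0// subr_ge0.
Qed.

Section pointwise.
Context {R : realType}.
Implicit Types (p a b s : R).

Lemma ler_powR_antimono p a b : p <= 0 -> 0 < a -> a <= b -> b `^ p <= a `^ p.
Proof.
move=> p0 a0 ab; rewrite -[p]opprK (powRN a) (powRN b).
have b0 : 0 < b by exact: lt_le_trans ab.
rewrite lef_pV2 ?posrE ?powR_gt0//.
by apply: ge0_ler_powR; rewrite ?oppr_ge0// nnegrE ltW.
Qed.

Lemma powRD_gt0 a b s : 0 < a -> a `^ (b + s) = a `^ b * a `^ s.
Proof. by move=> a0; rewrite powRD// (gt_eqF a0) implybT. Qed.

(** As p < 2, the second derivative p (p - 1) s^(p-2) decreases in s, so between a and b it is at
    least its value at [Num.max a b]; half of that value is the coefficient of (b - a)^2. Two uses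
    of the mean value theorem replace Taylor's formula. *)
Lemma powR_taylor2 p a b : 1 < p -> p < 2 -> 0 < a -> 0 <= b ->
  p * (p - 1) / 2 * (b - a) ^+ 2 * Num.max a b `^ (p - 2) <=
  b `^ p - a `^ p - p * a `^ (p - 1) * (b - a).
Proof.
move=> p1 p2 a0; rewrite le_eqVlt => /predU1P[<-|b0].
  (* For b = 0 the segment ends at 0, where s^p has no second derivative; here the difference of the
     two sides is exactly (p - 1) (1 - p / 2) a^p. *)
  rewrite (max_idPl (ltW a0)) powR0 ?gt_eqF ?(lt_trans _ p1)//.
  have e1 : a `^ p = a ^+ 2 * a `^ (p - 2).
    rewrite -powR_mulrn ?(ltW a0)// -powRD_gt0//; congr (_ `^ _).
    by rewrite [RHS]addrC subrK.
  have e2 : a `^ (p - 1) = a * a `^ (p - 2).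
    rewrite -{2}[a]powRr1 ?(ltW a0)// -powRD_gt0//.
    by congr (_ `^ _); ring.
  rewrite e1 e2.
  have : 0 <= a ^+ 2 * a `^ (p - 2) by rewrite mulr_ge0 ?sqr_ge0 ?powR_ge0.
  move=> X0; rewrite -subr_ge0.
  have -> : forall z, 0 - a ^+ 2 * z - p * (a * z) * (0 - a) -
    p * (p - 1) / 2 * (0 - a) ^+ 2 * z = (p - 1) * (1 - p / 2) * (a ^+ 2 * z).
    by move=> z; field.
  by apply: mulr_ge0 => //; apply: mulr_ge0; lra.
set M := Num.max a b.
have dpow q s : 0 < s -> is_derive s 1 (fun s => s `^ q) (q * s `^ (q - 1)).
  by move=> s0; exact: is_derive1_powR.
have m0 s : Num.min a b <= s -> 0 < s.
  by apply: lt_le_trans; rewrite lt_min a0 b0.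
pose C := p * (p - 1) / 2.
pose K s := s `^ p - (p * a `^ (p - 1) * s + C * M `^ (p - 2) * (s - a) ^+ 2).
pose K' s := p * s `^ (p - 1) - (p * a `^ (p - 1) + C * M `^ (p - 2) * (2 * (s - a))).
have dK s : Num.min a b <= s <= M -> is_derive s 1 K (K' s).
  case/andP=> /m0 s0 _; have ds := dpow p s s0.
  rewrite /K.
  rewrite -[X in is_derive _ _ X _]/((fun s => s `^ p) - (cst (p * a `^ (p - 1)) * id + cst (C * M `^ (p - 2)) * ((id - cst a) ^+ 2))).
  apply: is_derive_eq; rewrite /K' /= /cst /=.
  rewrite -![_ *: _]/(_ * _) !(mulr0, addr0, mulr1, add0r, subr0, expr1).
  by congr (_ - (_ + _ * _)); rewrite -[X in _ = X]mulr1.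
have [c [/andP[mc cM] c0 eK]] := MVT_between dK.
(* The mean value theorem for s^(p-1) between a and c makes [K' c] a nonnegative multiple of c - a,
   and [c0] gives c - a the sign of b - a. *)
have : 0 <= K' c * (b - a).
  have dpow1 s : Num.min a c <= s <= Num.max a c ->
      is_derive s 1 (fun s => s `^ (p - 1)) ((p - 1) * s `^ (p - 1 - 1)).
    case/andP=> hs _; apply: dpow; apply: m0; apply: le_trans hs.
    by rewrite le_min ge_min lexx mc.
  have [d [/andP[md dM] d0 ed]] := MVT_between dpow1.
  rewrite -addrA -opprD in ed.
  have -> : K' c = p * (p - 1) * (d `^ (p - (1 + 1)) - M `^ (p - 2)) * (c - a).
    rewrite /K' /C; move: ed; set u := c `^ _; set v := a `^ _.
    move=> /eqP; rewrite subr_eq => /eqP ->; by field.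
  rewrite -mulrA mulr_ge0//; apply: mulr_ge0; first by nra.
  rewrite subr_ge0; apply: ler_powR_antimono; first by lra.
    by apply: lt_le_trans md; rewrite lt_min a0 (m0 _ mc).
  by apply: le_trans dM _; rewrite ge_max le_max lexx cM.
rewrite -eK /K subrr expr0n/= mulr0 addr0.
by rewrite -/C; lra.
Qed.

End pointwise.
Section euclid.
Context {R : realType} {n : nat}.
Implicit Types (u v w : 'rV[R]_n) (c : R).

Lemma dotvC u v : dotv u v = dotv v u.
Proof. by apply: eq_bigr => i _; rewrite mulrC. Qed.

Lemma dotvDl u v w : dotv (u + v) w = dotv u w + dotv v w.
Proof. by rewrite -big_split; apply: eq_bigr => i _; rewrite !mxE mulrDl. Qed.

Lemma dotvDr u v w : dotv w (u + v) = dotv w u + dotv w v.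
Proof. by rewrite dotvC dotvDl !(dotvC w). Qed.

Lemma dotvZl c u w : dotv (c *: u) w = c * dotv u w.
Proof. by rewrite mulr_sumr; apply: eq_bigr => i _; rewrite !mxE mulrA. Qed.

Lemma dotvZr c u w : dotv w (c *: u) = c * dotv w u.
Proof. by rewrite dotvC dotvZl dotvC. Qed.

Lemma dotv_ge0 u : 0 <= dotv u u.
Proof. by apply: sumr_ge0 => i _; rewrite -expr2 sqr_ge0. Qed.

Lemma enorm_ge0 u : 0 <= enorm u.
Proof. exact: sqrtr_ge0. Qed.

Lemma sqr_enorm u : enorm u ^+ 2 = dotv u u.
Proof. by rewrite sqr_sqrtr// dotv_ge0. Qed.

Lemma enormZ c u : enorm (c *: u) = `|c| * enorm u.
Proof. by rewrite /enorm dotvZl dotvZr mulrA -expr2 sqrtrM ?sqr_ge0// sqrtr_sqr. Qed.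

Lemma enorm_eq0 u : (enorm u == 0) = (u == 0).
Proof.
apply/eqP/eqP => [u0|->]; last first.
  by rewrite /enorm /dotv big1 ?sqrtr0// => i _; rewrite mxE mul0r.
have : dotv u u == 0 by rewrite -sqr_enorm u0 expr0n.
rewrite psumr_eq0 => [/allP/= h|i _]; last by rewrite -expr2 sqr_ge0.
apply/rowP => i; rewrite mxE; apply/eqP.
by have := h i (mem_index_enum _); rewrite mulf_eq0 orbb.
Qed.

Lemma enorm0 : enorm (0 : 'rV[R]_n) = 0.
Proof. by apply/eqP; rewrite enorm_eq0. Qed.

Lemma enorm_gt0 u : (0 < enorm u) = (u != 0).
Proof. by rewrite lt_def enorm_eq0 enorm_ge0 andbT. Qed.

Lemma dotv_le u v : dotv u v <= enorm u * enorm v.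
Proof.
have [->|u0] := eqVneq u 0.
  by rewrite enorm0 mul0r /dotv big1// => i _; rewrite mxE mul0r.
have [->|v0] := eqVneq v 0.
  by rewrite enorm0 mulr0 /dotv big1// => i _; rewrite mxE mulr0.
have ab0 : 0 < enorm u * enorm v by rewrite mulr_gt0// enorm_gt0.
(* The square of |v| u - |u| v is 2 |u| |v| (|u| |v| - u.v). *)
have := dotv_ge0 (enorm v *: u + (- enorm u) *: v).
rewrite !(dotvDl, dotvDr, dotvZl, dotvZr) -!sqr_enorm (dotvC v u).
move: ab0; set a := enorm u; set b := enorm v; set t := dotv u v => ab0 h.
rewrite -subr_ge0 -(pmulr_rge0 _ ab0) -(pmulr_rge0 _ (ltr0n R 2)).
by apply: le_trans h _; rewrite le_eqVlt; apply/orP; left; apply/eqP; ring.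
Qed.

Lemma ler_enormD u v : enorm (u + v) <= enorm u + enorm v.
Proof.
rewrite -ler_sqr ?nnegrE ?addr_ge0 ?enorm_ge0//.
rewrite sqrrD !sqr_enorm !(dotvDl, dotvDr) (dotvC v u).
have := dotv_le u v; rewrite mulr2n; lra.
Qed.

End euclid.

(** Put z = x + y, fix |x| and |z|, and weaken (|x| + |y|)^(p-2) to max(|x|, |z|)^(p-2). The left
    side is then affine and nondecreasing in x.z, so the worst case is x.z = |x| |z|. There |y|
    becomes | |z| - |x| |, and what remains is [powR_taylor2] for the two norms. *)
Lemma enorm_powR_ge (R : realType) (p : R) (n : nat) (x y : 'rV[R]_n) :
  1 < p -> p < 2 ->
  enorm x `^ p + p * (p - 1) / 2 *
      (enorm y ^+ 2 / (enorm x + enorm y) `^ (2 - p))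
    + p * enorm x `^ (p - 2) * dotv x y
  <= enorm (x + y) `^ p.
Proof.
move=> p1 p2.
have E q : (enorm x + enorm y) `^ q = ((enorm x + enorm y) `^ (- q))^-1.
  by rewrite powRN invrK.
(* A power of 0 with nonzero exponent is 0, so for x = 0 the inequality reduces to p (p - 1) / 2 <=
   1. *)
have [->|x0] := eqVneq x 0.
  rewrite enorm0 !powR0 ?add0r; last 2 first.
  - by rewrite subr_eq0 lt_eqF.
  - by rewrite gt_eqF// (lt_trans _ p1).
  rewrite mulr0 mul0r addr0.
  have [->|y0] := eqVneq y 0; first by rewrite enorm0 expr0n mul0r mulr0 powR_ge0.
  have b0 : 0 < enorm y by rewrite enorm_gt0.
  rewrite -powRN opprB -powR_mulrn ?enorm_ge0// -powRD_gt0// (addrC _ (p - 2)) subrK.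
  by rewrite -[leRHS]mul1r ler_wpM2r ?powR_ge0//; nra.
set z := x + y; have a0 : 0 < enorm x by rewrite enorm_gt0.
have ey : y = z - x by rewrite /z addrAC subrr add0r.
have zM : Num.max (enorm x) (enorm z) <= enorm x + enorm y.
  by rewrite ge_max lerDl enorm_ge0/= ler_enormD.
have M0 : 0 < Num.max (enorm x) (enorm z) by rewrite lt_max a0.
have key := powR_taylor2 p1 p2 a0 (enorm_ge0 z).
have -> : ((enorm x + enorm y) `^ (2 - p))^-1 = (enorm x + enorm y) `^ (p - 2).
  by rewrite -powRN opprB.
have p20 : p - 2 <= 0 by rewrite subr_le0 ltW.
have hM := ler_powR_antimono p20 M0 zM.
have hM' : Num.max (enorm x) (enorm z) `^ (p - 2) <= enorm x `^ (p - 2).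
  by apply: ler_powR_antimono => //; rewrite le_max lexx.
have exy : dotv x y = dotv x z - enorm x ^+ 2.
  by rewrite sqr_enorm /z dotvDr addrAC subrr add0r.
have eyy : enorm y ^+ 2 = enorm x ^+ 2 + enorm z ^+ 2 - 2 * dotv x z.
  by rewrite !sqr_enorm /z !(dotvDl, dotvDr) (dotvC y x); ring.
have e1 : enorm x `^ (p - 1) = enorm x * enorm x `^ (p - 2).
  rewrite -{2}[enorm x]powRr1 ?(ltW a0)// -powRD_gt0//; congr (_ `^ _); ring.
have e2 : enorm x `^ p = enorm x ^+ 2 * enorm x `^ (p - 2).
  by rewrite -powR_mulrn ?(ltW a0)// -powRD_gt0//; congr (_ `^ _); ring.
rewrite exy.
have t0 : 0 <= enorm x * enorm z - dotv x z by rewrite subr_ge0 dotv_le.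
move: key; rewrite e1.
set A := enorm x `^ (p - 2) in hM' *; set B := Num.max _ _ `^ (p - 2) in hM hM' * => key.
have D0 : 0 <= enorm y ^+ 2 by rewrite sqr_ge0.
set C := p * (p - 1) / 2 in key *.
have C0 : 0 <= C by rewrite /C divr_ge0// mulr_ge0//; lra.
have h1 : C * (enorm y ^+ 2 * (enorm x + enorm y) `^ (p - 2)) <= C * (enorm y ^+ 2 * B).
  by rewrite !ler_wpM2l.
(* Monotonicity in x.z: the slope is p (A - B) + p (2 - p) B, nonnegative because B <= A. *)
have h2 : 0 <= (p * A - 2 * C * B) * (enorm x * enorm z - dotv x z).
  apply: mulr_ge0 => //; rewrite /C.
  have B0 : 0 <= B by exact: powR_ge0.
  have -> : p * A - 2 * (p * (p - 1) / 2) * B = p * (A - B) + p * (2 - p) * B.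
    by field.
  by apply: addr_ge0; apply: mulr_ge0 => //; [lra|lra|apply: mulr_ge0; lra].
move: key; rewrite e2 -/A => key.
rewrite eyy in h1 *.
apply: le_trans (_ : enorm x ^+ 2 * A + C * ((enorm x ^+ 2 + enorm z ^+ 2 - 2 * dotv x z) * B) + p * A * (dotv x z - enorm x ^+ 2) <= _).
  by rewrite lerD2r lerD2l.
rewrite -subr_ge0 in key; rewrite -subr_ge0.
apply: le_trans (addr_ge0 key h2) _; rewrite le_eqVlt; apply/orP; left.
by apply/eqP; ring.
Qed.

(** * Directional calculus *)

Section directional.
Context {R : realType} {V : normedModType R}.
Implicit Types (f g : V -> R) (x v w : V).

(** [Ck] speaks of directional derivatives only, so the chain rule and the mean value theorem are
    obtained by restricting to lines, where the one-variable rules apply. *)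
Lemma is_derive_line (W : normedModType R) (f : V -> W) x v (t : R) df :
  is_derive (t *: v + x) v f df ->
  is_derive t 1 (fun s : R => f (s *: v + x)) df.
Proof.
have E : (fun h : R => h^-1 *: (((fun s : R => f (s *: v + x)) \o shift t) (h *: 1)
    - f (t *: v + x))) =
  (fun h => h^-1 *: ((f \o shift (t *: v + x)) (h *: v) - f (t *: v + x))).
  apply/funext => h /=; congr (_ *: (f _ - _)).
  by rewrite scalerDl addrA; congr (_ *: _ + _ + _); rewrite -[_ *: _]/(h * 1) mulr1.
move=> [fd fE]; split.
  by rewrite /derivable E.
by rewrite /derive E.
Qed.

Lemma is_derive_line0 (W : normedModType R) (f : V -> W) x v df :
  is_derive (0 : R) 1 (fun s : R => f (s *: v + x)) df ->
  is_derive x v f df.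
Proof.
have E : (fun h : R => h^-1 *: (((fun s : R => f (s *: v + x)) \o shift 0) (h *: 1)
    - f (0 *: v + x))) =
  (fun h => h^-1 *: ((f \o shift x) (h *: v) - f x)).
  apply/funext => h /=; rewrite scale0r add0r addr0; congr (_ *: (f _ - _)).
  by congr (_ *: _ + _); rewrite -[_ *: _]/(h * 1) mulr1.
move=> [fd fE]; split.
  by move: fd; rewrite /derivable E.
by move: fE; rewrite /derive E.
Qed.

Lemma is_derive_line_at0 (W : normedModType R) (f : V -> W) x v df :
  is_derive x v f df -> is_derive (0 : R) 1 (fun s : R => f (s *: v + x)) df.
Proof. by move=> fd; apply: is_derive_line; rewrite scale0r add0r. Qed.

Lemma is_derive_cst_pt (c : R) x v : is_derive x v (fun _ : V => c) 0.
Proof. exact: is_derive_cst. Qed.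

Lemma is_deriveD_pt f g x v df dg : is_derive x v f df -> is_derive x v g dg ->
  is_derive x v (fun z => f z + g z) (df + dg).
Proof. by move=> ? ?; exact: is_deriveD. Qed.

Lemma is_deriveM_pt f g x v df dg : is_derive x v f df -> is_derive x v g dg ->
  is_derive x v (fun z => f z * g z) (f x * dg + g x * df).
Proof. by move=> ? ?; exact: is_deriveM. Qed.

Lemma is_derive_sqr_pt f x v df : is_derive x v f df ->
  is_derive x v (fun x => f x ^+ 2) (2 * (f x * df)).
Proof.
move=> fd; have -> : (fun x => f x ^+ 2) = fun x => f x * f x.
  by apply/funext => y; rewrite expr2.
apply: is_derive_eq (is_deriveM_pt fd fd) _; ring.
Qed.

Lemma is_derive_sum_pt n (f : 'I_n -> V -> R) x v df :
  (forall i, is_derive x v (f i) (df i)) ->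
  is_derive x v (fun z => \sum_i f i z) (\sum_i df i).
Proof.
move=> fd; have := is_derive_sum (h := f) (dh := df) _ => /(_ _ _ fd).
by rewrite (_ : \sum_i f i = fun z => \sum_i f i z)//; apply/funext => z; rewrite fct_sumE.
Qed.

Lemma is_derive_comp_pt f (g : R -> R) x v df dg :
  is_derive x v f df -> is_derive (f x) 1 g dg ->
  is_derive x v (fun z => g (f z)) (dg * df).
Proof.
move=> fd gd; apply: is_derive_line0.
have fd' : is_derive (0 : R) 1 (fun s : R => f (s *: v + x)) df.
  by apply: is_derive_line; rewrite scale0r add0r.
apply: (@is_derive1_comp _ g (fun s : R => f (s *: v + x))).
by rewrite scale0r add0r.
Qed.

Lemma derive_is f x v df : is_derive x v f df -> 'D_v f x = df.
Proof. by case. Qed.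

Lemma is_derive_scale_dir f x v (c : R) df :
  is_derive x v f df -> is_derive x (c *: v) f (c * df).
Proof.
move=> fd; apply: is_derive_line0.
pose h := (fun s : R => f (s *: v + x)).
have -> : (fun s : R => f (s *: (c *: v) + x)) = h \o ( *%R^~ c).
  by apply/funext => s /=; rewrite scalerA.
rewrite mulrC.
have hd : is_derive (0 * c) 1 h df.
  by apply: is_derive_line; rewrite mul0r scale0r add0r.
have cd : is_derive (0 : R) 1 ( *%R^~ c) c.
  have := is_deriveM (is_derive_id (0 : R) 1) (is_derive_cst c (0 : R) 1).
  by rewrite scaler0 add0r -[_ *: _]/(c * 1) mulr1.
exact: is_derive1_comp.
Qed.

Lemma MVT_line f x v : (forall z, derivable f z v) -> forall t : R,
  exists2 c, `|c| <= `|t| & f (t *: v + x) - f x = t * 'D_v f (c *: v + x).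
Proof.
move=> fd t.
have [s _|c [/andP[c1 c2] _ e]] := @MVT_between _ (fun s : R => f (s *: v + x))
   (fun s : R => 'D_v f (s *: v + x)) 0 t.
  by apply: is_derive_line; exact: derivableP.
exists c; last by move: e; rewrite scale0r add0r subr0 mulrC.
case: (leP 0 t) c1 c2 => t0 c1 c2; first by rewrite !ger0_norm.
by rewrite !ler0_norm ?lerN2// ltW.
Qed.

End directional.

Section Ck.
Context {R : realType} {V : normedModType R}.
Implicit Types (f g : V -> R) (x v w : V).

Lemma Ck1_intro f (df : V -> V -> R) : continuous f ->
  (forall x v, is_derive x v f (df x v)) -> (forall v, continuous (df ^~ v)) ->
  Ck 1 f.
Proof.
move=> fc fd dc; split => // v.
have -> : 'D_v f = df ^~ v; last exact: dc.
by apply/funext => x; have [] := fd x v.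
Qed.

Lemma Ck_cont (W : normedModType R) k (f : V -> W) : Ck k f -> continuous f.
Proof. by case: k => [//|k [? _ _]]. Qed.

Lemma CkS (W : normedModType R) k (f : V -> W) : Ck k.+1 f -> Ck k f.
Proof.
elim: k f => [|k ih] f; first by case.
by move=> [fc fd fD]; split => // v; exact/ih/fD.
Qed.

Lemma Ck_le (W : normedModType R) k l (f : V -> W) : (l <= k)%N -> Ck k f -> Ck l f.
Proof.
elim: k => [|k ih]; first by rewrite leqn0 => /eqP ->.
by rewrite leq_eqVlt => /predU1P[->//|]; rewrite ltnS => /ih h /CkS.
Qed.

Lemma Ck1_derivable f x v : Ck 1 f -> derivable f x v.
Proof. by move=> [_ fd _]. Qed.

Lemma Ck1_is_derive f x v : Ck 1 f -> is_derive x v f ('D_v f x).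
Proof. by move=> [_ fd _]; exact/derivableP/fd. Qed.

Lemma Ck_cst k (c : R) : Ck k (fun _ : V => c).
Proof.
elim: k c => [|k ih] c; first by move=> x; exact: cst_continuous.
split=> [x|x v|v]; [exact: cst_continuous|exact: derivable_cst|].
by have -> : 'D_v (fun=> c) = (fun _ : V => 0); [apply/funext => x; exact: derive_cst|exact: ih].
Qed.

Lemma CkD k f g : Ck k f -> Ck k g -> Ck k (fun x => f x + g x).
Proof.
elim: k f g => [|k ih] f g; first by move=> fc gc x; apply: cvgD; [exact: fc|exact: gc].
move=> [fc fd fD] [gc gd gD]; split => [x|x v|v].
- by apply: cvgD; [exact: fc|exact: gc].
- exact: derivableD.
- have -> : 'D_v (fun x => f x + g x) = (fun x => 'D_v f x + 'D_v g x).
    by apply/funext => x; exact: deriveD.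
  by apply: ih; [exact: fD|exact: gD].
Qed.

Lemma CkM k f g : Ck k f -> Ck k g -> Ck k (fun x => f x * g x).
Proof.
elim: k f g => [|k ih] f g; first by move=> fc gc x; apply: cvgM; [exact: fc|exact: gc].
move=> /[dup] /CkS fk [fc fd fD] /[dup] /CkS gk [gc gd gD]; split => [x|x v|v].
- by apply: cvgM; [exact: fc|exact: gc].
- exact: derivableM.
- have -> : 'D_v (fun x => f x * g x) = (fun x => f x * 'D_v g x + g x * 'D_v f x).
    by apply/funext => x; exact: deriveM.
  by apply: CkD; apply: ih => //; [exact: gD|exact: fD].
Qed.

Lemma Ck_sum k (I : Type) (r : seq I) (f : I -> V -> R) :
  (forall i, Ck k (f i)) -> Ck k (fun x => \sum_(i <- r) f i x).
Proof.
move=> fk; elim: r => [|i r ih].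
  by under eq_fun do rewrite big_nil; exact: Ck_cst.
by under eq_fun do rewrite big_cons; exact: CkD.
Qed.

(** Additivity in the direction is not automatic for directional derivatives; it comes from the
    continuity of 'D_w f. The increment of f along h (v + w) is split at x + h v, and the mean value
    theorem turns its second part into h times 'D_w f at a point that tends to x. *)
Lemma deriveD_dir f x v w : Ck 1 f -> 'D_(v + w) f x = 'D_v f x + 'D_w f x.
Proof.
move=> [fc fd fD]; apply/eqP; rewrite [eqbRHS]addrC -subr_eq; apply/eqP.
pose q (h : R) := h^-1 *: (f (h *: w + (h *: v + x)) - f (h *: v + x)).
have q1 : q h @[h --> 0^'] --> 'D_(v + w) f x - 'D_v f x.
  have -> : q = (fun h => h^-1 *: ((f \o shift x) (h *: (v + w)) - f x)
               - h^-1 *: ((f \o shift x) (h *: v) - f x)).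
    apply/funext => h; rewrite /q /= -scalerBr; congr (_ *: _).
    have -> : f (h *: w + (h *: v + x)) = f (h *: (v + w) + x).
      by congr f; rewrite scalerDr addrA; congr (_ + _); exact: addrC.
    by rewrite opprB addrA subrK.
  by apply: cvgB; exact: fd.
have q2 : q h @[h --> 0^'] --> 'D_w f x.
  apply/cvgrPdist_le => e e0.
  have /cvgrPdist_le/(_ _ e0) := fD w x.
  move=> /nbhs_ballP[/= d d0 hd].
  near=> h.
  have h0 : h != 0 by near: h; exact: nbhs_dnbhs_neq.
  have [c ch e1] := @MVT_line _ _ f (h *: v + x) w (fd ^~ w) h.
  rewrite /q e1 -[_ *: _]/(h^-1 * (h * _)) mulKf//; apply: hd.
  rewrite -ball_normE /ball_/= addrA opprD addrCA subrr addr0 normrN.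
  apply: le_lt_trans (ler_normD _ _) _; rewrite !normrZ.
  apply: (@le_lt_trans _ _ (`|h| * (`|w| + `|v|))).
    by rewrite mulrDr lerD// ler_wpM2r.
  apply: (@le_lt_trans _ _ (`|h| * (`|w| + `|v| + 1))).
    by rewrite ler_wpM2l// lerDl.
  rewrite -ltr_pdivlMr; last by rewrite ltr_wpDl// addr_ge0.
  near: h; apply: dnbhs0_lt; rewrite divr_gt0// ltr_wpDl// addr_ge0//.
exact: (cvg_unique _ q1 q2).
Unshelve. all: by end_near. Qed.

Lemma deriveZ_dir f x v c : Ck 1 f -> 'D_(c *: v) f x = c * 'D_v f x.
Proof. by move=> fC; apply/derive_is/is_derive_scale_dir/Ck1_is_derive. Qed.

Lemma derive_sum_dir f x (I : Type) (r : seq I) (v : I -> V) : Ck 1 f ->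
  'D_(\sum_(i <- r) v i) f x = \sum_(i <- r) 'D_(v i) f x.
Proof.
move=> fC; elim: r => [|i r ih]; first by rewrite !big_nil derive0.
by rewrite !big_cons deriveD_dir// ih.
Qed.

Lemma Ck1_comp f (g dg : R -> R) : Ck 1 f ->
  (forall x, is_derive (f x) 1 g (dg (f x))) ->
  (forall x, {for f x, continuous dg}) ->
  Ck 1 (fun x => g (f x)).
Proof.
move=> fC gd gc; have fc := Ck_cont fC; have [_ _ fD] := fC.
apply: (@Ck1_intro _ (fun x v => dg (f x) * 'D_v f x)).
- move=> x; apply: (continuous_comp (fc x)).
  by have [gx _] := gd x; exact/differentiable_continuous/derivable1_diffP.
- by move=> x v; exact: (is_derive_comp_pt (Ck1_is_derive x v fC) (gd x)).
- move=> v x; apply: cvgM; last exact: fD.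
  exact: (continuous_comp (fc x) (gc x)).
Qed.

End Ck.

Section rowvec.
Context {R : realType} {n : nat}.
Local Notation V := 'rV[R]_n.

Definition basis (j : 'I_n) : V := delta_mx ord0 j.

Lemma derive_basis (f : V -> R) x v : Ck 1 f ->
  'D_v f x = \sum_j v ord0 j * 'D_(basis j) f x.
Proof.
move=> fC; rewrite {1}[v]row_sum_delta derive_sum_dir//.
by apply: eq_bigr => j _; rewrite deriveZ_dir.
Qed.

End rowvec.

Lemma Ck_linear_comp (R : realType) (U V W : normedModType R) (L : U -> V)
    (f : V -> W) k : linear L -> continuous L -> Ck k f -> Ck k (fun x => f (L x)).
Proof.
move=> Ll Lc; elim: k f => [|k ih] f.
  by move=> fc x; apply: (continuous_comp (Lc x)); exact: fc.
move=> [fc fd fD].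
have E x v : (fun h : R => h^-1 *: (((fun x => f (L x)) \o shift x) (h *: v) - f (L x)))
   = (fun h => h^-1 *: ((f \o shift (L x)) (h *: L v) - f (L x))).
  by apply/funext => h /=; rewrite Ll.
split => [x|x v|v].
- by apply: (continuous_comp (Lc x)); exact: fc.
- by rewrite /derivable E; exact: fd.
- have -> : 'D_v (fun x => f (L x)) = (fun x => 'D_(L v) f (L x)).
    by apply/funext => x; rewrite /derive E.
  exact: (ih _ (fD (L v))).
Qed.

Lemma Ck_coord (R : realType) (V : normedModType R) n (f : V -> 'rV[R]_n) k j :
  Ck k f -> Ck k (fun x => f x ord0 j).
Proof.
elim: k f => [|k ih] f.
  by move=> fc x; exact: (@continuous_comp _ _ _ f (fun M : 'rV[R]_n => M ord0 j) x (fc x) (@coord_continuous _ _ _ ord0 j _)).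
move=> [fc fd fD].
split => [x|x v|v].
- by exact: (@continuous_comp _ _ _ f (fun M : 'rV[R]_n => M ord0 j) x (fc x) (@coord_continuous _ _ _ ord0 j _)).
- exact: (derivable_mxP _ _ _).1.
- have -> : 'D_v (fun x => f x ord0 j) = (fun x => 'D_v f x ord0 j).
    by apply/funext => x; rewrite derive_mx// mxE.
  exact: (ih _ (fD v)).
Qed.

(** * Borel sets and integration on row vectors *)

Section borel_rV.
Context {R : realType}.

Lemma rV_norm_coord n (v : 'rV[R]_n) i : `|v ord0 i| <= `|v|.
Proof.
rewrite [leRHS]/Num.Def.normr /= mx_normrE; exact: (le_bigmax _ (fun ij : 'I_1 * 'I_n => `|v ij.1 ij.2|) (ord0, i)).
Qed.

Lemma rV_norm_le n (v : 'rV[R]_n) e : 0 <= e -> (forall i, `|v ord0 i| <= e) -> `|v| <= e.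
Proof.
move=> e0 h; rewrite [leLHS]/Num.Def.normr /= mx_normrE; apply: bigmax_le => // -[i j] _ /=.
by rewrite ord1.
Qed.

Lemma box_measurable n (A : 'I_n -> set (measurableTypeR R)) :
  (forall i, measurable (A i)) ->
  measurable [set v : 'rV[R]_n | forall i, A i (v ord0 i)].
Proof.
move=> mA.
rewrite (_ : mkset _ = \big[setI/setT]_(i < n)
    ((fun v : 'rV[R]_n => v ord0 i) @^-1` A i)).
  apply: bigsetI_measurable => i _.
  rewrite -[X in measurable X]setTI.
  exact: (measurable_coord_rV i measurableT (mA i)).
rewrite -bigcap_seq; apply/seteqP; split=> v /= Av i.
  by move=> _; exact: Av.
by apply: (Av i); rewrite /= mem_index_enum.
Qed.

(** The sigma-algebra is generated by the coordinates, so U is written as a countable union of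
    boxes: those with rational centre and radius 1 / (k + 1) that are contained in U, enumerated
    through [unpickle]. *)
Lemma open_measurable_rV n (U : set 'rV[R]_n) : open U -> measurable U.
Proof.
move=> oU.
pose box (z : 'rV[rat]_n * nat) : set 'rV[R]_n :=
  [set v | forall i, ball (ratr (z.1 ord0 i) : R) z.2.+1%:R^-1 (v ord0 i)].
have mbox z : measurable (box z).
  by apply: (@box_measurable n (fun i => ball (ratr (z.1 ord0 i) : R) z.2.+1%:R^-1)) => i; exact: measurable_ball.
pose B k : set 'rV[R]_n :=
  if (unpickle k : option ('rV[rat]_n * nat)) is Some z then
    if asbool (box z `<=` U) then box z else set0 else set0.
suff -> : U = \bigcup_k B k.
  apply: bigcupT_measurable => k; rewrite /B.
  by case: unpickle => [z|//]; case: ifP.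
apply/seteqP; split => [v Uv|v [k _]]; last first.
  by rewrite /B; case: unpickle => [z|//]; case: ifPn => // /asboolP; exact.
move: oU; rewrite openE => /(_ _ Uv) /nbhs_ballP[/= e e0 he].
have e20 : 0 < e / 2 by rewrite divr_gt0.
have [k ke] : exists k : nat, k.+1%:R^-1 < e / 2.
  exists (Num.truncn (e / 2)^-1).
  by rewrite -[ltRHS]invrK ltf_pV2 ?posrE ?invr_gt0// truncnS_gt.
have dk : 0 < k.+1%:R^-1 :> R by rewrite invr_gt0.
have hq i : exists q : rat, ball (ratr q : R) k.+1%:R^-1 (v ord0 i).
  have /rat_in_itvoo[q] : v ord0 i - k.+1%:R^-1 < v ord0 i + k.+1%:R^-1.
    by rewrite ltrBlDr -addrA ltrDl addr_gt0.
  rewrite in_itv/= => qv; exists q.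
  by rewrite -ball_normE/= ltr_distl.
pose q : 'rV[rat]_n := \row_i projT1 (cid (hq i)).
have qE i : ball (ratr (q ord0 i) : R) k.+1%:R^-1 (v ord0 i).
  by rewrite mxE; case: cid.
exists (pickle (q, k)) => //; rewrite /B pickleK; case: ifPn => [_|/negP].
  exact: qE.
case; apply/asboolP => w wb; apply: he; split => // i j; rewrite ord1.
rewrite (splitr e); apply: (@ball_triangle _ _ (ratr (q ord0 j) : R)).
  by apply: (@le_ball _ _ _ k.+1%:R^-1); [exact: ltW|apply: ball_sym; exact: qE].
by apply: (@le_ball _ _ _ k.+1%:R^-1); [exact: ltW|exact: wb].
Qed.

Lemma continuous_measurable_rV n (f : 'rV[R]_n -> R) :
  continuous f -> measurable_fun setT f.
Proof.
move=> /continuousP cf; apply: (measurability _ (RGenOpens.measurableE R)).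
move=> _ [_ [a [b ->] <-]]; rewrite setTI; apply: open_measurable_rV.
exact/cf/interval_open.
Qed.

End borel_rV.

Section bounded_support.
Context {R : realType} {V : normedModType R}.
Implicit Types f g : V -> R.

(** Preferred to compactness of the closure because products inherit it from either factor and
    derivatives keep the same bound M. *)
Definition bounded_support f := exists M, forall x, f x != 0 -> `|x| <= M.

Lemma compactly_supported_bounded f : compactly_supported f -> bounded_support f.
Proof.
move=> /compact_bounded[M [_ hM]]; exists (M + 1) => x fx.
by apply: hM; [rewrite ltrDl|exact: subset_closure].
Qed.

Lemma bounded_support_sub f g : bounded_support f ->
  (forall x, f x = 0 -> g x = 0) -> bounded_support g.
Proof.
move=> [M hM] fg; exists M => x gx; apply: hM; apply: contra_neq gx; exact: fg.
Qed.

Lemma bounded_supportMl f g : bounded_support f -> bounded_support (fun x => f x * g x).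
Proof. by move=> /bounded_support_sub; apply => x ->; rewrite mul0r. Qed.

Lemma bounded_supportMr f g : bounded_support g -> bounded_support (fun x => f x * g x).
Proof. by move=> /bounded_support_sub; apply => x ->; rewrite mulr0. Qed.

Lemma bounded_supportD f g : bounded_support f -> bounded_support g ->
  bounded_support (fun x => f x + g x).
Proof.
move=> [M hM] [L hL]; exists (Num.max M L) => x; rewrite le_max.
have [->|f0 _] := eqVneq (f x) 0; last by rewrite hM.
by rewrite add0r => /hL ->; rewrite orbT.
Qed.

Lemma derive_bounded_support f M v : (forall x, f x != 0 -> `|x| <= M) ->
  forall x, 'D_v f x != 0 -> `|x| <= M.
Proof.
move=> hM x; apply: contraNle => Mx.
rewrite (@near_eq_derive _ _ _ _ (cst 0)) ?derive_cst//.
have : \forall y \near x, M < `|y|.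
  exact: (cvgr_gt _ (@norm_continuous _ V x) _ Mx).
apply: filterS => y My; apply/eqP; apply: contraTT My => /hM.
by rewrite -leNgt.
Qed.

End bounded_support.

Section integrable_rV.
Context {R : realType} {n : nat}.
Local Notation V := 'rV[R]_n.
Local Notation mu := (lebesgue_rV n).
Implicit Types f g h : V -> R.

Definition cube (M : R) : set V := [set v | forall i, v ord0 i \in `[- M, M]].

Lemma measurable_cube M : measurable (cube M).
Proof. by apply: (@box_measurable _ _ (fun=> `[- M, M]%classic)) => i; exact: measurable_itv. Qed.

Lemma cube_finite M : (mu (cube M) < +oo)%E.
Proof.
have := @lebesgue_rV_box R n (fun=> `[- M, M]%classic) (fun=> measurable_itv _).
move=> e; rewrite /cube [X in (X < _)%E]e.
set X := (X in (X < _)%E); suff /fineK <- : X \is a fin_num by exact: ltry.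
apply: (big_ind (fun x => x \is a fin_num)) => // [x y|i _]; first exact: fin_numM.
by rewrite /= lebesgue_measure_itv/=; case: ifP.
Qed.

Lemma compact_cube M : compact (cube M).
Proof.
by apply: (@rV_compact _ _ (fun=> `[- M, M]%classic)) => i; exact: segment_compact.
Qed.

Lemma bounded_support_cube f M : (forall x, f x != 0 -> `|x| <= M) ->
  forall x, ~ cube M x -> f x = 0.
Proof.
move=> fM x; apply: contra_notP => /eqP/fM xM i.
by rewrite in_itv/= -ler_norml (le_trans (rV_norm_coord _ _)).
Qed.

Lemma bounded_support_integrable f C : measurable_fun setT f ->
  (forall x, `|f x| <= C) -> bounded_support f -> mu.-integrable setT (EFin \o f).
Proof.
move=> mf fC [M fM].
have -> : EFin \o f = (EFin \o f) \_ (cube M).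
  apply/funext => x; rewrite patchE; case: ifPn => // /negP xM /=.
  by rewrite (bounded_support_cube fM)// => xM'; apply: xM; rewrite inE.
apply/integrable_restrict => //; first exact: measurable_cube.
rewrite setTI; apply: measurable_bounded_integrable.
- exact: measurable_cube.
- exact: cube_finite.
- exact: measurable_funTS.
- exists C; split; first exact: num_real.
  by move=> D CD x _ /=; rewrite (le_trans (fC x))// ltW.
Qed.

Lemma continuous_bounded_support f : continuous f -> bounded_support f ->
  exists C, forall x, `|f x| <= C.
Proof.
move=> fc [M fM].
have : compact (f @` cube M).
  by apply: continuous_compact; [exact: continuous_subspaceT|exact: compact_cube].
move=> /compact_bounded[L [_ hL]]; exists (`|L| + 1) => x.
have [xM|/(bounded_support_cube fM) ->] := pselect (cube M x); last by rewrite normr0 addr_ge0.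
by apply: hL; [rewrite ltr_pwDr// ler_norm|exists x].
Qed.

Lemma continuous_integrable f : continuous f -> bounded_support f ->
  mu.-integrable setT (EFin \o f).
Proof.
move=> fc fb; have [C fC] := continuous_bounded_support fc fb.
by apply: bounded_support_integrable fb; [exact: continuous_measurable_rV|exact: fC].
Qed.

End integrable_rV.

Section integral_derivative.
Context {R : realType}.

Lemma integral_lebesgue_rVS n (g : 'rV[R]_n.+1 -> R) :
  (lebesgue_rV n.+1).-integrable setT (EFin \o g) ->
  (lebesgue_measure \x lebesgue_rV n)%E.-integrable setT
     (fun z => (g (cons_rV z))%:E) /\
  (\int[lebesgue_rV n.+1]_x (g x)%:E =
   \int[(lebesgue_measure \x lebesgue_rV n)%E]_z (g (cons_rV z))%:E)%E.
Proof.
move=> ig.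
have mg : measurable_fun setT (EFin \o g) by case/integrableP: ig.
have mc := @measurable_cons_rV R n.
have ig' : (lebesgue_measure \x lebesgue_rV n)%E.-integrable setT
     (fun z => (g (cons_rV z))%:E).
  apply/integrableP; split.
    exact: (measurableT_comp mg mc).
  case/integrableP: ig => _; apply: le_lt_trans.
  rewrite -[leRHS]/(\int[pushforward (lebesgue_measure \x lebesgue_rV n)%E (@cons_rV R n)]_x `|(g x)%:E|)%E.
  by rewrite ge0_integral_pushforward// ; exact: measurableT_comp.
split => //.
rewrite -[LHS]/(\int[pushforward (lebesgue_measure \x lebesgue_rV n)%E (@cons_rV R n)]_x (g x)%:E)%E.
by rewrite (integral_pushforward mc mg).
Qed.

Lemma integral_derive1_eq0 (h dh : R -> R) : continuous dh ->
  (forall x : R, is_derive x 1 h (dh x)) -> bounded_support h ->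
  (\int[@lebesgue_measure R]_x (dh x)%:E = 0)%E.
Proof.
move=> dc hd [M hM].
have dhM x : dh x != 0 -> `|x| <= M.
  have -> : dh = 'D_1 h by apply/funext => y; have [] := hd y.
  exact: derive_bounded_support.
pose a : R := `|M| + 1.
have Ma : M < a by rewrite /a ltr_pwDr// ler_norm.
have a0 : - a < a.
  by rewrite -subr_gt0 opprK addr_gt0// /a ltr_wpDl.
have out x : a <= `|x| -> h x = 0.
  by move=> ax; apply/eqP; apply: contraTT ax => /hM xM; rewrite -ltNge (le_lt_trans xM).
have -> : (\int[@lebesgue_measure R]_x (dh x)%:E = \int[@lebesgue_measure R]_(x in `[(- a)%R, a]) (dh x)%:E)%E.
  rewrite [RHS]integral_mkcond; apply: eq_integral => x _; rewrite patchE.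
  case: ifPn => //; rewrite notin_setE/= in_itv/= -ler_norml => /negP.
  rewrite -ltNge => ax; congr EFin; apply/eqP; apply: contraTT ax => /dhM xM.
  by rewrite -leNgt (le_trans xM)// ltW.
have hc : continuous h.
  by move=> x; apply/differentiable_continuous/derivable1_diffP; have [] := hd x.
rewrite (@continuous_FTC2 _ dh h)//.
- by rewrite !out ?subee// ?normrN ler_norm.
- exact: continuous_subspaceT.
- split => [x _||]; first by have [] := hd x.
    exact/cvg_at_right_filter/hc.
  exact/cvg_at_left_filter/hc.
- by move=> x _; rewrite derive1E; have [] := hd x.
Qed.

Lemma cons_rV_lift n (a : R) (v : 'rV[R]_n) i : cons_rV (a, v) ord0 (lift ord0 i) = v ord0 i.
Proof.
rewrite /cons_rV /=; have -> : lift ord0 i = rshift 1 i by exact: val_inj.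
by rewrite (@row_mxEr _ 1 1 n).
Qed.

Lemma cons_rVP n (w : 'rV[R]_n.+1) (a : R) (v : 'rV[R]_n) : w ord0 ord0 = a ->
  (forall i, w ord0 (lift ord0 i) = v ord0 i) -> w = cons_rV (a, v).
Proof.
move=> wa wv; apply/rowP => i; case: (unliftP ord0 i) => [j|] ->.
  by rewrite wv cons_rV_lift.
by rewrite cons_rV_head.
Qed.

Lemma continuous_cons_rV n (a : R) : continuous (fun v : 'rV[R]_n => cons_rV (a, v)).
Proof.
move=> v A /nbhs_ballP[e e0 eA]; apply/nbhs_ballP; exists e => //= w [_ vw].
apply: eA; split => // i j; rewrite (ord1 i); case: (unliftP ord0 j) => [k|] ->.
  by rewrite !cons_rV_lift.
by rewrite !cons_rV_head; exact: ballxx.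
Qed.

Lemma continuous_cons_rV1 n (v : 'rV[R]_n) : continuous (fun a : R => cons_rV (a, v)).
Proof.
move=> a A /nbhs_ballP[e e0 eA]; apply/nbhs_ballP; exists e => //= b ab.
apply: eA; split => // i j; rewrite (ord1 i); case: (unliftP ord0 j) => [k|] ->.
  by rewrite !cons_rV_lift; exact: ballxx.
by rewrite !cons_rV_head.
Qed.

(** Fubini, with the order of integration chosen by j. If j is the first coordinate, it is
    integrated innermost and the one-variable case applies; otherwise the first coordinate is frozen
    and the induction hypothesis applies to the slice. *)
Lemma integral_derive_basis n (j : 'I_n) (h dh : 'rV[R]_n -> R) :
  continuous h -> bounded_support h -> continuous dh ->
  (forall x, is_derive x (basis j) h (dh x)) ->
  (\int[lebesgue_rV n]_x (dh x)%:E = 0)%E.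
Proof.
elim: n j h dh => [[]//|n ih] j h dh hc [M hM] dc hd.
have ib : (lebesgue_rV n.+1).-integrable setT (EFin \o dh).
  apply: continuous_integrable => //; exists M.
  have -> : dh = 'D_(basis j) h by apply/funext => y; have [] := hd y.
  exact: derive_bounded_support.
have [ig ->] := integral_lebesgue_rVS ib.
have normc a (v : 'rV[R]_n) : `|v| <= `|cons_rV (a, v)| /\ `|a| <= `|cons_rV (a, v)|.
  split; first by apply: rV_norm_le => // i; rewrite -(cons_rV_lift a); exact: rV_norm_coord.
  by have := rV_norm_coord (cons_rV (a, v)) ord0; rewrite cons_rV_head.
case: (unliftP ord0 j) => [k|] jE.
  rewrite -(integral12_prod_meas1 ig) integral0_eq// => a _.
  apply: (ih k (fun v => h (cons_rV (a, v))) (fun v => dh (cons_rV (a, v)))).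
  - by move=> v; apply: continuous_comp; [exact: continuous_cons_rV|exact: hc].
  - by exists M => v /hM; apply: le_trans; case: (normc a v).
  - by move=> v; apply: continuous_comp; [exact: continuous_cons_rV|exact: dc].
  - move=> v; apply: is_derive_line0.
    rewrite (_ : (fun s => _) = fun s : R => h (s *: basis j + cons_rV (a, v))).
      by apply: is_derive_line; rewrite scale0r add0r; exact: hd.
    apply/funext => s; congr h; apply/esym/cons_rVP => [|i].
      by rewrite 3!mxE cons_rV_head jE/= mulr0 add0r.
    by rewrite 3!mxE cons_rV_lift jE !mxE (inj_eq lift_inj).
rewrite -(integral21_prod_meas1 ig) integral0_eq// => v _.
apply: (@integral_derive1_eq0 (fun a => h (cons_rV (a, v))) (fun a => dh (cons_rV (a, v)))).
- by move=> a; apply: continuous_comp; [exact: continuous_cons_rV1|exact: dc].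
- move=> a; rewrite (_ : (fun s => _) = fun s : R => h (s *: basis j + cons_rV (0, v))).
    apply: is_derive_line; rewrite (_ : _ + _ = cons_rV (a, v)); first exact: hd.
    apply: cons_rVP => [|i].
      by rewrite 3!mxE cons_rV_head jE eqxx mulr1 addr0.
    by rewrite 3!mxE cons_rV_lift jE/= mulr0 add0r.
  apply/funext => s; congr h; apply/esym/cons_rVP => [|i].
    by rewrite 3!mxE cons_rV_head jE eqxx mulr1 addr0.
  by rewrite 3!mxE cons_rV_lift jE/= mulr0 add0r.
- by exists M => a /hM; apply: le_trans; case: (normc a v).
Qed.

End integral_derivative.

(** * Left-invariant horizontal fields *)

Section stratified_fields.
Context {R : realType} {N : nat} {Ns : seq nat} (G : stratified_group R N Ns).
Local Notation n := (N + sumn Ns)%N.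
Local Notation V := 'rV[R]_n.

Lemma weight_lshift (k : 'I_N) : weight (Ns := Ns) (lshift (sumn Ns) k) = 1%N.
Proof.
rewrite /weight /reshape_index /=.
by have /eqP -> : ((k.+1 - N)%N == 0%N) by rewrite subn_eq0.
Qed.

(** In this form the field is a derivative of the jointly smooth group law in one fixed direction,
    evaluated at (x, 0); smoothness in x follows at once. *)
Lemma hfield_derive k x : hfield G k x =
  'D_((0 : V), horizontal_basis k) (fun z : V * V => sg_op G z.1 z.2) (x, 0).
Proof.
rewrite /hfield /left_invariant_field /derive.
set F := (F in lim (F @ _) = _); set F' := (F in _ = lim (F @ _)).
suff -> : F = F' by [].
by apply/funext => h; rewrite /F /F' /= scaler0 add0r.
Qed.

Lemma hfield_Ck k m : Ck m (hfield G k).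
Proof.
have -> : hfield G k = fun x =>
    'D_((0 : V), horizontal_basis k) (fun z : V * V => sg_op G z.1 z.2) (x, 0).
  by apply/funext => x; exact: hfield_derive.
have [_ _ opD] := sg_op_smooth G m.+1.
have Ll : linear (fun x : V => (x, 0 : V)).
  by move=> a u v; apply: injective_projections => //=; rewrite scaler0 add0r.
have Lc : continuous (fun x : V => (x, 0 : V)).
  move=> x A /nbhs_ballP[e e0 eA]; apply/nbhs_ballP; exists e => //= y xy.
  by apply: eA; split => //=; exact: ballxx.
exact: (Ck_linear_comp Ll Lc (opD (0, horizontal_basis k))).
Qed.

Lemma hfield_coord_Ck k j m : Ck m (fun x => hfield G k x ord0 j).
Proof. exact/Ck_coord/hfield_Ck. Qed.

Lemma is_derive_sg_op k x j :
  is_derive (0 : V) (horizontal_basis k) (fun y => sg_op G x y ord0 j) (hfield G k x ord0 j).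
Proof.
have opd : derivable (sg_op G x) 0 (horizontal_basis k).
  have [_ fd _] := sg_op_smooth G 1.
  have := fd (x, 0) (0, horizontal_basis k); rewrite /derivable.
  set F := (F in cvg (F @ _) -> _); set F' := (F in _ -> cvg (F @ _)).
  suff -> : F = F' by [].
  by apply/funext => h; rewrite /F /F' /= scaler0 add0r.
split; first exact: (derivable_mxP _ _ _).1.
by rewrite /hfield /left_invariant_field derive_mx// mxE.
Qed.

Lemma dilationDZ (lam : R) (x y : V) (h : R) :
  dilation lam (h *: y + x) = h *: dilation lam y + dilation lam x.
Proof. by apply/rowP => i; rewrite !mxE; ring. Qed.

Lemma dilation_basis lam j :
  dilation (Ns := Ns) lam (basis j) = (lam ^+ weight j) *: basis j :> V.
Proof.
by apply/rowP => i; rewrite !mxE/=; case: (eqVneq i j) => [->|_]; rewrite ?mulr0.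
Qed.

(** Both sides are the derivative at 0 of the j-th coordinate of y -> (delta x) o y along lam e_k.
    One side uses linearity in the direction. The other uses lam e_k = delta e_k, valid because
    horizontal coordinates have weight 1, together with the automorphism property of the
    dilation. *)
Lemma hfield_homogeneous k j (lam : R) x : 0 < lam ->
  lam * hfield G k (dilation lam x) ord0 j = lam ^+ weight j * hfield G k x ord0 j.
Proof.
move=> l0; set e := horizontal_basis k : V.
have d1 := is_derive_scale_dir lam (is_derive_sg_op k (dilation lam x) j).
have d2 : is_derive (0 : V) (lam *: e) (fun y => sg_op G (dilation lam x) y ord0 j)
    (lam ^+ weight j * hfield G k x ord0 j).
  apply: is_derive_line0.
  have -> : (fun s => sg_op G (dilation lam x) (s *: (lam *: e) + 0) ord0 j) =
      (fun s => lam ^+ weight j * sg_op G x (s *: e + 0) ord0 j).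
    apply/funext => s; have -> : s *: (lam *: e) + 0 = dilation lam (s *: e + 0).
      rewrite !addr0 -[s *: e]addr0 dilationDZ.
      have -> : dilation lam (0 : V) = 0 by apply/rowP => i; rewrite !mxE mulr0.
      by rewrite addr0 /e -/(basis _) dilation_basis weight_lshift expr1.
    by rewrite -(sg_dilation G l0) mxE.
  have d3 : is_derive (0 : R) 1 (fun s : R => sg_op G x (s *: e + 0) ord0 j) (hfield G k x ord0 j).
    exact: (is_derive_line_at0 (is_derive_sg_op k x j)).
  have := is_deriveM_pt (is_derive_cst (lam ^+ weight j) (0 : R) 1) d3.
  by rewrite mulr0 addr0.
by rewrite -(derive_is d1) -(derive_is d2).
Qed.

(** Differentiating the homogeneity relation in x_j produces on the left a further factor
    lam^(weight j), which cancels the one on the right and leaves b x = lam * b (delta x). Letting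
    lam tend to 0 gives b x = 0. *)
Lemma derive_hfield_diag k j x : 'D_(basis j) (fun x => hfield G k x ord0 j) x = 0.
Proof.
pose a := fun x => hfield G k x ord0 j; pose b := 'D_(basis j) a.
have aC : Ck 1 a by exact: hfield_coord_Ck.
have [_ _ /(_ (basis j)) bc] := aC; rewrite -/b in bc.
have bE lam : 0 < lam -> b x = lam * b (dilation lam x).
  move=> l0.
  have d1 : is_derive x (basis j) (fun x => lam * a (dilation lam x))
      (lam * (lam ^+ weight j * b (dilation lam x))).
    have d : is_derive x (basis j) (fun x => a (dilation lam x)) (lam ^+ weight j * b (dilation lam x)).
      apply: is_derive_line0.
      have -> : (fun s => a (dilation lam (s *: basis j + x))) =
          (fun s => a (s *: (lam ^+ weight j *: basis j) + dilation lam x)).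
        by apply/funext => s; rewrite dilationDZ dilation_basis.
      exact: (is_derive_line_at0 (is_derive_scale_dir _ (Ck1_is_derive _ _ aC))).
    have := is_deriveM_pt (is_derive_cst lam x (basis j)) d.
    by rewrite mulr0 addr0.
  have d2 : is_derive x (basis j) (fun x => lam ^+ weight j * a x) (lam ^+ weight j * b x).
    have := is_deriveM_pt (is_derive_cst (lam ^+ weight j) x (basis j)) (Ck1_is_derive x (basis j) aC).
    by rewrite mulr0 addr0.
  have E : (fun x => lam * a (dilation lam x)) = (fun x => lam ^+ weight j * a x).
    by apply/funext => y; exact: hfield_homogeneous.
  rewrite E in d1; have := derive_is d1; rewrite (derive_is d2) mulrCA.
  by apply: mulfI; rewrite expf_neq0// gt_eqF.
have : compact (b @` cube `|x|).
  by apply: continuous_compact; [exact: continuous_subspaceT|exact: compact_cube].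
move=> /compact_bounded[L [_ hL]].
(* For lam <= 1 the dilates of x stay in the cube of half-side |x|, on which b is bounded. *)
have hb lam : 0 < lam -> lam <= 1 -> `|b x| <= lam * (`|L| + 1).
  move=> l0 l1; rewrite (bE _ l0) normrM (gtr0_norm l0) ler_wpM2l ?(ltW l0)//.
  apply: hL; first by rewrite ltr_pwDr// ler_norm.
  exists (dilation lam x) => // i; rewrite in_itv/= -ler_norml mxE normrM.
  apply: le_trans (rV_norm_coord x i); rewrite -[leRHS]mul1r ler_wpM2r//.
  by rewrite ger0_norm ?exprn_ge0 ?(ltW l0)// exprn_ile1// ltW.
apply/eqP; rewrite -normr_eq0 -/(b x) eq_le normr_ge0 andbT.
apply/ler_addgt0Pl => e e0; rewrite addr0.
have L0 : 0 < `|L| + 1 by rewrite ltr_wpDl.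
have m0 : 0 < Num.min 1 (e / (`|L| + 1)) by rewrite lt_min ltr01 divr_gt0.
apply: le_trans (hb _ m0 _) _; first by rewrite ge_min lexx.
by rewrite -ler_pdivlMr// ge_min lexx orbT.
Qed.

(** By [derive_hfield_diag], X_k h is the sum over j of the coordinate derivatives d_j (a_j h),
    where a_j is the j-th coefficient of X_k. *)
Lemma integral_hfield k (h : V -> R) : Ck 1 h -> bounded_support h ->
  (\int[lebesgue_rV n]_x ('D_(hfield G k x) h x)%:E = 0)%E.
Proof.
move=> hC hb; have [hc _ hD] := hC.
have aC j : Ck 1 (fun x => hfield G k x ord0 j) by exact: hfield_coord_Ck.
pose d j x := hfield G k x ord0 j * 'D_(basis j) h x.
have dc j : continuous (d j).
  exact: (@CkM _ _ 0 _ _ (Ck_cont (aC j)) (hD (basis j))).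
have db j : bounded_support (d j).
  apply: bounded_supportMr; case: hb => M hM; exists M; exact: derive_bounded_support.
transitivity (\int[lebesgue_rV n]_x (\sum_j (d j x)%:E))%E.
  by apply: eq_integral => x _; rewrite derive_basis// -sumEFin.
rewrite integral_sum//; last by move=> j; exact: continuous_integrable.
rewrite big1// => j _.
apply: (@integral_derive_basis _ _ j (fun x => hfield G k x ord0 j * h x)) => //.
- exact: (@CkM _ _ 0 _ _ (Ck_cont (aC j)) hc).
- exact: bounded_supportMr.
- move=> x.
  have := is_deriveM_pt (Ck1_is_derive x (basis j) (aC j)) (Ck1_is_derive x (basis j) hC).
  by rewrite derive_hfield_diag mulr0 addr0.
Qed.

End stratified_fields.

(** * Regularised powers *)

Section powR_calculus.
Context {R : realType} {V : normedModType R}.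
Implicit Types (f : V -> R) (x v : V) (a : R).

Lemma continuous_powR_gt0 a (s : R) : 0 < s -> {for s, continuous (fun t : R => t `^ a)}.
Proof.
move=> s0; apply/differentiable_continuous/derivable1_diffP.
by have [] := @is_derive1_powR _ a s s0.
Qed.

Lemma cvg_powR_gt0 a (s : R) (g : nat -> R) : 0 < s -> g @ \oo --> s ->
  (fun k => g k `^ a) @ \oo --> s `^ a.
Proof.
by move=> s0 gs; exact: (@cvg_comp _ _ _ g (fun t => t `^ a) _ _ _ gs (continuous_powR_gt0 s0)).
Qed.

Lemma Ck1_powR f a : Ck 1 f -> (forall x, 0 < f x) -> Ck 1 (fun x => f x `^ a).
Proof.
move=> fC f0.
have pd x : is_derive (f x) 1 (fun t : R => t `^ a) (a * f x `^ (a - 1)) by exact: is_derive1_powR.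
have pc x : {for f x, continuous (fun t : R => a * t `^ (a - 1))}.
  by apply: continuousM; [exact: cst_continuous|exact: continuous_powR_gt0].
exact: (Ck1_comp fC pd pc).
Qed.

Lemma is_derive_powR f a x v df : is_derive x v f df -> 0 < f x ->
  is_derive x v (fun x => f x `^ a) (a * f x `^ (a - 1) * df).
Proof. by move=> fd f0; apply: is_derive_comp_pt fd (is_derive1_powR _ f0). Qed.

End powR_calculus.

Section smooth_lemmas.
Context {R : realType} {V : normedModType R}.
Implicit Types (f g : V -> R).

Lemma smooth_derive f v : smooth f -> smooth ('D_v f).
Proof. by move=> fs k; have [_ _] := fs k.+1; exact. Qed.

End smooth_lemmas.

Section cbs.
Context {R : realType} {n : nat}.
Local Notation V := 'rV[R]_n.
Local Notation mu := (lebesgue_rV n).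
Implicit Types f g h : V -> R.

(** The class of integrands on which integrability is automatic, so that the real-valued integral is
    linear and monotone without side conditions; it is stable under multiplication by any continuous
    function. *)
Definition cbs f := continuous f /\ bounded_support f.

Lemma cbs_integrable f : cbs f -> mu.-integrable setT (EFin \o f).
Proof. by case; exact: continuous_integrable. Qed.

Lemma continuous_emeasurable f : continuous f ->
  measurable_fun setT (fun x => (f x)%:E).
Proof.
by move=> fc; exact: (measurableT_comp (@EFin_measurable _ _) (continuous_measurable_rV fc)).
Qed.

Lemma cbs_emeasurable f : cbs f -> measurable_fun setT (fun x => (f x)%:E).
Proof. by case=> /continuous_emeasurable. Qed.

Lemma cbsD f g : cbs f -> cbs g -> cbs (fun x => f x + g x).
Proof. by move=> [fc fb] [gc gb]; split; [exact: (@CkD _ _ 0)|exact: bounded_supportD]. Qed.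

Lemma cbsMl f g : cbs f -> continuous g -> cbs (fun x => f x * g x).
Proof. by move=> [fc fb] gc; split; [exact: (@CkM _ _ 0)|exact: bounded_supportMl]. Qed.

Lemma cbsMr f g : cbs f -> continuous g -> cbs (fun x => g x * f x).
Proof. by move=> [fc fb] gc; split; [exact: (@CkM _ _ 0)|exact: bounded_supportMr]. Qed.

Lemma cbs_norm f : cbs f -> cbs (fun x => `|f x|).
Proof.
move=> [fc fb]; split; first by move=> x; apply: continuous_comp; [exact: fc|exact: norm_continuous].
by apply: bounded_support_sub fb _ => x ->; rewrite normr0.
Qed.

Lemma cbsZ (c : R) f : cbs f -> cbs (fun x => c * f x).
Proof. by move=> fb; apply: cbsMr => //; exact: cst_continuous. Qed.

Lemma cbs_Ck1 f : Ck 1 f -> bounded_support f -> cbs f.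
Proof. by move=> /Ck_cont. Qed.

Lemma cbs_derive f v : Ck 1 f -> bounded_support f -> cbs ('D_v f).
Proof.
move=> [_ _ fD] [M hM]; split; first exact: fD.
by exists M; exact: derive_bounded_support.
Qed.

Lemma cbs_fin f : cbs f -> (\int[mu]_x (f x)%:E)%E = (\int[mu]_x (f x))%R%:E.
Proof. by move=> /cbs_integrable fi; rewrite fineK//; exact: integrable_fin_num. Qed.

Lemma cbs_le f g : cbs f -> cbs g -> (forall x, f x <= g x) ->
  \int[mu]_x f x <= \int[mu]_x g x.
Proof. by move=> fb gb fg; apply: le_Rintegral => //; exact: cbs_integrable. Qed.

Lemma cbs_intD f g : cbs f -> cbs g ->
  \int[mu]_x (f x + g x) = \int[mu]_x f x + \int[mu]_x g x.
Proof. by move=> fb gb; apply: RintegralD => //; exact: cbs_integrable. Qed.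

Lemma cbs_intZ c f : cbs f -> \int[mu]_x (c * f x) = c * \int[mu]_x f x.
Proof. by move=> fb; apply: RintegralZl => //; exact: cbs_integrable. Qed.

Lemma Rintegral_derive_basis j h : Ck 1 h -> bounded_support h ->
  \int[mu]_x 'D_(basis j) h x = 0.
Proof.
move=> hC hb; have [hc _ hD] := hC.
by rewrite /Rintegral (integral_derive_basis hc hb (hD _) (fun x => Ck1_is_derive x _ hC)).
Qed.

End cbs.

(** * Derivatives on zero sets *)

Section roots.
Context {R : realType} {n : nat}.
Local Notation V := 'rV[R]_n.
Local Notation mu := (lebesgue_rV n).
Implicit Types (u phi : V -> R).

Lemma Ck_sqr k (f : V -> R) : Ck k f -> Ck k (fun x => f x ^+ 2).
Proof.
move=> fC; rewrite (_ : (fun x => _) = fun x => f x * f x); first exact: CkM.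
by apply/funext => x; rewrite expr2.
Qed.

Lemma reg_gt0 u (d : R) x : 0 < d -> 0 < u x ^+ 2 + d ^+ 2.
Proof. by move=> d0; rewrite ltr_wpDl ?sqr_ge0// exprn_gt0. Qed.

Lemma Ck_reg k u (d : R) : Ck k u -> Ck k (fun x => u x ^+ 2 + d ^+ 2).
Proof. by move=> uC; apply: CkD; [exact: Ck_sqr|exact: Ck_cst]. Qed.

Lemma is_derive_reg u (d : R) x v du : is_derive x v u du ->
  is_derive x v (fun x => u x ^+ 2 + d ^+ 2) (2 * (u x * du)).
Proof.
move=> ud; apply: is_derive_eq (is_deriveD_pt (is_derive_sqr_pt ud) (is_derive_cst_pt _ _ _)) _.
by rewrite addr0.
Qed.

(* [th = e u / sqrt (u^2 + e^2)] satisfies [|th| <= e], is increasing in [u], and has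
   [j]-th derivative [w] on the zero set of [u]; integrate the derivative of [th w phi]. *)
Lemma ae_derive_eq0 u phi j : smooth u -> Ck 1 phi -> bounded_support phi ->
  (forall x, 0 <= phi x) ->
  {ae mu, forall x, phi x != 0 -> u x = 0 -> 'D_(basis j) u x = 0}.
Proof.
move=> us pC pb p0; set w := 'D_(basis j) u.
have ws : smooth w by exact: smooth_derive.
set w' := 'D_(basis j) w.
have w'c : continuous w' by exact: (smooth_derive (basis j) ws 0).
pose g x := w' x * phi x + w x * 'D_(basis j) phi x.
have gb : cbs g.
  apply: cbsD; first exact: cbsMr (cbs_Ck1 pC pb) w'c.
  exact: (cbsMr (cbs_derive (basis j) pC pb) (ws 0)).
pose Z := [set x | u x = 0].
have mZ : measurable Z.
  have := continuous_measurable_rV (us 0) measurableT (measurable_set1 0).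
  by rewrite setTI.
pose k x := \1_Z x * (w x ^+ 2 * phi x).
have mk : measurable_fun setT k.
  apply: measurable_funM; first exact: measurable_indic.
  by apply: continuous_measurable_rV; exact: (@CkM _ _ 0 _ _ (Ck_sqr (ws 0)) (Ck_cont pC)).
have k0 x : 0 <= k x by rewrite /k indicE mulr_ge0 ?ler0n// mulr_ge0 ?sqr_ge0.
(* The factor e is the bound on |th|; since it is arbitrary, the integral of [k] vanishes. *)
have hk e : 0 < e -> (\int[mu]_x (k x)%:E <= (e * \int[mu]_x `|g x|)%:E)%E.
  move=> e0.
  pose s x := u x ^+ 2 + e ^+ 2; have s0 x : 0 < s x by exact: reg_gt0.
  have sC : Ck 1 s by exact: Ck_reg.
  pose th x := e * u x * s x `^ (- 2^-1).
  have thC : Ck 1 th.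
    by apply: CkM; [apply: CkM; [exact: Ck_cst|exact: us]|exact: Ck1_powR].
  have ud x := Ck1_is_derive x (basis j) (us 1).
  have thd x : is_derive x (basis j) th (e ^+ 3 * s x `^ (- 2^-1 - 1) * w x).
    apply: is_derive_eq (is_deriveM_pt (is_deriveM_pt (is_derive_cst_pt e x _) (ud x)) (is_derive_powR (- 2^-1) (is_derive_reg e (ud x)) (s0 x))) _.
    have -> : s x `^ (- 2^-1) = s x * s x `^ (- 2^-1 - 1).
      by rewrite -{2}[s x]powRr1 ?(ltW (s0 x))// -powRD_gt0//; congr (_ `^ _); ring.
    rewrite -/w -/(s x); move: (s x `^ _) => P; rewrite /s.
    by rewrite /w; field.
  have thE x : `|th x| <= e.
    rewrite /th normrM normrM (gtr0_norm e0) -mulrA -[leRHS]mulr1 ler_wpM2l ?(ltW e0)//.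
    rewrite (ger0_norm (powR_ge0 _ _)) powRN ler_pdivrMr ?powR_gt0// mul1r.
    rewrite powR12_sqrt ?(ltW (s0 x))// -sqrtr_sqr ler_sqrt ?(ltW (s0 x))//.
    by rewrite /s lerDl sqr_ge0.
  pose h x := th x * (w x * phi x).
  have wpC : Ck 1 (fun x => w x * phi x) by exact: CkM.
  have hC : Ck 1 h by exact: CkM.
  have hb : bounded_support h by do 2 apply: bounded_supportMr.
  have hd x : 'D_(basis j) h x = th x * g x + e ^+ 3 * s x `^ (- 2^-1 - 1) * (w x ^+ 2 * phi x).
    apply: derive_is; apply: is_derive_eq (is_deriveM_pt (thd x) (is_deriveM_pt (Ck1_is_derive x _ (ws 1)) (Ck1_is_derive x _ pC))) _.
    by rewrite /g /w' /w; ring.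
  have := Rintegral_derive_basis j hC hb.
  have b1 : cbs (fun x => th x * g x) by exact: cbsMr (Ck_cont thC).
  have b2 : cbs (fun x => e ^+ 3 * s x `^ (- 2^-1 - 1) * (w x ^+ 2 * phi x)).
    apply: cbsMr; first exact: cbsMr (cbs_Ck1 pC pb) (Ck_sqr (ws 0)).
    apply: (@CkM _ _ 0); [exact: cst_continuous|exact: (Ck_cont (Ck1_powR _ sC s0))].
  under eq_Rintegral do rewrite hd.
  rewrite cbs_intD// => /eqP; rewrite addrC addr_eq0 => /eqP e1.
  apply: (@le_trans _ _ (\int[mu]_x (e ^+ 3 * s x `^ (- 2^-1 - 1) * (w x ^+ 2 * phi x))%:E)%E).
    apply: ge0_le_integral => //=.
    - by move=> x _; rewrite lee_fin.
    - exact: (measurableT_comp (@EFin_measurable _ _) mk).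
    - exact: cbs_emeasurable b2.
    - move=> x _; rewrite lee_fin /k indicE; case: (boolP (x \in Z)) => [|_].
        (* On the zero set of u one has s = e^2, so e^3 s^(-3/2) = 1 and the two integrands
           agree. *)
        rewrite inE /Z/= => ux; rewrite mul1r /s ux expr0n/= add0r.
        rewrite -(powR_mulrn 2 (ltW e0)) -powRrM -(powR_mulrn 3) ?(ltW e0)// -powRD_gt0//.
        by rewrite (_ : _ + _ = 0) ?powRr0 ?mul1r//; field.
      by rewrite mul0r; apply: mulr_ge0; apply: mulr_ge0; rewrite ?powR_ge0 ?sqr_ge0 ?exprn_ge0 ?(ltW e0).
  rewrite (cbs_fin b2) lee_fin e1 -cbs_intZ; last exact: cbs_norm.
  apply: (@le_trans _ _ (\int[mu]_x `|th x * g x|)).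
    apply: le_trans (ler_norm _) _; rewrite normrN; apply: le_normr_Rintegral => //.
    exact: cbs_integrable.
  apply: cbs_le; [exact: cbs_norm|exact/cbsZ/cbs_norm|].
  by move=> x; rewrite normrM ler_wpM2r.
have k_int0 : (\int[mu]_x (k x)%:E = 0)%E.
  apply/eqP; rewrite eq_le integral_ge0 ?andbT//; last by move=> x _; rewrite lee_fin.
  apply/lee_addgt0Pr => e e0; rewrite add0e.
  set I := \int[mu]_x `|g x| in hk.
  have I0 : 0 <= I by apply: Rintegral_ge0.
  apply: le_trans (hk (e / (I + 1)) _) _; first by rewrite divr_gt0// ltr_wpDl.
  by rewrite lee_fin mulrAC ler_pdivrMr ?ltr_wpDl// ler_wpM2l ?(ltW e0)// lerDl.
have := (ae_eq_integral_abs mu measurableT (_ : measurable_fun setT (EFin \o k))).1.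
move=> /(_ (measurableT_comp (@EFin_measurable _ _) mk)).
under eq_integral do rewrite /= ger0_norm//.
move=> /(_ k_int0); apply: filterS => x kx px ux.
have := kx I; rewrite /= /k indicE mem_set// mul1r => -[] /eqP.
by rewrite mulf_eq0 (negPf px) orbF expf_eq0/= => /eqP.
Qed.

End roots.

(** * Integrability of the derivatives of roots *)

Section root_inequalities.
Context {R : realType}.
Implicit Types (q s b E u w phi : R).

(** Here B = u / b and A = w / E with b = s^((1-q)/2), and dA, dB are their derivatives, so the
    bracket is the derivative of B A phi. The main term is A dB = (1 - (1 - q) u^2 / s) w^2 / (b E),
    at least q w^2 / (b E), and w^2 / E >= |w| - b. The remaining terms are errors: |B A| <= L and
    |B dA| <= 1 + K |w'|. *)
Lemma root_algebra q s b E u w w' phi dphi K L dA dB : 0 < q -> q < 1 ->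
  0 < s -> 0 < b -> 0 < E -> E ^+ 2 = w ^+ 2 + b ^+ 2 -> u ^+ 2 <= s ->
  0 <= phi -> `|u| <= L * b -> `|u| * b <= K * E ^+ 3 ->
  dA = w * (- 2^-1 * (E ^+ 3)^-1 *
      (2 * (w * w') + (1 - q) * (b ^+ 2 / s) * (2 * (u * w)))) + E^-1 * w' ->
  dB = u * ((q - 1) / 2 * (b^-1 / s) * (2 * (u * w))) + b^-1 * w ->
  q * (b^-1 * `|w| * phi) <=
  q * phi + (u / b * (w / E) * dphi + phi * (u / b * dA + w / E * dB))
    + (1 + K * `|w'|) * phi + L * `|dphi|.
Proof.
move=> q0 q1 s0 b0 E0 EE us p0 uL uK dAE dBE.
have bE : b <= E by rewrite -ler_sqr ?nnegrE ?(ltW b0) ?(ltW E0)// EE lerDr sqr_ge0.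
have wE : `|w| <= E.
  by rewrite -ler_sqr ?nnegrE ?(ltW E0)// real_normK ?num_real// EE lerDl sqr_ge0.
have th0 : 0 <= u ^+ 2 / s by rewrite divr_ge0 ?sqr_ge0// ltW.
have th1 : u ^+ 2 / s <= 1 by rewrite ler_pdivrMr// mul1r.
(* |w| - b <= w^2 / E because E <= |w| + b *)
have h1 : q * (b^-1 * `|w|) <= q + w / E * dB.
  have -> : w / E * dB = (1 - (1 - q) * (u ^+ 2 / s)) * (b^-1 * (w ^+ 2 / E)).
    by rewrite dBE; field; rewrite !gt_eqF.
  have hw : `|w| - b <= w ^+ 2 / E.
    rewrite ler_pdivlMr// -(real_normK (num_real w)).
    have [wb|bw] := lerP `|w| b.
      apply: (@le_trans _ _ 0); last exact: sqr_ge0.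
      by rewrite mulr_le0_ge0// ?subr_le0// ltW.
    have Ewb : E <= `|w| + b.
      rewrite -ler_sqr ?nnegrE ?addr_ge0 ?(ltW E0) ?(ltW b0)// EE sqrrD.
      by rewrite real_normK ?num_real// addrAC lerDl mulrn_wge0// mulr_ge0// ltW.
    apply: (@le_trans _ _ ((`|w| - b) * (`|w| + b))).
      by rewrite ler_wpM2l// subr_ge0 ltW.
    by rewrite -subr_sqr gerBl sqr_ge0.
  have hb : b^-1 * `|w| - 1 <= b^-1 * (w ^+ 2 / E).
    have -> : b^-1 * `|w| - 1 = b^-1 * (`|w| - b) by rewrite mulrBr mulVf// gt_eqF.
    by rewrite ler_wpM2l// invr_ge0 ltW.
  have X0 : 0 <= b^-1 * (w ^+ 2 / E).
    by rewrite mulr_ge0 ?invr_ge0 ?divr_ge0 ?sqr_ge0 ?ltW.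
  have : q * (b^-1 * (w ^+ 2 / E)) <= (1 - (1 - q) * (u ^+ 2 / s)) * (b^-1 * (w ^+ 2 / E)).
    rewrite ler_wpM2r// lerBrDr -lerBrDl -[leRHS]mulr1 ler_wpM2l// subr_ge0 ltW//.
  have : q * (b^-1 * `|w| - 1) <= q * (b^-1 * (w ^+ 2 / E)) by rewrite ler_wpM2l// ltW.
  by lra.
have h2 : `|u / b * (w / E)| <= L.
  rewrite normrM !normrM !normfV (gtr0_norm b0) (gtr0_norm E0).
  rewrite -[leRHS]mulr1 ler_pM ?divr_ge0 ?(ltW b0) ?(ltW E0)//.
    by rewrite ler_pdivrMr.
  by rewrite ler_pdivrMr// mul1r.
(* In w' / E - w^2 w' / E^3 only b^2 w' / E^3 survives. The b^2 it carries is what makes the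
   coefficient of w' bounded by K. *)
have h3 : `|u / b * dA| <= 1 + K * `|w'|.
  have -> : u / b * dA = (u * b / E ^+ 3) * w' -
      (1 - q) * (u ^+ 2 / s) * (b * w ^+ 2 / E ^+ 3).
    rewrite dAE; have -> : E^-1 * w' = (w ^+ 2 + b ^+ 2) / E ^+ 3 * w'.
      by rewrite -EE; field; rewrite gt_eqF.
    by field; rewrite !gt_eqF.
  have X1 : 0 <= b * w ^+ 2 / E ^+ 3.
    apply: divr_ge0; last by rewrite exprn_ge0// ltW.
    by apply: mulr_ge0; [exact: ltW|exact: sqr_ge0].
  apply: le_trans (ler_normB _ _) _; rewrite [leRHS]addrC; apply: lerD.
    rewrite normrM ler_wpM2r// normrM normfV normrM (gtr0_norm b0) (gtr0_norm (exprn_gt0 3 E0)).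
    by rewrite ler_pdivrMr ?exprn_gt0.
  rewrite ger0_norm; last first.
    by apply: mulr_ge0 => //; apply: mulr_ge0 => //; rewrite subr_ge0 ltW.
  apply: mulr_ile1.
  - by rewrite mulr_ge0// subr_ge0 ltW.
  - exact: X1.
  - apply: mulr_ile1; rewrite ?subr_ge0 ?(ltW q1)//.
    by rewrite gerBl ltW.
  - rewrite ler_pdivrMr ?exprn_gt0// mul1r (exprS E) ler_pM ?sqr_ge0 ?(ltW b0)//.
    by rewrite EE lerDl sqr_ge0.
have k1 : q * (b^-1 * `|w|) * phi <= (q + w / E * dB) * phi by rewrite ler_wpM2r.
have k2 : - (u / b * (w / E) * dphi) <= L * `|dphi|.
  by apply: le_trans (ler_norm _) _; rewrite normrN normrM ler_wpM2r.
have k3 : - (u / b * dA) * phi <= (1 + K * `|w'|) * phi.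
  by rewrite ler_wpM2r//; apply: le_trans (ler_norm _) _; rewrite normrN.
move: k1 k2 k3; rewrite !mulrDl !mulrDr => k1 k2 k3.
rewrite -subr_ge0.
set T1 := q * (b^-1 * `|w| * phi); set T2 := u / b * (w / E) * dphi in k2 *.
have e1 : T1 = q * (b^-1 * `|w|) * phi by rewrite /T1 !mulrA.
rewrite -e1 in k1.
have -> : phi * (u / b * dA) = - (- (u / b * dA) * phi) by ring.
have -> : phi * (w / E * dB) = w / E * dB * phi by ring.
by lra.
Qed.

Lemma sqr_powR_half (x : R) : 0 < x -> (x `^ 2^-1) ^+ 2 = x.
Proof. by move=> x0; rewrite powR12_sqrt ?sqr_sqrtr// ltW. Qed.

(** The relation q' = q / (1 - q), that is 1 / q' = 1 / q - 1, closes the induction on m: the weight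
    found in front of |w'| is the weight of the same problem for w, with exponent q' and
    regularisation d^(1-q). *)
Lemma root_powR q q' d u w w' phi dphi s D dA dB : 0 < q -> q < 1 ->
  q' = q / (1 - q) -> q' <= 1 -> 0 < d -> d <= 1 -> 0 <= phi ->
  s = u ^+ 2 + d ^+ 2 -> D = w ^+ 2 + s `^ (1 - q) ->
  dA = w * (- 2^-1 * D `^ (- 2^-1 - 1) *
      (2 * (w * w') + (1 - q) * s `^ (1 - q - 1) * (2 * (u * w)))) + D `^ (- 2^-1) * w' ->
  dB = u * ((q - 1) / 2 * s `^ ((q - 1) / 2 - 1) * (2 * (u * w)))
     + s `^ ((q - 1) / 2) * w ->
  q * (s `^ ((q - 1) / 2) * `|w| * phi) <=
  q * phi + (u * s `^ ((q - 1) / 2) * (w * D `^ (- 2^-1)) * dphi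
     + phi * (u * s `^ ((q - 1) / 2) * dA + w * D `^ (- 2^-1) * dB))
    + (1 + (w ^+ 2 + (d `^ (1 - q)) ^+ 2) `^ ((q' - 1) / 2) * `|w'|) * phi
    + (u ^+ 2 + 2) * `|dphi|.
Proof.
move=> q0 q1 q'E q'1 d0 d1 p0 sE DE -> ->.
have oq : 0 < 1 - q by rewrite subr_gt0.
have s0 : 0 < s by rewrite sE ltr_wpDl ?sqr_ge0// exprn_gt0.
have [sg sgE] : exists sg, sg = s `^ 2^-1 by eexists.
have sg0 : 0 < sg by rewrite sgE powR_gt0.
have sg2 : sg ^+ 2 = s by rewrite sgE sqr_powR_half.
have [b bE'] : exists b, b = sg `^ (1 - q) by eexists.
have b0 : 0 < b by rewrite bE' powR_gt0.
have bE : s `^ ((1 - q) / 2) = b by rewrite bE' sgE -powRrM mulrC.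
have b2E : s `^ (1 - q) = b ^+ 2.
  by rewrite -bE -(powR_mulrn 2) ?powR_ge0// -powRrM divfK.
have D0 : 0 < D by rewrite DE b2E ltr_wpDl ?sqr_ge0// exprn_gt0.
have [E EE] : exists E, E = D `^ 2^-1 by eexists.
have E0 : 0 < E by rewrite EE powR_gt0.
have E2 : E ^+ 2 = D by rewrite EE sqr_powR_half.
have p1 : s `^ ((q - 1) / 2) = b^-1.
  by rewrite -bE -powRN; congr (_ `^ _); ring.
have p2 : s `^ ((q - 1) / 2 - 1) = b^-1 / s.
  by rewrite powRD_gt0// p1 powR_inv1// ltW.
have p3 : s `^ (1 - q - 1) = b ^+ 2 / s by rewrite powRD_gt0// b2E powR_inv1// ltW.
have p4 : D `^ (- 2^-1) = E^-1 by rewrite powRN EE.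
have p5 : D `^ (- 2^-1 - 1) = (E ^+ 3)^-1.
  rewrite powRD_gt0// p4 powR_inv1 ?(ltW D0)// -E2; field; rewrite gt_eqF//.
have u_s : u ^+ 2 <= s by rewrite sE lerDl sqr_ge0.
have usg : `|u| <= sg.
  by rewrite -ler_sqr ?nnegrE ?(ltW sg0)// sg2 real_normK ?num_real.
have b_E : b <= E by rewrite -ler_sqr ?nnegrE ?(ltW b0) ?(ltW E0)// E2 DE b2E lerDr sqr_ge0.
rewrite p1 p2 p3 p4 p5.
have q'2 : 1 + q' = (1 - q)^-1 by rewrite q'E; field; rewrite gt_eqF.
have sgb : sg = b `^ (1 + q') by rewrite bE' -powRrM q'2 mulfV ?gt_eqF// powRr1// ltW.
apply: (@root_algebra q s b E u w w' phi dphi _ (u ^+ 2 + 2)) => //.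
- by rewrite E2 DE b2E.
(* L = u^2 + 2: with sg = sqrt s one has sg <= b when sg <= 1, and b >= 1 with sg <= s when sg > 1,
   so sg <= (s + 1) b; moreover d <= 1. *)
- apply: le_trans usg _.
  have : sg <= (s + 1) * b.
    rewrite -sg2; have [s1|s1] := lerP sg 1.
      have : sg <= b by rewrite bE' ger1_powR ?sg0//= gerBl ltW.
      by move=> /le_trans; apply; rewrite mulrDl mul1r lerDr; apply: mulr_ge0; [exact: sqr_ge0|exact: ltW].
    have b1 : 1 <= b by have := @ler_powR _ sg (ltW s1) 0 (1 - q) (ltW oq); rewrite powRr0 bE'.
    apply: (@le_trans _ _ ((sg ^+ 2 + 1) * 1)); last by rewrite ler_wpM2l// addr_ge0 ?sqr_ge0.
    rewrite mulr1; apply: ler_wpDr => //; rewrite expr2 ler_pMr// ltW//.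
  move=> /le_trans; apply; rewrite ler_wpM2r ?(ltW b0)// sE -addrA lerD2l.
  have : d ^+ 2 <= 1 by rewrite exprn_ile1// ltW.
  by lra.
(* The chain is |u| b <= sg b = b^(2+q') <= E^(2+q') = D^((q'-1)/2) E^3. As q' <= 1, D may then be
   lowered to w^2 + d^(2(1-q)). *)
- apply: (@le_trans _ _ (sg * b)); first by rewrite ler_wpM2r// ltW.
  have -> : sg * b = b `^ (2 + q').
    by rewrite sgb -{2}[b]powRr1 ?(ltW b0)// -powRD_gt0//; congr (_ `^ _); ring.
  have q'0 : 0 < q' by rewrite q'E divr_gt0.
  apply: (@le_trans _ _ (E `^ (2 + q'))).
    by apply: ge0_ler_powR; rewrite ?nnegrE ?(ltW b0) ?(ltW E0)// addr_ge0// ltW.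
  have -> : E `^ (2 + q') = D `^ ((q' - 1) / 2) * E ^+ 3.
    rewrite -E2 -(powR_mulrn 2) ?(ltW E0)// -powRrM -(powR_mulrn 3) ?(ltW E0)//.
    by rewrite -powRD_gt0//; congr (_ `^ _); field.
  rewrite ler_wpM2r ?exprn_ge0 ?(ltW E0)//; apply: ler_powR_antimono.
  - by rewrite mulr_le0_ge0// subr_le0.
  - by rewrite ltr_wpDl ?sqr_ge0// exprn_gt0// powR_gt0.
  - rewrite DE lerD2l -powR_mulrn ?powR_ge0// -powRrM mulrC powRrM.
    rewrite powR_mulrn ?(ltW d0)//; apply: ge0_ler_powR; rewrite ?nnegrE ?sqr_ge0 ?(ltW oq) ?(ltW s0)//.
    by rewrite sE lerDr sqr_ge0.
Qed.

End root_inequalities.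

Section root_bound.
Context {R : realType} {n : nat}.
Local Notation V := 'rV[R]_n.
Local Notation mu := (lebesgue_rV n).
Implicit Types (u phi : V -> R).

(** The bound must be uniform in d, since d later tends to 0. For m = 0 the exponent is 0 and
    nothing is singular. In the induction step [root_powR] is integrated: the exact derivative
    contributes 0, and the term with |w'| is bounded by the induction hypothesis for w. *)
Lemma root_derivative_bound m u phi j : smooth u -> Ck 1 phi ->
  bounded_support phi -> (forall x, 0 <= phi x) ->
  exists C : R, forall d, 0 < d -> d <= 1 ->
  \int[mu]_x ((u x ^+ 2 + d ^+ 2) `^ ((m.+1%:R^-1 - 1) / 2) *
      `|'D_(basis j) u x| * phi x) <= C.
Proof.
move=> + pC pb p0; elim: m u => [|m ih] u us.
  exists (\int[mu]_x (`|'D_(basis j) u x| * phi x)) => d d0 d1.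
  rewrite invr1 subrr mul0r.
  by under eq_Rintegral do rewrite powRr0 mul1r.
pose w := 'D_(basis j) u; have ws : smooth w by exact: smooth_derive.
pose w' := 'D_(basis j) w.
have w'c : continuous w' by exact: (smooth_derive (basis j) ws 0).
have [C hC] := ih w ws.
pose q : R := m.+2%:R^-1; pose q' : R := m.+1%:R^-1.
have q0 : 0 < q by rewrite invr_gt0.
have q1 : q < 1 by rewrite invf_lt1// ltr1n.
have q'E : q' = q / (1 - q).
  have <- : m.+1%:R * q = 1 - q.
    by rewrite -[m.+1%:R](addrK 1) natr1 mulrBl mulfV ?pnatr_eq0// mul1r.
  by rewrite invfM mulrCA mulfV ?mulr1// gt_eqF.
have q'1 : q' <= 1 by rewrite invf_le1// ler1n.
have pbs := cbs_Ck1 pC pb.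
have dpbs : cbs (fun x => `|'D_(basis j) phi x|) by exact/cbs_norm/cbs_derive.
have nw'c : continuous (fun x => `|w' x|).
  by move=> x; apply: continuous_comp; [exact: w'c|exact: norm_continuous].
have nwc : continuous (fun x => `|w x|).
  by move=> x; apply: continuous_comp; [exact: (ws 0)|exact: norm_continuous].
exists (q^-1 * (q * \int[mu]_x phi x + (\int[mu]_x phi x + C) +
   \int[mu]_x ((u x ^+ 2 + 2) * `|'D_(basis j) phi x|))) => d d0 d1.
pose s x := u x ^+ 2 + d ^+ 2.
have s0 x : 0 < s x by exact: reg_gt0.
have sC : Ck 1 s by exact: Ck_reg.
pose D x := w x ^+ 2 + s x `^ (1 - q).
have D0 x : 0 < D x by rewrite /D ltr_wpDl ?sqr_ge0// powR_gt0.
have DC : Ck 1 D by apply: CkD; [exact/Ck_sqr|exact: Ck1_powR].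
pose B x := u x * s x `^ ((q - 1) / 2).
have BC : Ck 1 B by apply: CkM; [exact: us|exact: Ck1_powR].
pose A x := w x * D x `^ (- 2^-1).
have AC : Ck 1 A by apply: CkM; [exact: ws|exact: Ck1_powR].
(* The regularisation at which the induction hypothesis for w is applied; it lies again in the
   interval from 0 to 1. *)
pose d' := d `^ (1 - q).
have d'0 : 0 < d' by exact: powR_gt0.
have oq : 0 <= 1 - q by rewrite subr_ge0 ltW.
have d'1 : d' <= 1.
  by have := @ge0_ler_powR _ (1 - q) oq d 1; rewrite powR1 => -> //; rewrite nnegrE// ltW.
have ud x := Ck1_is_derive x (basis j) (us 1).
have wd x := Ck1_is_derive x (basis j) (ws 1).
have sd x : is_derive x (basis j) s (2 * (u x * w x)) by exact: is_derive_reg.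
have Dd x : is_derive x (basis j) D (2 * (w x * w' x) + (1 - q) * s x `^ (1 - q - 1) * (2 * (u x * w x))).
  exact: (is_deriveD_pt (is_derive_sqr_pt (wd x)) (is_derive_powR _ (sd x) (s0 x))).
pose dA x := w x * (- 2^-1 * D x `^ (- 2^-1 - 1) *
  (2 * (w x * w' x) + (1 - q) * s x `^ (1 - q - 1) * (2 * (u x * w x)))) + D x `^ (- 2^-1) * w' x.
pose dB x := u x * ((q - 1) / 2 * s x `^ ((q - 1) / 2 - 1) * (2 * (u x * w x)))
     + s x `^ ((q - 1) / 2) * w x.
have Ad x : is_derive x (basis j) A (dA x).
  exact: (is_deriveM_pt (wd x) (is_derive_powR _ (Dd x) (D0 x))).
have Bd x : is_derive x (basis j) B (dB x).
  exact: (is_deriveM_pt (ud x) (is_derive_powR _ (sd x) (s0 x))).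
pose h x := B x * A x * phi x.
have BAC : Ck 1 (fun x => B x * A x) by exact: CkM.
have hC1 : Ck 1 h by exact: CkM.
have hb : bounded_support h by exact: bounded_supportMr.
have hd x : 'D_(basis j) h x = B x * A x * 'D_(basis j) phi x + phi x * (B x * dA x + A x * dB x).
  exact: derive_is (is_deriveM_pt (is_deriveM_pt (Bd x) (Ad x)) (Ck1_is_derive x _ pC)).
have hint := Rintegral_derive_basis j hC1 hb.
pose J x := (w x ^+ 2 + d' ^+ 2) `^ ((q' - 1) / 2) * `|w' x| * phi x.
have Jb : cbs J.
  apply: cbsMr => //; apply: (@CkM _ _ 0) => //.
  by apply: Ck_cont; apply: Ck1_powR; [exact: Ck_reg|move=> x; exact: reg_gt0].
have u2c : continuous (fun x => u x ^+ 2 + 2).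
  by apply: (@CkD _ _ 0); [exact: (Ck_sqr (us 0))|exact: cst_continuous].
have b1 : cbs (fun x => q * phi x) by exact: cbsZ.
have b2 : cbs ('D_(basis j) h) by exact: cbs_derive.
have b3 : cbs (fun x => phi x + J x) by exact: cbsD.
have b4 : cbs (fun x => (u x ^+ 2 + 2) * `|'D_(basis j) phi x|) by exact: cbsMr.
have b0 : cbs (fun x => s x `^ ((q - 1) / 2) * `|w x| * phi x).
  apply: cbsMr => //; apply: (@CkM _ _ 0) => //.
  by apply: Ck_cont; exact: Ck1_powR.
rewrite [leRHS]mulrC ler_pdivlMr// [leLHS]mulrC.
have hJ : \int[mu]_x J x <= C := hC d' d'0 d'1.
pose g x := q * phi x + 'D_(basis j) h x + (phi x + J x) + (u x ^+ 2 + 2) * `|'D_(basis j) phi x|.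
have b5 : cbs (fun x => q * phi x + 'D_(basis j) h x) by exact: cbsD.
have b6 : cbs (fun x => q * phi x + 'D_(basis j) h x + (phi x + J x)) by exact: cbsD.
have gb : cbs g by exact: cbsD.
have le_g x : q * (s x `^ ((q - 1) / 2) * `|w x| * phi x) <= g x.
  rewrite /g hd.
  have := @root_powR _ q q' d (u x) (w x) (w' x) (phi x) ('D_(basis j) phi x) (s x) (D x) (dA x) (dB x)
    q0 q1 q'E q'1 d0 d1 (p0 x) erefl erefl erefl erefl.
  by rewrite [(1 + _) * phi x]mulrDl mul1r.
have := cbs_le (cbsZ q b0) gb le_g; rewrite cbs_intZ// => /le_trans; apply.
have -> : \int[mu]_x g x = \int[mu]_x (q * phi x + 'D_(basis j) h x + (phi x + J x)) +
    \int[mu]_x ((u x ^+ 2 + 2) * `|'D_(basis j) phi x|) by exact: cbs_intD.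
have -> : \int[mu]_x (q * phi x + 'D_(basis j) h x + (phi x + J x)) =
  \int[mu]_x (q * phi x + 'D_(basis j) h x) + \int[mu]_x (phi x + J x) by exact: cbs_intD.
have -> : \int[mu]_x (q * phi x + 'D_(basis j) h x) =
  \int[mu]_x (q * phi x) + \int[mu]_x ('D_(basis j) h x) by exact: cbs_intD.
rewrite hint addr0 cbs_intZ// (cbs_intD pbs Jb).
by rewrite lerD2r lerD2l lerD2l.
Qed.

End root_bound.

(** * Flatness at almost every zero *)

Section flat.
Context {R : realType} {n : nat}.
Local Notation V := 'rV[R]_n.
Local Notation mu := (lebesgue_rV n).
Implicit Types (u phi : V -> R).

Fixpoint flat (m : nat) u (x : V) : Prop :=
  if m is k.+1 then u x = 0 /\ forall j, flat k ('D_(basis j) u) x else True.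

(** Almost everywhere on the zero set of u each d_j u vanishes too; being smooth, d_j u falls under
    the induction hypothesis. *)
Lemma ae_flat m u phi : smooth u -> Ck 1 phi -> bounded_support phi ->
  (forall x, 0 <= phi x) ->
  {ae mu, forall x, phi x != 0 -> u x = 0 -> flat m u x}.
Proof.
move=> + pC pb p0; elim: m u => [|m ih] u us; first exact: aeW.
have h1 j := ae_derive_eq0 j us pC pb p0.
have h2 j := ih _ (smooth_derive (basis j) us).
have h : {ae mu, forall x, forall j, (phi x != 0 -> u x = 0 -> 'D_(basis j) u x = 0) /\
   (phi x != 0 -> 'D_(basis j) u x = 0 -> flat m ('D_(basis j) u) x)}.
  by apply: filter_forall => j; apply: filterS2 (h1 j) (h2 j).
by apply: filterS h => x hx px ux /=; split => // j; have [/(_ px ux) ? ] := hx j; exact.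
Qed.

(** Each order of flatness gains one factor |t|, through the mean value theorem along the line; at
    order 0 it is the boundedness of u on a compact cube. *)
Lemma flat_Taylor m u x v : smooth u -> flat m u x ->
  exists2 C : R, 0 <= C & forall t : R, `|t| <= 1 -> `|u (t *: v + x)| <= C * `|t| ^+ m.
Proof.
elim: m u => [|m ih] u us.
  move=> _; pose M := `|v| + `|x|.
  have : compact (u @` cube M).
    by apply: continuous_compact; [apply: continuous_subspaceT; exact: (us 0)|exact: compact_cube].
  move=> /compact_bounded[L [_ hL]]; exists (`|L| + 1); first by rewrite addr_ge0.
  move=> t t1; rewrite expr0 mulr1; apply: hL; first by rewrite ltr_pwDr// ler_norm.
  exists (t *: v + x) => // i; rewrite in_itv/= -ler_norml.
  apply: le_trans (rV_norm_coord _ _) _; apply: le_trans (ler_normD _ _) _.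
  by rewrite lerD2r normrZ -[leRHS]mul1r ler_wpM2r.
move=> [ux fl].
have hj j : {C : R | 0 <= C & forall t : R, `|t| <= 1 -> `|'D_(basis j) u (t *: v + x)| <= C * `|t| ^+ m}.
  exact: (cid2 (ih _ (smooth_derive (basis j) us) (fl j))).
pose C j := s2val (hj j).
have C0 j : 0 <= C j := s2valP (hj j).
have hC j := s2valP' (hj j).
exists (\sum_j `|v ord0 j| * C j).
  by apply: sumr_ge0 => j _; rewrite mulr_ge0.
move=> t t1.
have [c ct] := @MVT_line _ _ u x v (fun z => @Ck1_derivable _ _ u z v (us 1)) t.
rewrite ux subr0 => ->; rewrite normrM exprS mulrCA ler_wpM2l// (@derive_basis _ _ u _ _ (us 1)).
apply: le_trans (ler_norm_sum _ _ _) _; rewrite mulr_suml; apply: ler_sum => j _.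
rewrite normrM -mulrA ler_wpM2l//.
apply: le_trans (hC j c (le_trans ct t1)) _.
by apply: (ler_wpM2l (C0 j)); apply: lerXn2r; rewrite ?nnegrE.
Qed.

End flat.

Section fatou_bound.
Context {d : measure_display} {T : measurableType d} {R : realType}.
Variable mu : {measure set T -> \bar R}.
Local Open Scope ereal_scope.

Lemma fatou_bound (f_ : nat -> T -> R) (f : T -> R) (C : \bar R) :
  (forall m, measurable_fun setT (f_ m)) ->
  (forall m x, (0 <= f_ m x)%R) ->
  (forall x, f_ ^~ x @ \oo --> f x) ->
  (forall m, \int[mu]_x (f_ m x)%:E <= C) ->
  \int[mu]_x (f x)%:E <= C.
Proof.
move=> mf f0 cf fC.
have := @fatou _ _ _ mu setT measurableT (fun m x => (f_ m x)%:E)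
  (fun m => measurableT_comp (@EFin_measurable _ _) (mf m))
  (fun m x _ => f0 m x).
under eq_integral => x _.
  have cx : (f_ m x)%:E @[m --> \oo] --> (f x)%:E by apply: cvg_EFin; [exact: nearW|exact: cf].
  rewrite (is_cvg_limn_einfE (cvgP _ cx)) (cvg_lim _ cx)//.
  over.
move=> /le_trans; apply; rewrite limn_einf_lim; apply: lime_le.
  exact: is_cvg_einfs.
apply: nearW => m; apply: le_trans (fC m); apply: ereal_inf_lbound.
by exists m => /=.
Qed.

End fatou_bound.

Section root_integrable.
Context {R : realType} {n : nat}.
Local Notation V := 'rV[R]_n.
Local Notation mu := (lebesgue_rV n).
Implicit Types (u phi f g h c : V -> R).

Lemma integrable_continuousM c h : continuous c -> bounded_support h ->
  mu.-integrable setT (EFin \o h) -> mu.-integrable setT (EFin \o (fun x => c x * h x)).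
Proof.
move=> cc [M hM] ih.
have : compact (c @` cube M).
  by apply: continuous_compact; [exact: continuous_subspaceT|exact: compact_cube].
move=> /compact_bounded[L [_ hL]].
have mh : measurable_fun setT h by apply/measurable_EFinP; case/integrableP: ih.
apply: (@le_integrable _ _ _ mu setT measurableT _ (fun x => (`|L| + 1)%:E * (h x)%:E)%E).
- apply/measurable_EFinP; apply: measurable_funM => //; exact: continuous_measurable_rV.
- move=> x _; rewrite /= lee_fin !normrM.
  have [xM|/(bounded_support_cube hM) ->] := pselect (cube M x); last by rewrite normr0 !mulr0.
  rewrite ler_wpM2r// (ger0_norm (addr_ge0 _ _))//; apply: hL; last by exists x.
  by rewrite ltr_pwDr// ler_norm.
- exact: integrableZl.
Qed.

(** Choose q = 1 / (m + 1) <= p - 1. The excess |u|^(p-1-q) has exponent between 0 and 2, so it is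
    at most u^2 + 2, and this factor is put into the test function. Fatou's lemma removes the
    regularisation from [root_derivative_bound]. *)
Lemma root_integrable u phi j (p : R) : 1 < p -> p < 2 -> smooth u -> Ck 1 phi ->
  bounded_support phi -> (forall x, 0 <= phi x) ->
  mu.-integrable setT (EFin \o (fun x => `|u x| `^ (p - 2) * `|'D_(basis j) u x| * phi x)).
Proof.
move=> p1 p2 us pC pb p0; set w := 'D_(basis j) u.
have [m hm] : exists m : nat, m.+1%:R^-1 <= p - 1.
  exists (Num.truncn (p - 1)^-1).
  by rewrite -[leRHS]invrK lef_pV2 ?posrE ?invr_gt0 ?subr_gt0// ltW// truncnS_gt.
pose q : R := m.+1%:R^-1.
have q0 : 0 < q by rewrite invr_gt0.
have q1 : q < 1 by apply: le_lt_trans hm _; lra.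
pose phi' x := phi x * (u x ^+ 2 + 2).
have u2C : Ck 1 (fun x => u x ^+ 2 + 2) by apply: CkD; [exact/Ck_sqr/us|exact: Ck_cst].
have p'C : Ck 1 phi' by exact: CkM.
have p'b : bounded_support phi' by exact: bounded_supportMl.
have p'0 x : 0 <= phi' x by rewrite mulr_ge0// addr_ge0// sqr_ge0.
have [C hC] := root_derivative_bound m j us p'C p'b p'0.
have wc : continuous (fun x => `|w x|).
  move=> x; apply: continuous_comp; last exact: norm_continuous.
  exact: (smooth_derive (basis j) us 0).
have mw : measurable_fun setT (fun x => `|w x|) by exact: continuous_measurable_rV.
have mu_ : measurable_fun setT u by exact: (continuous_measurable_rV (us 0)).
have mphi : measurable_fun setT phi by exact: (continuous_measurable_rV (Ck_cont pC)).
(* Where u = 0 the regularised weight has no finite limit, while the integrand to be bounded is 0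
   there because [powR] vanishes at 0; the limit is therefore taken on [Z] only. *)
pose Z := [set x | u x != 0].
have mZ : measurable Z.
  have := measurableC (mu_ measurableT [set 0] (measurable_set1 0)).
  by rewrite setTI; congr measurable; apply/seteqP; split => x /=; [move/eqP|move=> /eqP].
pose d_ (k : nat) : R := k.+1%:R^-1.
have d0 k : 0 < d_ k by rewrite invr_gt0.
have d1 k : d_ k <= 1 by rewrite invf_le1// ler1n.
have dcvg : d_ @ \oo --> 0 by exact: cvg_harmonic.
pose f_ k x := \1_Z x * ((u x ^+ 2 + d_ k ^+ 2) `^ ((q - 1) / 2) * `|w x| * phi' x).
pose f x := \1_Z x * ((u x ^+ 2) `^ ((q - 1) / 2) * `|w x| * phi' x).
have fb k : cbs (fun x => (u x ^+ 2 + d_ k ^+ 2) `^ ((q - 1) / 2) * `|w x| * phi' x).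
  apply: cbsMr; first exact: cbs_Ck1.
  apply: (@CkM _ _ 0) => //; apply: Ck_cont; apply: Ck1_powR.
    exact/Ck_reg/us.
  by move=> x; exact: reg_gt0.
have mf k : measurable_fun setT (f_ k).
  apply: measurable_funM; first exact: measurable_indic.
  by apply: continuous_measurable_rV; case: (fb k).
have f0 k x : 0 <= f_ k x.
  by rewrite /f_ indicE mulr_ge0 ?ler0n// mulr_ge0// mulr_ge0// powR_ge0.
have fcvg x : f_ ^~ x @ \oo --> f x.
  rewrite /f_ /f indicE; case: (boolP (x \in Z)) => [|_]; last first.
    by under eq_fun do rewrite mul0r; rewrite mul0r; exact: cvg_cst.
  rewrite inE /Z/= => ux; under eq_fun do rewrite mul1r.
  rewrite mul1r; do 2 apply: cvgMl.
  have hs : (fun k => u x ^+ 2 + d_ k ^+ 2) @ \oo --> u x ^+ 2.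
    rewrite -[X in _ --> X]addr0 -[X in _ --> _ + X](mul0r 0).
    by apply: cvgD; [exact: cvg_cst|under eq_fun do rewrite expr2; exact: cvgM].
  have u20 : 0 < u x ^+ 2 by rewrite exprn_even_gt0.
  exact: cvg_powR_gt0.
have fC k : (\int[mu]_x (f_ k x)%:E <= C%:E)%E.
  apply: (@le_trans _ _ (\int[mu]_x ((u x ^+ 2 + d_ k ^+ 2) `^ ((q - 1) / 2) * `|w x| * phi' x)%:E)%E).
    apply: ge0_le_integral => //=.
    - by move=> x _; rewrite lee_fin.
    - exact: (measurableT_comp (@EFin_measurable _ _) (mf k)).
    - exact: cbs_emeasurable.
    - move=> x _; rewrite lee_fin /f_ indicE -[leRHS]mul1r ler_wpM2r//.
        by rewrite mulr_ge0// mulr_ge0// powR_ge0.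
      by case: (x \in Z).
  by rewrite (cbs_fin (fb k)) lee_fin; exact: hC.
have fint : (\int[mu]_x (f x)%:E <= C%:E)%E := fatou_bound mf f0 fcvg fC.
have mg : measurable_fun setT (fun x => `|u x| `^ (p - 2) * `|w x| * phi x).
  apply: measurable_funM => //; apply: measurable_funM => //.
  by apply: (measurableT_comp (measurable_powR _)); exact: measurableT_comp.
apply/integrableP; split; first exact/measurable_EFinP.
apply: (@le_lt_trans _ _ (\int[mu]_x (f x)%:E)%E); last by apply: le_lt_trans fint _; exact: ltry.
apply: ge0_le_integral => //=.
- by do 2 apply: measurableT_comp => //.
- apply: measurableT_comp => //; exact: measurable_fun_cvg mf (fun x _ => fcvg x).
move=> x _; rewrite lee_fin ger0_norm; last first.
  by rewrite mulr_ge0// mulr_ge0// powR_ge0.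
rewrite /f indicE; have [ux|ux] := eqVneq (u x) 0.
  rewrite ux normr0 powR0; last by rewrite subr_eq0 lt_eqF.
  rewrite !mul0r; apply: mulr_ge0; first by rewrite ler0n.
  by apply: mulr_ge0 => //; apply: mulr_ge0 => //; exact: powR_ge0.
rewrite mem_set// mul1r /phi'.
have nu : 0 < `|u x| by rewrite normr_gt0.
have -> : (u x ^+ 2) `^ ((q - 1) / 2) = `|u x| `^ (q - 1).
  rewrite -(real_normK (num_real (u x))) -(powR_mulrn 2)// -powRrM; congr (_ `^ _).
  by rewrite mulrC divfK.
have -> : p - 2 = (q - 1) + (p - 1 - q) by ring.
rewrite powRD_gt0// -!mulrA ler_wpM2l ?powR_ge0// mulrCA ler_wpM2l//.
rewrite mulrC ler_wpM2l//.
have e0 : 0 <= p - 1 - q by rewrite subr_ge0.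
have [u1|u1] := lerP `|u x| 1.
  have := @ge0_ler_powR _ (p - 1 - q) e0 `|u x| 1.
  rewrite powR1 !nnegrE normr_ge0 ler01 => /(_ isT isT u1) /le_trans; apply.
  by have := sqr_ge0 (u x); lra.
have := @ler_powR _ `|u x| (ltW u1) (p - 1 - q) 2%:R.
rewrite powR_mulrn// real_normK ?num_real// => h.
by apply: le_trans (h _) _; [lra|rewrite lerDl].
Qed.

End root_integrable.

(** * The regularised flux *)

Section integrable_extra.
Context {R : realType} {n : nat}.
Local Notation V := 'rV[R]_n.
Local Notation mu := (lebesgue_rV n).

Lemma integrable_sumR (I : Type) (r : seq I) (f : I -> V -> R) :
  (forall i, mu.-integrable setT (EFin \o f i)) ->
  mu.-integrable setT (EFin \o (fun x => \sum_(i <- r) f i x)).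
Proof.
move=> fi; have -> : EFin \o (fun x => \sum_(i <- r) f i x) =
    fun x => (\sum_(i <- r) (EFin \o f i) x)%E.
  by apply/funext => x /=; rewrite -sumEFin.
by apply: integrable_sum => // i _; exact: fi.
Qed.

Lemma integrableDR (f g : V -> R) : mu.-integrable setT (EFin \o f) ->
  mu.-integrable setT (EFin \o g) ->
  mu.-integrable setT (EFin \o (fun x => f x + g x)).
Proof. by move=> fi gi; exact: (integrableD measurableT fi gi). Qed.

Lemma measurable_sumR (I : Type) (r : seq I) (f : I -> V -> R) :
  (forall i, measurable_fun setT (f i)) ->
  measurable_fun setT (fun x => \sum_(i <- r) f i x).
Proof.
move=> mf; elim: r => [|i r ih].
  by under eq_fun do rewrite big_nil; exact: measurable_cst.
by under eq_fun do rewrite big_cons; exact: measurable_funD.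
Qed.

Lemma cbs_sum (I : Type) (r : seq I) (f : I -> V -> R) : (forall i, cbs (f i)) ->
  cbs (fun x => \sum_(i <- r) f i x).
Proof.
move=> fb; elim: r => [|i r ih].
  under eq_fun do rewrite big_nil; split; first by move=> x; exact: cst_continuous.
  by exists 0 => x; rewrite eqxx.
by under eq_fun do rewrite big_cons; exact: cbsD.
Qed.

Lemma cbs_int_sum (I : Type) (r : seq I) (f : I -> V -> R) : (forall i, cbs (f i)) ->
  \int[mu]_x (\sum_(i <- r) f i x) = \sum_(i <- r) \int[mu]_x f i x.
Proof.
move=> fb; elim: r => [|i r ih].
  by rewrite big_nil /Rintegral; under eq_integral do rewrite big_nil; rewrite integral0.
under eq_Rintegral do rewrite big_cons.
by rewrite big_cons -ih; apply: cbs_intD => //; exact: cbs_sum.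
Qed.

End integrable_extra.

Lemma powR_le1D (R : realType) (s t : R) : 0 <= s -> 0 <= t -> t <= 1 -> s `^ t <= s + 1.
Proof.
move=> s0 t0 t1; have [s1|s1] := lerP s 1.
  have := @ge0_ler_powR _ t t0 s 1.
  rewrite powR1 !nnegrE ler01 => /(_ s0 isT s1) /le_trans; apply.
  by rewrite lerDr.
have := @ler_powR _ s (ltW s1) t 1 t1; rewrite powRr1// => /le_trans; apply.
by rewrite lerDl.
Qed.

Section flux.
Context {R : realType} {N : nat} {Ns : seq nat} (G : stratified_group R N Ns).
Local Notation n := (N + sumn Ns)%N.
Local Notation V := 'rV[R]_n.
Local Notation mu := (lebesgue_rV n).
Variables (p : R) (rho F : V -> R).
Hypotheses (p1 : 1 < p) (p2 : p < 2) (rho0 : forall x, 0 <= rho x)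
  (rhoC : Ck 1 rho) (Fs : smooth F).

Lemma hderive_Ck m (f : V -> R) k : Ck m.+1 f -> Ck m (fun x => 'D_(hfield G k x) f x).
Proof.
move=> fC; have f1 : Ck 1 f by exact: Ck_le fC.
have -> : (fun x => 'D_(hfield G k x) f x) =
    fun x => \sum_j hfield G k x ord0 j * 'D_(basis j) f x.
  by apply/funext => x; exact: derive_basis.
by apply: Ck_sum => j; apply: CkM; [exact: hfield_coord_Ck|have [_ _] := fC; exact].
Qed.

Definition hder (i : 'I_N) (x : V) : R := 'D_(hfield G i x) F x.

Definition hsq (x : V) : R := \sum_i hder i x ^+ 2.

Definition hhess (k i : 'I_N) (x : V) : R := 'D_(hfield G k x) (hder i) x.

Definition hrho (k : 'I_N) (x : V) : R := 'D_(hfield G k x) rho x.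

(* [S] stands for [|grad_H F|^2 + d^2], whose [X_k]-derivative does not depend on [d];
   [dflux S k] is the resulting [X_k]-derivative of [flux S k]. *)
Definition flux (S : R) (k : 'I_N) (x : V) : R := rho x * S `^ ((p - 2) / 2) * hder k x.

Definition dflux (S : R) (k : 'I_N) (x : V) : R :=
  rho x * S `^ ((p - 2) / 2) * hhess k k x +
  hder k x * (rho x * ((p - 2) / 2 * S `^ ((p - 2) / 2 - 1) *
      \sum_i 2 * (hder i x * hhess k i x)) + S `^ ((p - 2) / 2) * hrho k x).

Lemma hder_smooth i : smooth (hder i).
Proof. by move=> k; apply: hderive_Ck; exact: Fs. Qed.

Lemma hsq_smooth : smooth hsq.
Proof. by move=> k; apply: Ck_sum => i; apply: Ck_sqr; exact: hder_smooth. Qed.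

Lemma hsq_ge0 x : 0 <= hsq x.
Proof. by apply: sumr_ge0 => i _; exact: sqr_ge0. Qed.

Lemma hder_le_hsq i x : hder i x ^+ 2 <= hsq x.
Proof.
by rewrite /hsq (bigD1 i)//= lerDl; apply: sumr_ge0 => j _; exact: sqr_ge0.
Qed.

Lemma hsq_eq0 x : (hsq x = 0) <-> (forall i, hder i x = 0).
Proof.
split => [s0 i|h]; last by rewrite /hsq big1// => i _; rewrite h expr0n.
apply/eqP; rewrite -sqrf_eq0 eq_le sqr_ge0 andbT.
by apply: le_trans (hder_le_hsq i x) _; rewrite s0.
Qed.

Lemma hsq_dotv x : dotv (hgrad G F x) (hgrad G F x) = hsq x.
Proof. by apply: eq_bigr => i _; rewrite !mxE expr2. Qed.

Lemma enorm_hgrad_powR x r : enorm (hgrad G F x) `^ r = hsq x `^ (r / 2).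
Proof. by rewrite /enorm hsq_dotv -powR12_sqrt ?hsq_ge0// -powRrM mulrC. Qed.

Lemma p_fluxE x k : p_flux G p rho F x ord0 k = flux (hsq x) k x.
Proof. by rewrite /p_flux !mxE enorm_hgrad_powR. Qed.

(** Positivity is asked only at the point x, so that the formula serves both for e > 0 everywhere
    and for e = 0 off the critical set. *)
Lemma is_derive_flux (e : R) k x : 0 < hsq x + e ^+ 2 ->
  is_derive x (hfield G k x) (fun z => flux (hsq z + e ^+ 2) k z)
    (dflux (hsq x + e ^+ 2) k x).
Proof.
move=> s0; set v := hfield G k x.
have hd i := Ck1_is_derive x v (hder_smooth i 1).
have hsqd : is_derive x v hsq (\sum_i 2 * (hder i x * hhess k i x)).
  exact: (is_derive_sum_pt (fun i => is_derive_sqr_pt (hd i))).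
have Sd : is_derive x v (fun z => hsq z + e ^+ 2) (\sum_i 2 * (hder i x * hhess k i x)).
  have := is_deriveD_pt hsqd (is_derive_cst_pt (e ^+ 2) x v); rewrite addr0; exact.
apply: is_derive_eq (is_deriveM_pt (is_deriveM_pt (Ck1_is_derive x v rhoC)
  (is_derive_powR ((p - 2) / 2) Sd s0)) (hd k)) _.
by rewrite /dflux /hrho /hhess -/v; ring.
Qed.

Lemma flux_Ck e k : 0 < e -> Ck 1 (fun z => flux (hsq z + e ^+ 2) k z).
Proof.
move=> e0; apply: CkM; last exact: hder_smooth.
apply: CkM; first exact: rhoC.
apply: Ck1_powR.
  by apply: CkD; [exact: hsq_smooth|exact: Ck_cst].
by move=> x; rewrite ltr_wpDl ?hsq_ge0// exprn_gt0.
Qed.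

Lemma dflux_continuous e k : 0 < e -> continuous (fun x => dflux (hsq x + e ^+ 2) k x).
Proof.
move=> e0; have := hderive_Ck (m := 0) k (flux_Ck k e0).
rewrite (_ : (fun x => _) = (fun x => dflux (hsq x + e ^+ 2) k x)) //.
apply/funext => x; apply: derive_is; apply: is_derive_flux.
by rewrite ltr_wpDl ?hsq_ge0// exprn_gt0.
Qed.

Lemma hhessE k i x : hhess k i x = \sum_j hfield G k x ord0 j * 'D_(basis j) (hder i) x.
Proof. exact/derive_basis/hder_smooth. Qed.

Lemma powR_mul_norm_le_powR (S y : R) : y ^+ 2 <= S ->
  S `^ ((p - 2) / 2) * `|y| <= S `^ ((p - 1) / 2).
Proof.
move=> yS; have [S0|S0] := eqVneq S 0.
  move: yS; rewrite S0 => /(fun h => conj h (sqr_ge0 y))/andP/le_anti/eqP.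
  by rewrite sqrf_eq0 => /eqP ->; rewrite normr0 mulr0 powR_ge0.
have Sp : 0 < S by rewrite lt_def S0 (le_trans (sqr_ge0 y)).
have yS' : `|y| <= S `^ 2^-1.
  by rewrite -ler_sqr ?nnegrE ?powR_ge0// sqr_powR_half// real_normK ?num_real.
apply: (@le_trans _ _ (S `^ ((p - 2) / 2) * S `^ 2^-1)).
  by rewrite ler_wpM2l// powR_ge0.
by rewrite -powRD_gt0//; have -> : (p - 2) / 2 + 2^-1 = (p - 1) / 2 by field.
Qed.

Lemma powR_mul_norm_le (S y : R) : y ^+ 2 <= S -> S `^ ((p - 2) / 2) * `|y| <= S + 1.
Proof.
move=> yS; apply: le_trans (powR_mul_norm_le_powR yS) _.
apply: powR_le1D; first exact: le_trans (sqr_ge0 y) yS.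
  by rewrite divr_ge0// subr_ge0 ltW.
by rewrite ler_pdivrMr//; move: p2; lra.
Qed.

Lemma flux_le S k x : hder k x ^+ 2 <= S -> `|flux S k x| <= rho x * (S + 1).
Proof.
move=> h; rewrite /flux -mulrA normrM (ger0_norm (rho0 x)) ler_wpM2l//.
by rewrite normrM (ger0_norm (powR_ge0 _ _)) powR_mul_norm_le.
Qed.

(** Continuous weight of the singular terms in the majorant of [dflux]. The factor 2 is there
    because second derivatives enter [dflux] twice, through X_k X_k F and through the derivative of
    the power of S. *)
Definition hdom (k i : 'I_N) (j : 'I_n) (x : V) : R :=
  2 * (rho x * `|hfield G k x ord0 j|).

(** Since p - 2 < 0 and S >= (X_i F)^2, the power of S is at most |X_i F|^(p-2), which no longer
    involves S. Where X_i F = 0 the right side is 0 by the convention of [powR], and the last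
    hypothesis makes the left side vanish too. *)
Lemma hhess_le S k i x : 0 < S -> hder i x ^+ 2 <= S ->
  (forall j, hder i x = 0 -> 'D_(basis j) (hder i) x = 0) ->
  S `^ ((p - 2) / 2) * `|hhess k i x| <=
  \sum_j `|hfield G k x ord0 j| * (`|hder i x| `^ (p - 2) * `|'D_(basis j) (hder i) x|).
Proof.
move=> S0 iS h0; rewrite hhessE.
apply: (@le_trans _ _ (S `^ ((p - 2) / 2) * \sum_j `|hfield G k x ord0 j| * `|'D_(basis j) (hder i) x|)).
  rewrite ler_wpM2l ?powR_ge0//; apply: le_trans (ler_norm_sum _ _ _) _.
  by apply: ler_sum => j _; rewrite normrM.
rewrite mulr_sumr; apply: ler_sum => j _; rewrite mulrCA ler_wpM2l//.
have [vi|vi] := eqVneq (hder i x) 0; first by rewrite h0// normr0 !mulr0.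
rewrite ler_wpM2r//.
have -> : `|hder i x| `^ (p - 2) = (hder i x ^+ 2) `^ ((p - 2) / 2).
  rewrite -(real_normK (num_real (hder i x))) -(powR_mulrn 2)// -powRrM; congr (_ `^ _).
  by rewrite mulrC divfK.
apply: ler_powR_antimono => //.
  by rewrite mulr_le0_ge0// subr_le0 ltW.
by rewrite exprn_even_gt0.
Qed.

(** Differentiating the power of S costs a factor 1 / S, which |X_k F X_i F| <= S and |p - 2| <= 1
    absorb. Both second-order terms are then at most rho times the sum of the W i. *)
Lemma dflux_le S k x : 0 < S -> hsq x <= S ->
  (forall i j, hder i x = 0 -> 'D_(basis j) (hder i) x = 0) ->
  `|dflux S k x| <= \sum_i \sum_j hdom k i j x *
      (`|hder i x| `^ (p - 2) * `|'D_(basis j) (hder i) x|)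
    + (S + 1) * `|hrho k x|.
Proof.
move=> S0 hS h0.
pose W i := S `^ ((p - 2) / 2) * `|hhess k i x|.
have W0 i : 0 <= W i by rewrite mulr_ge0// powR_ge0.
have iS i : hder i x ^+ 2 <= S by apply: le_trans hS; exact: hder_le_hsq.
have hW : 2 * rho x * \sum_i W i <= \sum_i \sum_j hdom k i j x *
      (`|hder i x| `^ (p - 2) * `|'D_(basis j) (hder i) x|).
  rewrite mulr_sumr; apply: ler_sum => i _.
  apply: (@le_trans _ _ (2 * rho x * \sum_j `|hfield G k x ord0 j| * (`|hder i x| `^ (p - 2) * `|'D_(basis j) (hder i) x|))).
    rewrite ler_wpM2l ?mulr_ge0//; apply: hhess_le => // j; exact: h0.
  by rewrite mulr_sumr; apply: ler_sum => j _; rewrite /hdom !mulrA.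
apply: le_trans (lerD hW (lexx _)).
have t1 : `|rho x * S `^ ((p - 2) / 2) * hhess k k x| <= rho x * \sum_i W i.
  rewrite -mulrA normrM (ger0_norm (rho0 x)) ler_wpM2l// normrM (ger0_norm (powR_ge0 _ _)) -/(W k).
  by rewrite (bigD1 k)//= lerDl sumr_ge0.
have t2 : `|hder k x * (rho x * ((p - 2) / 2 * S `^ ((p - 2) / 2 - 1) *
      \sum_i 2 * (hder i x * hhess k i x)))| <= rho x * \sum_i W i.
  rewrite mulrCA normrM (ger0_norm (rho0 x)) ler_wpM2l//.
  rewrite mulr_sumr mulr_sumr; apply: le_trans (ler_norm_sum _ _ _) _.
  apply: ler_sum => i _.
  have -> : hder k x * ((p - 2) / 2 * S `^ ((p - 2) / 2 - 1) * (2 * (hder i x * hhess k i x)))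
    = (p - 2) * (hder k x * hder i x / S) * (S `^ ((p - 2) / 2) * hhess k i x).
    rewrite (powRD_gt0 _ _ S0) (powR_inv1 (ltW S0)).
    move: (hder k x) (hder i x) (hhess k i x) (S `^ _) => a b c P.
    by field; rewrite gt_eqF.
  rewrite normrM [X in _ * X]normrM (ger0_norm (powR_ge0 _ _)) -/(W i).
  rewrite -[leRHS]mul1r ler_wpM2r// normrM; apply: mulr_ile1 => //.
    by rewrite ler0_norm; move: p1 p2; lra.
  rewrite normrM normfV (gtr0_norm S0) ler_pdivrMr// mul1r ler_norml.
  move: (iS k) (iS i); move: (hder k x) (hder i x) => b c bS cS.
  have := sqr_ge0 (b - c); rewrite sqrrB => h1; have := sqr_ge0 (b + c); rewrite sqrrD => h2.
  by apply/andP; split; lra.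
have t3 : `|hder k x * (S `^ ((p - 2) / 2) * hrho k x)| <= (S + 1) * `|hrho k x|.
  rewrite mulrA normrM ler_wpM2r// normrM (ger0_norm (powR_ge0 _ _)) mulrC.
  exact: powR_mul_norm_le.
rewrite /dflux mulrDr; apply: le_trans (ler_normD _ _) _.
apply: le_trans (lerD t1 (le_trans (ler_normD _ _) (lerD t2 t3))) _.
by rewrite -mulrA; lra.
Qed.

End flux.

(** * The weak inequality *)

Lemma cvg_sumR (R : realType) (I : Type) (r : seq I) (f : I -> nat -> R) (l : I -> R) :
  (forall i, f i @ \oo --> l i) ->
  (fun m => \sum_(i <- r) f i m) @ \oo --> \sum_(i <- r) l i.
Proof.
move=> fl; elim: r => [|i r ih].
  by under eq_fun do rewrite big_nil; rewrite big_nil; exact: cvg_cst.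
by under eq_fun do rewrite big_cons; rewrite big_cons; apply: cvgD; [exact: fl|exact: ih].
Qed.

Section dominated_convergence_R.
Context {d : measure_display} {T : measurableType d} {R : realType}.
Variable mu : {measure set T -> \bar R}.

Lemma dominated_convergence_R (f_ : nat -> T -> R) (f g : T -> R) :
  (forall m, measurable_fun setT (f_ m)) -> measurable_fun setT f ->
  {ae mu, forall x, f_ ^~ x @ \oo --> f x} ->
  mu.-integrable setT (EFin \o g) ->
  {ae mu, forall x, forall m, `|f_ m x| <= g x} ->
  mu.-integrable setT (EFin \o f) /\
  (fun m => \int[mu]_x (f_ m x)%:E)%E @ \oo --> (\int[mu]_x (f x)%:E)%E.
Proof.
move=> mf_ mf cf ig hg.
have [|||||] := @dominated_convergence _ _ _ mu setT measurableT
  (fun m x => (f_ m x)%:E) (fun x => (f x)%:E) (fun x => (g x)%:E).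
- by move=> m; exact: (measurableT_comp (@EFin_measurable _ _) (mf_ m)).
- exact: (measurableT_comp (@EFin_measurable _ _) mf).
- by apply: filterS cf => x cx _; apply: cvg_EFin; [exact: nearW|exact: cx].
- exact: ig.
- by apply: filterS hg => x gx m _; rewrite /= lee_fin.
by move=> fi _ fc; split.
Qed.

End dominated_convergence_R.

Section weak.
Context {R : realType} {N : nat} {Ns : seq nat} (G : stratified_group R N Ns).
Local Notation n := (N + sumn Ns)%N.
Local Notation V := 'rV[R]_n.
Local Notation mu := (lebesgue_rV n).
Variables (p : R) (rho F phi : V -> R).
Hypotheses (p1 : 1 < p) (p2 : p < 2) (rho0 : forall x, 0 <= rho x)
  (rhoC : Ck 1 rho) (Fs : smooth F) (pC : Ck 1 phi) (pb : bounded_support phi)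
  (p0 : forall x, 0 <= phi x).

Local Notation hd := (hder G F).
Local Notation hs := (hsq G F).
Local Notation fl := (flux G p rho F).
Local Notation dfl := (dflux G p rho F).

Definition hphi (k : 'I_N) (x : V) : R := 'D_(hfield G k x) phi x.

Lemma hphi_cbs k : cbs (hphi k).
Proof.
split; first exact: (hderive_Ck G (m := 0) k pC).
by case: pb => M hM; exists M => x; exact: derive_bounded_support.
Qed.

(** The regularised flux is C^1, so X_k (flux * phi) integrates to 0. *)
Lemma weak_identity_reg (e : R) : 0 < e ->
  \int[mu]_x (\sum_k fl (hs x + e ^+ 2) k x * hphi k x) =
  - \int[mu]_x (phi x * \sum_k dfl (hs x + e ^+ 2) k x).
Proof.
move=> e0.
have s0 x : 0 < hs x + e ^+ 2 by rewrite ltr_wpDl ?hsq_ge0// exprn_gt0.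
have flC k := flux_Ck G p rhoC Fs k e0.
have b1 k : cbs (fun x => fl (hs x + e ^+ 2) k x * hphi k x).
  exact: (cbsMr (hphi_cbs k) (Ck_cont (flC k))).
have b2 k : cbs (fun x => phi x * dfl (hs x + e ^+ 2) k x).
  exact: (cbsMl (cbs_Ck1 pC pb) (dflux_continuous rhoC Fs e0)).
have e1 k : \int[mu]_x (fl (hs x + e ^+ 2) k x * hphi k x) +
    \int[mu]_x (phi x * dfl (hs x + e ^+ 2) k x) = 0.
  rewrite -(cbs_intD (b1 k) (b2 k)).
  have hC : Ck 1 (fun x => fl (hs x + e ^+ 2) k x * phi x) by exact: CkM.
  have h0 := integral_hfield G k hC (bounded_supportMr _ pb).
  rewrite /Rintegral; set I1 := (X in fine X).
  suff -> : I1 = 0%E by [].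
  rewrite -h0; apply: eq_integral => x _; congr EFin.
  have d1 := is_deriveM_pt (is_derive_flux p rhoC Fs k (s0 x)) (Ck1_is_derive x (hfield G k x) pC).
  by rewrite (derive_is d1).
rewrite (cbs_int_sum _ b1).
under [in RHS]eq_Rintegral do rewrite mulr_sumr.
rewrite (cbs_int_sum _ b2) -sumrN; apply: eq_bigr => k _.
by apply/eqP; rewrite -addr_eq0 e1.
Qed.

Lemma ae_hder_flat1 : {ae mu, forall x, phi x != 0 ->
  forall i j, hd i x = 0 -> 'D_(basis j) (hd i) x = 0}.
Proof.
have h i j := ae_derive_eq0 j (hder_smooth G Fs i) pC pb p0.
have : {ae mu, forall x, forall i j, phi x != 0 -> hd i x = 0 -> 'D_(basis j) (hd i) x = 0}.
  by apply: filter_forall => i; apply: filter_forall => j; exact: h.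
by apply: filterS => x hx px i j; exact: hx.
Qed.

(* Dominates the divergences of all the regularised fluxes. *)
Definition gdom (x : V) : R := \sum_k (\sum_i \sum_j hdom G rho k i j x *
    (`|hd i x| `^ (p - 2) * `|'D_(basis j) (hd i) x| * phi x)
  + (hs x + 2) * `|hrho G rho k x| * phi x).

Lemma gdom_integrable : mu.-integrable setT (EFin \o gdom).
Proof.
apply: integrable_sumR => k; apply: integrableDR.
  apply: integrable_sumR => i; apply: integrable_sumR => j.
  apply: integrable_continuousM.
  - apply: (@CkM _ _ 0); first exact: cst_continuous.
    apply: (@CkM _ _ 0); first exact: (Ck_cont rhoC).
    by move=> x; apply: continuous_comp; [exact: (hfield_coord_Ck G k j 0)|exact: norm_continuous].
  - exact: bounded_supportMr.
  - by apply: root_integrable => //; exact: hder_smooth.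
apply: cbs_integrable; apply: cbsMr; first exact: cbs_Ck1.
apply: (@CkM _ _ 0).
  by apply: (@CkD _ _ 0); [exact: (hsq_smooth G Fs 0)|exact: cst_continuous].
by move=> x; apply: continuous_comp; [exact: (hderive_Ck G (m := 0) k rhoC)|exact: norm_continuous].
Qed.

Lemma dflux_dom x S : (phi x != 0 ->
    forall i j, hd i x = 0 -> 'D_(basis j) (hd i) x = 0) ->
  0 < S -> hs x <= S -> S <= hs x + 1 ->
  `|phi x * \sum_k dfl S k x| <= gdom x.
Proof.
move=> h0 S0 hS Sh; have [px|px] := eqVneq (phi x) 0.
  rewrite px mul0r normr0; apply: sumr_ge0 => k _; rewrite px mulr0 addr0.
  by apply: sumr_ge0 => i _; apply: sumr_ge0 => j _; rewrite !mulr0.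
rewrite normrM (ger0_norm (p0 x)) mulrC -ler_pdivlMr; last by rewrite lt_def px p0.
apply: le_trans (ler_norm_sum _ _ _) _.
rewrite /gdom mulr_suml; apply: ler_sum => k _.
apply: le_trans (dflux_le p1 p2 rho0 Fs k S0 hS (h0 px)) _.
rewrite [leRHS]mulrDl mulfK//; apply: lerD; last by rewrite ler_wpM2r//; lra.
rewrite mulr_suml; apply: ler_sum => i _; rewrite mulr_suml; apply: ler_sum => j _.
by rewrite -[leRHS]mulrA mulfK.
Qed.

Lemma cvg_dflux (S_ : nat -> R) (S : R) k x : 0 < S -> S_ @ \oo --> S ->
  (fun m => dfl (S_ m) k x) @ \oo --> dfl S k x.
Proof.
move=> S0 hS.
have c1 := cvg_powR_gt0 (a := (p - 2) / 2) S0 hS.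
have c2 := cvg_powR_gt0 (a := (p - 2) / 2 - 1) S0 hS.
apply: cvgD; first by apply: cvgMl; apply: cvgMr.
apply: cvgMr; apply: cvgD; last exact: cvgMl.
by apply: cvgMr; apply: cvgMl; exact: cvgMr.
Qed.

Lemma cvg_flux (S_ : nat -> R) (S : R) k x : 0 < S -> S_ @ \oo --> S ->
  (fun m => fl (S_ m) k x) @ \oo --> fl S k x.
Proof.
move=> S0 hS; have c1 := cvg_powR_gt0 (a := (p - 2) / 2) S0 hS.
by apply: cvgMl; exact: cvgMr.
Qed.

Lemma dflux_eq0 S k x : (forall i j, hd i x = 0 -> 'D_(basis j) (hd i) x = 0) ->
  hs x = 0 -> dfl S k x = 0.
Proof.
move=> h0 /hsq_eq0 hd0; rewrite /dflux hd0 mul0r addr0 hhessE// big1 ?mulr0// => j _.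
by rewrite h0 ?mulr0.
Qed.

Lemma measurable_hsq_powR r : measurable_fun setT (fun x => hs x `^ r).
Proof.
apply: (measurableT_comp (measurable_powR _)).
exact: (continuous_measurable_rV (hsq_smooth G Fs 0)).
Qed.

Lemma measurable_flux k : measurable_fun setT (fun x => fl (hs x) k x).
Proof.
apply: measurable_funM; last exact: (continuous_measurable_rV (hder_smooth G Fs k 0)).
apply: measurable_funM; last exact: measurable_hsq_powR.
exact: (continuous_measurable_rV (Ck_cont rhoC)).
Qed.

Lemma hhess_continuous k i : continuous (hhess G F k i).
Proof. exact: (hderive_Ck G (m := 0) k (hder_smooth G Fs i 1)). Qed.

Lemma measurable_dflux k : measurable_fun setT (fun x => dfl (hs x) k x).
Proof.
have mr := continuous_measurable_rV (Ck_cont rhoC).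
have mh i := continuous_measurable_rV (hder_smooth G Fs i 0).
have mhh i := continuous_measurable_rV (@hhess_continuous k i).
apply: measurable_funD.
  apply: measurable_funM; last exact: mhh.
  by apply: measurable_funM; [exact: mr|exact: measurable_hsq_powR].
apply: measurable_funM; first exact: mh.
apply: measurable_funD.
  apply: measurable_funM; first exact: mr.
  apply: measurable_funM.
    by apply: measurable_funM; [exact: measurable_cst|exact: measurable_hsq_powR].
  apply: measurable_sumR => i; apply: measurable_funM; first exact: measurable_cst.
  by apply: measurable_funM; [exact: mh|exact: mhh].
apply: measurable_funM; first exact: measurable_hsq_powR.
exact: (continuous_measurable_rV (hderive_Ck G (m := 0) k rhoC)).
Qed.

(** Dominated convergence on both sides of the regularised identity with e = 1 / (m + 1): the flux
    side is dominated because |grad F|^(p-1) grows at most linearly in |grad F|^2, the divergence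
    side by [gdom]. *)
Lemma weak_identity :
  [/\ mu.-integrable setT (EFin \o (fun x => \sum_k fl (hs x) k x * hphi k x)),
      mu.-integrable setT (EFin \o (fun x => phi x * \sum_k dfl (hs x) k x)) &
  (\int[mu]_x (\sum_k fl (hs x) k x * hphi k x)%:E =
   - \int[mu]_x (phi x * \sum_k dfl (hs x) k x)%:E)%E].
Proof.
pose d_ (m : nat) : R := m.+1%:R^-1.
have d0 m : 0 < d_ m by rewrite invr_gt0.
have d21 m : d_ m ^+ 2 <= 1.
  by rewrite exprn_ile1// ?(ltW (d0 m))// invf_le1// ler1n.
have dcvg : d_ @ \oo --> 0 by exact: cvg_harmonic.
pose S_ m x := hs x + d_ m ^+ 2.
have S0 m x : 0 < S_ m x by rewrite ltr_wpDl ?hsq_ge0// exprn_gt0.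
have hS m x : hs x <= S_ m x by rewrite lerDl sqr_ge0.
have Sh m x : S_ m x <= hs x + 1 by rewrite lerD2l.
have Scvg x : S_ ^~ x @ \oo --> hs x.
  rewrite -[X in _ --> X]addr0 -[X in _ --> _ + X](mul0r 0).
  by apply: cvgD; [exact: cvg_cst|under eq_fun do rewrite expr2; exact: cvgM].
have flC m k := flux_Ck G p rhoC Fs k (d0 m).
pose A m x := \sum_k fl (S_ m x) k x * hphi k x.
pose B m x := phi x * \sum_k dfl (S_ m x) k x.
have Ab m : cbs (A m).
  by apply: cbs_sum => k; exact: (cbsMr (hphi_cbs k) (Ck_cont (flC m k))).
have Bb m : cbs (B m).
  have -> : B m = fun x => \sum_k phi x * dfl (S_ m x) k x.
    by apply/funext => x; rewrite /B mulr_sumr.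
  apply: cbs_sum => k.
  exact: (cbsMl (cbs_Ck1 pC pb) (dflux_continuous rhoC Fs (d0 m))).
have AB m : (\int[mu]_x (A m x)%:E = - \int[mu]_x (B m x)%:E)%E.
  by rewrite (cbs_fin (Ab m)) (cbs_fin (Bb m)) -EFinN -(weak_identity_reg (d0 m)).
have [|||||iA cA] := @dominated_convergence_R _ _ _ mu A (fun x => \sum_k fl (hs x) k x * hphi k x)
    (fun x => \sum_k rho x * (hs x + 2) * `|hphi k x|).
- by move=> m; exact: (continuous_measurable_rV (proj1 (Ab m))).
- apply: measurable_sumR => k; apply: measurable_funM; first exact: measurable_flux.
  exact: (continuous_measurable_rV (proj1 (hphi_cbs k))).
- apply: aeW => x; apply: cvg_sumR => k; apply: cvgMl.
  have [s0|s0] := eqVneq (hs x) 0.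
    have /hsq_eq0/(_ k) h0 := s0.
    rewrite /flux h0; under eq_fun do rewrite mulr0.
    by rewrite mulr0; exact: cvg_cst.
  by apply: cvg_flux; [rewrite lt_def s0 hsq_ge0|exact: Scvg].
- apply: integrable_sumR => k; apply: cbs_integrable; apply: cbsMr.
    exact/cbs_norm/hphi_cbs.
  apply: (@CkM _ _ 0); first exact: (Ck_cont rhoC).
  by apply: (@CkD _ _ 0); [exact: (hsq_smooth G Fs 0)|exact: cst_continuous].
- apply: aeW => x m; apply: le_trans (ler_norm_sum _ _ _) _; apply: ler_sum => k _.
  rewrite normrM ler_wpM2r//; apply: le_trans (flux_le p1 p2 rho0 _) _.
    by apply: le_trans (hS m x); exact: hder_le_hsq.
  by rewrite ler_wpM2l//; have := Sh m x; lra.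
have [|||||iB cB] := @dominated_convergence_R _ _ _ mu B (fun x => phi x * \sum_k dfl (hs x) k x) gdom.
- by move=> m; exact: (continuous_measurable_rV (proj1 (Bb m))).
- apply: measurable_funM; first exact: (continuous_measurable_rV (Ck_cont pC)).
  by apply: measurable_sumR => k; exact: measurable_dflux.
- apply: filterS ae_hder_flat1 => x hx; rewrite /B.
  have [px|px] := eqVneq (phi x) 0.
    by rewrite px mul0r; under eq_fun do rewrite mul0r; exact: cvg_cst.
  apply: cvgMr; apply: cvg_sumR => k.
  (* At critical points outside a null set the second derivatives vanish as well, so all the
     divergences, regularised or not, are 0 there. *)
  have [s0|s0] := eqVneq (hs x) 0.
    under eq_fun do rewrite (dflux_eq0 _ _ (hx px) s0).
    by rewrite (dflux_eq0 _ _ (hx px) s0); exact: cvg_cst.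
  by apply: cvg_dflux; [rewrite lt_def s0 hsq_ge0|exact: Scvg].
- exact: gdom_integrable.
- by apply: filterS ae_hder_flat1 => x hx m; exact: dflux_dom.
split => //.
have c2 : (fun m => \int[mu]_x (A m x)%:E)%E @ \oo -->
    (- \int[mu]_x (phi x * \sum_k dfl (hs x) k x)%:E)%E.
  have -> : (fun m => \int[mu]_x (A m x)%:E)%E = (fun m => - \int[mu]_x (B m x)%:E)%E.
    by apply/funext => m; exact: AB.
  exact: cvgeN.
exact: (cvg_unique (@ereal_hausdorff R) cA c2).
Qed.

End weak.

Lemma derive_quadratic_eq0 (R : realType) (V : normedModType R) (T : V -> R) x v K :
  derivable T x v -> T x = 0 ->
  (forall t : R, `|t| <= 1 -> `|T (t *: v + x)| <= K * t ^+ 2) -> 'D_v T x = 0.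
Proof.
move=> Td Tx TK.
have c : (fun h : R => h^-1 *: ((T \o shift x) (h *: v) - T x)) @ 0^' --> (0 : R).
  apply/cvgrPdist_le => e e0; near=> h.
  have h0 : h != 0 by near: h; exact: nbhs_dnbhs_neq.
  have h1 : `|h| <= 1 by apply: ltW; near: h; exact: dnbhs0_lt.
  have hK : `|h| * (`|K| + 1) <= e.
    rewrite -ler_pdivlMr ?ltr_wpDl//; apply: ltW; near: h; apply: dnbhs0_lt.
    by rewrite divr_gt0// ltr_wpDl.
  rewrite sub0r normrN Tx subr0 /= -[_ *: _]/(_ * _) normrM normfV.
  rewrite mulrC ler_pdivrMr ?normr_gt0//; apply: le_trans (TK h h1) _.
  rewrite -(real_normK (num_real h)) expr2 mulrA ler_wpM2r//.
  apply: le_trans hK; rewrite mulrC ler_wpM2l//.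
  by apply: le_trans (ler_norm _) _; rewrite lerDl.
exact: (cvg_unique _ Td c).
Unshelve. all: by end_near. Qed.

Section weak_ineq.
Context {R : realType} {N : nat} {Ns : seq nat} (G : stratified_group R N Ns).
Local Notation n := (N + sumn Ns)%N.
Local Notation V := 'rV[R]_n.
Local Notation mu := (lebesgue_rV n).
Variables (p : R) (rho F phi : V -> R).
Hypotheses (p1 : 1 < p) (p2 : p < 2) (rho0 : forall x, 0 <= rho x)
  (rhoC : Ck 1 rho) (Fs : smooth F) (pC : Ck 1 phi) (pb : bounded_support phi)
  (p0 : forall x, 0 <= phi x).

Local Notation hd := (hder G F).
Local Notation hs := (hsq G F).
Local Notation fl := (flux G p rho F).
Local Notation dfl := (dflux G p rho F).

Lemma p_flux_fctE k : (fun z => p_flux G p rho F z ord0 k) = fun z => fl (hs z) k z.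
Proof. by apply/funext => z; exact: p_fluxE. Qed.

Lemma p_sub_laplacianE x : hs x != 0 ->
  p_sub_laplacian G p rho F x = \sum_k dfl (hs x) k x.
Proof.
move=> s0; apply: eq_bigr => k _; rewrite p_flux_fctE.
have S0 : 0 < hs x + 0 ^+ 2 by rewrite expr0n addr0 lt_def s0 hsq_ge0.
have d1 := is_derive_flux p rhoC Fs k S0.
have e1 : (fun z => fl (hs z + 0 ^+ 2) k z) = fun z => fl (hs z) k z.
  by apply/funext => z; rewrite expr0n addr0.
by rewrite e1 in d1; rewrite (derive_is d1) expr0n addr0.
Qed.

(** Along the direction of X_k the flux is at most a constant times |grad F|^(p-1), which flatness
    of order m makes O(|t|^(m(p-1))), hence O(t^2). Its derivative, which exists by hypothesis, can
    then only be 0. *)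
Lemma p_sub_laplacian_flat m x : 2 <= m%:R * (p - 1) ->
  (forall i, flat m (hd i) x) -> hs x = 0 ->
  p_sub_laplacian_exists G p rho F x -> p_sub_laplacian G p rho F x = 0.
Proof.
move=> mp fl0 s0 ex; rewrite /p_sub_laplacian /hdiv big1// => k _.
have := ex k; rewrite p_flux_fctE; set v := hfield G k x => Td.
have hC i := flat_Taylor v (hder_smooth G Fs i) (fl0 i).
have [C [C0 hsC]] : exists C, 0 <= C /\ forall t : R, `|t| <= 1 -> hs (t *: v + x) <= C * (`|t| ^+ m) ^+ 2.
  have hCi i := cid2 (hC i).
  exists (\sum_i (s2val (hCi i)) ^+ 2); split; first by apply: sumr_ge0 => i _; exact: sqr_ge0.
  move=> t t1; rewrite /hsq mulr_suml; apply: ler_sum => i _.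
  rewrite -exprMn -(real_normK (num_real (hd i _))) ler_sqr ?nnegrE//.
    exact: (s2valP' (hCi i)).
  by rewrite mulr_ge0 ?exprn_ge0//; exact: (s2valP (hCi i)).
have [L [L0 hL]] : exists L, 0 <= L /\ forall t : R, `|t| <= 1 -> rho (t *: v + x) <= L.
  have : compact (rho @` cube (`|v| + `|x|)).
    by apply: continuous_compact; [apply: continuous_subspaceT; exact: (Ck_cont rhoC)|exact: compact_cube].
  move=> /compact_bounded[L [_ hL]]; exists (`|L| + 1); split; first by rewrite addr_ge0.
  move=> t t1; apply: le_trans (ler_norm _) _; apply: hL; first by rewrite ltr_pwDr// ler_norm.
  exists (t *: v + x) => // i; rewrite in_itv/= -ler_norml.
  apply: le_trans (rV_norm_coord _ _) _; apply: le_trans (ler_normD _ _) _.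
  by rewrite lerD2r normrZ -[leRHS]mul1r ler_wpM2r.
apply: (@derive_quadratic_eq0 _ _ _ x v (L * C `^ ((p - 1) / 2))) => //.
  have /hsq_eq0/(_ k) h0 := s0.
  by rewrite /flux h0 mulr0.
move=> t t1; rewrite /flux -mulrA normrM (ger0_norm (rho0 _)) -mulrA.
apply: ler_pM => //; first exact: hL.
rewrite normrM (ger0_norm (powR_ge0 _ _)).
apply: le_trans (powR_mul_norm_le_powR p (hder_le_hsq G F k _)) _.
have e0 : 0 <= (p - 1) / 2 by rewrite divr_ge0// subr_ge0 ltW.
apply: le_trans (ge0_ler_powR e0 _ _ (hsC t t1)) _; rewrite ?nnegrE ?hsq_ge0//.
  by rewrite mulr_ge0// sqr_ge0.
rewrite powRM ?sqr_ge0// ler_wpM2l ?powR_ge0//.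
rewrite -exprM -(powR_mulrn (m * 2))// -powRrM natrM.
have -> : m%:R * 2 * ((p - 1) / 2) = m%:R * (p - 1) by field.
rewrite -(real_normK (num_real t)); have [->|t0] := eqVneq t 0.
  by rewrite normr0 powR0 ?sqr_ge0// gt_eqF// (lt_le_trans _ mp).
rewrite -(powR_mulrn 2)//; apply: ger_powR => //.
by rewrite normr_gt0 t0.
Qed.

(** Off the critical set [p_sub_laplacian] is the sum of the [dflux] terms; on it both are 0 almost
    everywhere where phi does not vanish, so the hypothesis transfers to the integrand of
    [weak_identity]. The truncation by [Num.max 0] makes the integrand nonnegative everywhere, eta
    being nonnegative only almost everywhere. *)
Lemma weak_inequality (eta : V -> R) : measurable_fun setT eta ->
  (forall x, 0 <= F x) ->
  {ae mu, forall x, 0 <= eta x} ->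
  {ae mu, forall x, p_sub_laplacian_exists G p rho F x /\
        eta x * F x `^ (p - 1) <= - p_sub_laplacian G p rho F x} ->
  (\int[mu]_x (Num.max 0 (eta x * F x `^ (p - 1)) * phi x)%:E <=
   \int[mu]_x (\sum_k fl (hs x) k x * hphi G phi k x)%:E)%E.
Proof.
move=> meta F0 eta0 hex.
have [i1 i2 ->] := weak_identity G p1 p2 rho0 rhoC Fs pC pb p0.
pose g x := phi x * \sum_k dfl (hs x) k x.
have mg : measurable_fun setT g by apply/measurable_EFinP; case/integrableP: i2.
have mF : measurable_fun setT F := continuous_measurable_rV (Fs 0).
have mphi : measurable_fun setT phi := continuous_measurable_rV (Ck_cont pC).
have [m hm] : exists m : nat, 2 <= m%:R * (p - 1).
  exists (Num.truncn (2 / (p - 1))).+1.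
  by rewrite -ler_pdivrMr ?subr_gt0// ltW// truncnS_gt.
have fl0 : {ae mu, forall x, forall i, phi x != 0 -> hd i x = 0 -> flat m (hd i) x}.
  by apply: filter_forall => i; exact: ae_flat (hder_smooth G Fs i) pC pb p0.
have key : {ae mu, forall x, Num.max 0 (eta x * F x `^ (p - 1)) * phi x <= - g x}.
  apply: filterS3 eta0 hex fl0 => x e0 [ex hx] fx.
  rewrite max_r ?mulr_ge0 ?powR_ge0//.
  have [px|px] := eqVneq (phi x) 0; first by rewrite /g px mulr0 mul0r oppr0.
  rewrite /g mulrC -mulrN ler_wpM2l//.
  have [s0|s0] := eqVneq (hs x) 0; last by rewrite -p_sub_laplacianE.
  have hd0 i : hd i x = 0 by have /hsq_eq0 := s0.
  (* Here S = 0, and its power with nonzero exponent (p - 2) / 2 is 0 by convention. *)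
  have -> : \sum_k dfl (hs x) k x = 0.
    rewrite big1// => k _; rewrite /dflux hd0 mul0r addr0 s0 powR0 ?mulr0 ?mul0r//.
    by rewrite mulf_neq0 ?invr_eq0// subr_eq0 lt_eqF.
  by rewrite -(p_sub_laplacian_flat hm (fun i => fx i px (hd0 i)) s0 ex).
have -> : (- (\int[mu]_x (phi x * \sum_k dfl (hs x) k x)%:E) = \int[mu]_x (Num.max 0 (- g x))%R%:E)%E.
  transitivity (\int[mu]_x (- g x)%:E)%E.
    have := @integralZl _ _ _ mu setT measurableT _ i2 (-1).
    under eq_integral do rewrite EFinN mulN1e.
    by rewrite EFinN mulN1e => <-.
  apply: ae_eq_integral => //.
  - by apply/measurable_EFinP; exact: measurableT_comp.
  - apply/measurable_EFinP; apply: measurable_maxr; first exact: measurable_cst.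
    exact: measurableT_comp.
  - apply: filterS2 eta0 key => x e0 kx _; rewrite max_r//.
    by apply: le_trans kx; rewrite mulr_ge0// le_max lexx.
apply: ae_ge0_le_integral => //.
- by move=> x _; rewrite lee_fin mulr_ge0// le_max lexx.
- apply/measurable_EFinP; apply: measurable_funM => //; apply: measurable_maxr; first exact: measurable_cst.
  apply: measurable_funM => //; exact: (measurableT_comp (measurable_powR _)).
- by move=> x _; rewrite lee_fin le_max lexx.
- apply/measurable_EFinP; apply: measurable_maxr; first exact: measurable_cst.
  exact: measurableT_comp.
- by apply: filterS key => x kx _; rewrite lee_fin le_max kx orbT.
Qed.

End weak_ineq.

(** * Energies and the passage to the limit *)

Section lower_integral.
Context {d : measure_display} {T : measurableType d} {R : realType}.
Variable mu : {measure set T -> \bar R}.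
Local Open Scope ereal_scope.

Lemma nnintegral_mono (f g : T -> \bar R) : (forall x, 0 <= f x) ->
  (forall x, f x <= g x) -> \int[mu]_x f x <= \int[mu]_x g x.
Proof.
move=> f0 fg; rewrite !ge0_integralTE//; last by move=> x; exact: le_trans (fg x).
apply: le_ereal_sup => _ [h /= hf <-]; exists h => // x.
exact: le_trans (hf x) (fg x).
Qed.

(* No measurability of [f]: the integral of a nonnegative function is the
   supremum over the simple functions below it. *)
Lemma ae_nnintegral_mono (f g : T -> \bar R) : (forall x, 0 <= f x) ->
  (forall x, 0 <= g x) -> measurable_fun setT g ->
  {ae mu, forall x, f x <= g x} -> \int[mu]_x f x <= \int[mu]_x g x.
Proof.
move=> f0 g0 mg [A [mA A0 fgA]].
(* Raising g to +oo on a measurable null set makes the domination hold everywhere without changing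
   the integral. *)
pose h x := g x + +oo * (\1_A x)%:E.
have hA x : A x -> h x = +oo.
  by move=> Ax; rewrite /h indicE mem_set// mule1 addey// gt_eqF// (lt_le_trans _ (g0 x)).
have hN x : ~ A x -> h x = g x by move=> Ax; rewrite /h indicE memNset// mule0 adde0.
have h0 x : 0 <= h x.
  by rewrite adde_ge0// mule_ge0// lee_fin indicE ler0n.
have mh : measurable_fun setT h.
  apply: emeasurable_funD => //; apply: emeasurable_funM; first exact: measurable_cst.
  by apply/measurable_EFinP; exact: measurable_indic.
apply: (@le_trans _ _ (\int[mu]_x h x)).
  apply: nnintegral_mono => // x; have [Ax|Ax] := pselect (A x); first by rewrite hA// leey.
  rewrite hN//; apply: contrapT => fg; apply: Ax; exact: fgA.
rewrite le_eqVlt; apply/orP; left; apply/eqP; apply: ge0_ae_eq_integral => //.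
exists A; split => // x /= hx; apply: contrapT => Ax; apply: hx => _; exact: hN.
Qed.

End lower_integral.

Section abs_powR.
Context {R : realType}.
Implicit Types (t p r e : R).

Lemma powR_small r e : 0 < r -> 0 < e ->
  exists2 dl, 0 < dl & forall t, 0 <= t -> t <= dl -> t `^ r <= e.
Proof.
move=> r0 e0; exists (e `^ r^-1); first exact: powR_gt0.
move=> t t0 te; have := @ge0_ler_powR _ r (ltW r0) t (e `^ r^-1).
rewrite !nnegrE powR_ge0 => /(_ t0 isT te); rewrite -powRrM mulVf ?gt_eqF// powRr1//.
exact: ltW.
Qed.

Lemma abs_powRE p t : `|t| `^ p = (t ^+ 2) `^ (p / 2).
Proof.
rewrite -(real_normK (num_real t)) -(powR_mulrn 2)// -powRrM; congr (_ `^ _).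
by rewrite mulrC divfK.
Qed.

Lemma abs_powR_mul p t : 1 < p -> `| `|t| `^ (p - 2) * t| = `|t| `^ (p - 1).
Proof.
move=> p1; rewrite normrM (ger0_norm (powR_ge0 _ _)).
have [->|t0] := eqVneq t 0; first by rewrite normr0 mulr0 powR0// subr_eq0 gt_eqF.
rewrite -{2}[`|t|]powRr1// -powRD_gt0 ?normr_gt0//; congr (_ `^ _); ring.
Qed.

(** Away from 0, |t|^p is a power of t^2 > 0. At 0 the difference quotient has absolute value
    |h|^(p-1), which tends to 0 because p > 1. *)
Lemma is_derive_abs_powR p t : 1 < p ->
  is_derive t 1 (fun t : R => `|t| `^ p) (p * (`|t| `^ (p - 2) * t)).
Proof.
move=> p1; have p0 : 0 < p by apply: lt_trans p1.
have E : (fun t : R => `|t| `^ p) = fun t => (t ^+ 2) `^ (p / 2).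
  by apply/funext => s; exact: abs_powRE.
have [->|t0] := eqVneq t 0.
  rewrite normr0 !mulr0.
  have c : (fun h : R => h^-1 *: (((fun t : R => `|t| `^ p) \o shift 0) (h *: 1) - `|0 : R| `^ p)) @ 0^' --> (0 : R).
    apply/cvgrPdist_le => e e0.
    have [dl dl0 hdl] : exists2 dl, 0 < dl & forall t, 0 <= t -> t <= dl -> t `^ (p - 1) <= e.
      by apply: powR_small; rewrite ?subr_gt0.
    near=> h.
    have h0 : h != 0 by near: h; exact: nbhs_dnbhs_neq.
    rewrite sub0r normrN normr0 (powR0 (lt0r_neq0 p0)) subr0 /= addr0.
    rewrite -[h *: 1]/(h * 1) mulr1 -[_ *: _]/(_ * _) normrM normfV.
    rewrite (ger0_norm (powR_ge0 _ _)) mulrC -powR_inv1// -powRD_gt0 ?normr_gt0//.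
    apply: hdl => //; apply: ltW; near: h; exact: dnbhs0_lt.
  by split; [apply/cvg_ex; exists 0|exact: cvg_lim].
rewrite E.
have d1 := is_derive_powR (p / 2) (is_derive_sqr_pt (is_derive_id t 1)) (_ : 0 < t ^+ 2).
apply: is_derive_eq (d1 _) _; first by rewrite exprn_even_gt0.
rewrite /= mulr1 abs_powRE.
have -> : (p - 2) / 2 = p / 2 - 1 by field.
by field.
Unshelve. all: by end_near. Qed.

Lemma continuous_abs_powR_mul p : 1 < p ->
  continuous (fun t : R => p * (`|t| `^ (p - 2) * t)).
Proof.
move=> p1 t; apply: cvgM; first exact: cvg_cst.
have [->|t0] := eqVneq t 0.
  rewrite /continuous_at mulr0; apply/cvgrPdist_le => e e0.
  have [dl dl0 hdl] : exists2 dl, 0 < dl & forall t, 0 <= t -> t <= dl -> t `^ (p - 1) <= e.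
    by apply: powR_small; rewrite ?subr_gt0.
  apply/nbhs_ballP; exists dl => //= s; rewrite /ball/= sub0r normrN => sd.
  by rewrite sub0r normrN abs_powR_mul//; apply: hdl => //; exact: ltW.
apply: cvgM; last exact: cvg_id.
have n0 : 0 < `|t| by rewrite normr_gt0.
exact: (@cvg_comp _ _ _ (fun s : R => `|s|) (fun s : R => s `^ (p - 2)) _ _ _
  (@norm_continuous _ R t) (continuous_powR_gt0 n0)).
Qed.

Lemma Ck1_abs_powR (V : normedModType R) (f : V -> R) p : 1 < p -> Ck 1 f ->
  Ck 1 (fun x => `|f x| `^ p).
Proof.
move=> p1 fC.
have gd x := is_derive_abs_powR (f x) p1.
have gc x : {for f x, continuous (fun t : R => p * (`|t| `^ (p - 2) * t))}.
  exact: continuous_abs_powR_mul.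
exact: (@Ck1_comp _ _ f (fun t : R => `|t| `^ p) (fun t : R => p * (`|t| `^ (p - 2) * t)) fC gd gc).
Qed.

Lemma is_derive_abs_powR_comp (V : normedModType R) (f : V -> R) p x v : 1 < p -> Ck 1 f ->
  is_derive x v (fun x => `|f x| `^ p) (p * (`|f x| `^ (p - 2) * f x) * 'D_v f x).
Proof.
by move=> p1 fC; exact: is_derive_comp_pt (Ck1_is_derive x v fC) (is_derive_abs_powR (f x) p1).
Qed.

End abs_powR.

Section enorm_limits.
Context {R : realType}.

Lemma continuous_enorm (V : normedModType R) n (u : V -> 'rV[R]_n) :
  (forall i, continuous (fun x => u x ord0 i)) -> continuous (fun x => enorm (u x)).
Proof.
move=> uc x.
have c : continuous (fun x => \sum_i u x ord0 i * u x ord0 i).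
  by apply: (@Ck_sum _ _ 0) => i; exact: (@CkM _ _ 0).
exact: (@cvg_comp _ _ _ (fun x => \sum_i u x ord0 i * u x ord0 i) Num.sqrt
  _ _ _ (c x) (@sqrt_continuous _ _)).
Qed.

Lemma cvg_enorm n (u_ : nat -> 'rV[R]_n) (u : 'rV[R]_n) :
  (forall i, (fun m => u_ m ord0 i) @ \oo --> u ord0 i) ->
  (fun m => enorm (u_ m)) @ \oo --> enorm u.
Proof.
move=> uc.
have c : (fun m => dotv (u_ m) (u_ m)) @ \oo --> dotv u u.
  by apply: cvg_sumR => i; exact: cvgM.
exact: (@cvg_comp _ _ _ (fun m => dotv (u_ m) (u_ m)) Num.sqrt _ _ _ c (@sqrt_continuous _ _)).
Qed.

End enorm_limits.

Lemma powR_split2 (R : realType) (t p : R) : p != 0 -> 0 <= t -> t `^ p = t `^ (p - 2) * t ^+ 2.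
Proof.
move=> p0; rewrite le_eqVlt => /predU1P[<-|t0]; first by rewrite powR0// expr0n mulr0.
by rewrite -(powR_mulrn 2) ?(ltW t0)// -powRD_gt0// subrK.
Qed.

Section energy.
Context {R : realType} {N : nat} {Ns : seq nat} (G : stratified_group R N Ns).
Local Notation n := (N + sumn Ns)%N.
Local Notation V := 'rV[R]_n.
Local Notation mu := (lebesgue_rV n).
Variables (p : R) (rho F f : V -> R).
Hypotheses (p1 : 1 < p) (p2 : p < 2) (rho0 : forall x, 0 <= rho x)
  (rhoC : Ck 1 rho) (F0 : forall x, 0 <= F x) (Fs : smooth F) (fs : smooth f)
  (fb : bounded_support f).

Local Notation hs := (hsq G F).
Local Notation fl := (flux G p rho F).

Definition testfun (e : R) (x : V) : R := `|f x| `^ p * (F x + e) `^ (- (p - 1)).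

(** The remainder of the pointwise inequality at c grad F, used for c = f / (F + e) and for its
    limit c = f / F; in the latter case y is F grad (f / F). *)
Definition remainder (c : R) (x : V) : R :=
  let y := hgrad G f x - c *: hgrad G F x in
  rho x * (enorm y ^+ 2 * (enorm (c *: hgrad G F x) + enorm y) `^ (p - 2)).

Lemma FDe_gt0 e x : 0 < e -> 0 < F x + e.
Proof. by move=> e0; rewrite ltr_wpDl. Qed.

Lemma FDe_Ck e k : Ck k (fun x => F x + e).
Proof. by apply: CkD; [exact: Fs|exact: Ck_cst]. Qed.

Lemma testfun_Ck e : 0 < e -> Ck 1 (testfun e).
Proof.
move=> e0; apply: CkM; first by apply: Ck1_abs_powR => //; exact: fs.
by apply: Ck1_powR; [exact: FDe_Ck|move=> x; exact: FDe_gt0].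
Qed.

Lemma testfun_bounded e : bounded_support (testfun e).
Proof.
apply: bounded_supportMl; apply: bounded_support_sub fb _ => x ->.
by rewrite normr0 powR0// gt_eqF// (lt_trans _ p1).
Qed.

Lemma testfun_ge0 e x : 0 <= testfun e x.
Proof. by rewrite mulr_ge0// powR_ge0. Qed.

(** The test function is homogeneous of degree 1 in the pair (f, F + e), so its derivatives depend
    on the ratio c only: substituting f = c (F + e) cancels all powers of F + e. *)
Lemma hphi_testfun e k x : 0 < e -> let c := f x / (F x + e) in
  hphi G (testfun e) k x =
  p * (`|c| `^ (p - 2) * c) * 'D_(hfield G k x) f x - (p - 1) * `|c| `^ p * hder G F k x.
Proof.
move=> e0 c; have w0 := FDe_gt0 x e0; set w := F x + e in w0.
have FdC := Ck1_is_derive x (hfield G k x) (Fs 1).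
have d1 : is_derive x (hfield G k x) (fun x => F x + e) (hder G F k x).
  have := is_deriveD_pt FdC (is_derive_cst_pt e x (hfield G k x)); rewrite addr0; exact.
have d2 := is_derive_powR (- (p - 1)) d1 w0.
have d3 := is_derive_abs_powR_comp x (hfield G k x) p1 (fs 1).
rewrite /hphi (derive_is (is_deriveM_pt d3 d2)) -/w.
have fE : f x = c * w by rewrite /c divfK// gt_eqF.
rewrite {1 2 3}fE normrM (gtr0_norm w0) !powRM ?(ltW w0)//.
have e1 : w `^ (- (p - 1) - 1) = (w `^ (p - 2) * w ^+ 2)^-1.
  rewrite -powR_split2 ?(ltW w0)//; last by rewrite gt_eqF// (lt_trans _ p1).
  by rewrite -powRN; congr (_ `^ _); ring.
have e2 : w `^ (- (p - 1)) = (w `^ (p - 2) * w)^-1.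
  rewrite -{3}[w]powRr1 ?(ltW w0)// -powRD_gt0// -powRN; congr (_ `^ _); ring.
have e3 : w `^ p = w `^ (p - 2) * w ^+ 2.
  by apply: powR_split2; [rewrite gt_eqF// (lt_trans _ p1)|exact: ltW].
rewrite e1 e2 e3.
have W0 : w `^ (p - 2) != 0 by rewrite gt_eqF// powR_gt0.
have w0' : w != 0 by rewrite gt_eqF.
move: (w `^ (p - 2)) W0 (`|c| `^ p) (`|c| `^ (p - 2)) ('D_(hfield G k x) f x) (hder G F k x) => W W0 A B D E.
by field; rewrite W0 w0'.
Qed.

(** A Picone-type identity: the test function is chosen so that its pairing with the flux gives
    exactly the zeroth-order and linear terms of the pointwise inequality at X and grad f - X. *)
Lemma flux_testfun e x : 0 < e -> let c := f x / (F x + e) in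
  let X := c *: hgrad G F x in
  \sum_k fl (hs x) k x * hphi G (testfun e) k x =
  rho x * (enorm X `^ p + p * enorm X `^ (p - 2) * dotv X (hgrad G f x - X)).
Proof.
move=> e0 c X; have p0 : p != 0 by rewrite gt_eqF// (lt_trans _ p1).
set b := enorm (hgrad G F x); have b0 : 0 <= b by exact: enorm_ge0.
have bE : b ^+ 2 = hs x by rewrite sqr_enorm hsq_dotv.
transitivity (\sum_k rho x * b `^ (p - 2) *
   (p * (`|c| `^ (p - 2) * c) * (hder G F k x * 'D_(hfield G k x) f x) -
   (p - 1) * `|c| `^ p * hder G F k x ^+ 2)).
  apply: eq_bigr => k _; rewrite hphi_testfun// -/c /flux -enorm_hgrad_powR -/b; ring.
rewrite -mulr_sumr sumrB -!mulr_sumr -/(hsq G F x) -bE.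
have -> : \sum_k hder G F k x * 'D_(hfield G k x) f x = dotv (hgrad G F x) (hgrad G f x).
  by apply: eq_bigr => k _; rewrite !mxE.
rewrite /X dotvDr -(scaleNr c (hgrad G F x)) dotvZr !dotvZl -sqr_enorm -/b enormZ !powRM//.
rewrite (powR_split2 p0 b0) (powR_split2 p0 (normr_ge0 c)) real_normK ?num_real//.
by ring.
Qed.

Lemma remainder_ge0 c x : 0 <= remainder c x.
Proof. by rewrite /remainder mulr_ge0// mulr_ge0 ?sqr_ge0// powR_ge0. Qed.

Lemma energy_pointwise e x : 0 < e ->
  \sum_k fl (hs x) k x * hphi G (testfun e) k x +
    p * (p - 1) / 2 * remainder (f x / (F x + e)) x <=
  rho x * enorm (hgrad G f x) `^ p.
Proof.
move=> e0; rewrite flux_testfun//; set c := f x / _; set X := c *: hgrad G F x.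
rewrite /remainder -/X; set Y := hgrad G f x - X.
have -> : hgrad G f x = X + Y by rewrite /Y addrC subrK.
apply: le_trans (ler_wpM2l (rho0 x) (enorm_powR_ge X Y p1 p2)).
rewrite le_eqVlt; apply/orP; left; apply/eqP.
rewrite -[p - 2]opprB (powRN (enorm X + enorm Y)).
by ring.
Qed.

Lemma hgrad_coord_continuous h k : Ck 1 h -> continuous (fun x => hgrad G h x ord0 k).
Proof.
move=> hC; rewrite (_ : (fun x => _) = fun x => 'D_(hfield G k x) h x).
  exact: (hderive_Ck G (m := 0) k hC).
by apply/funext => x; rewrite mxE.
Qed.

Lemma measurable_remainder e : 0 < e ->
  measurable_fun setT (fun x => remainder (f x / (F x + e)) x).
Proof.
move=> e0.
have cc : continuous (fun x => f x / (F x + e)).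
  have -> : (fun x => f x / (F x + e)) = fun x => f x * (F x + e) `^ (- 1).
    by apply/funext => x; rewrite powR_inv1// ltW// FDe_gt0.
  apply: (@CkM _ _ 0); first exact: (fs 0).
  by apply: Ck_cont; apply: Ck1_powR; [exact: FDe_Ck|move=> x; exact: FDe_gt0].
have Xc : continuous (fun x => enorm ((f x / (F x + e)) *: hgrad G F x)).
  apply: continuous_enorm => k.
  rewrite (_ : (fun x => _) = fun x => (f x / (F x + e)) * hgrad G F x ord0 k); last first.
    by apply/funext => x; rewrite [LHS]mxE.
  by apply: (@CkM _ _ 0) => //; apply: hgrad_coord_continuous; exact: Fs.
have Yc : continuous (fun x => enorm (hgrad G f x - (f x / (F x + e)) *: hgrad G F x)).
  apply: continuous_enorm => k.
  rewrite (_ : (fun x => _) = fun x => hgrad G f x ord0 k + (- (f x / (F x + e))) * hgrad G F x ord0 k); last first.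
    by apply/funext => x; rewrite [LHS]mxE [X in _ + X]mxE [X in - X]mxE mulNr.
  apply: (@CkD _ _ 0); first by apply: hgrad_coord_continuous; exact: fs.
  apply: (@CkM _ _ 0); last by apply: hgrad_coord_continuous; exact: Fs.
  by move=> x; exact: (cvgN (cc x)).
apply: measurable_funM; first exact: (continuous_measurable_rV (Ck_cont rhoC)).
apply: measurable_funM; first exact: measurable_funX (continuous_measurable_rV Yc).
apply: (measurableT_comp (measurable_powR _)).
apply: measurable_funD; [exact: (continuous_measurable_rV Xc)|exact: (continuous_measurable_rV Yc)].
Qed.

Lemma energy_cbs : cbs (fun x => rho x * enorm (hgrad G f x) `^ p).
Proof.
have ec : continuous (fun x => enorm (hgrad G f x)).
  by apply: continuous_enorm => k; apply: hgrad_coord_continuous; exact: fs.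
split.
  apply: (@CkM _ _ 0); first exact: (Ck_cont rhoC).
  move=> x; rewrite (_ : (fun x => _) = fun x => `|enorm (hgrad G f x)| `^ p).
    have pc : continuous (fun t : R => `|t| `^ p).
      move=> t; apply/differentiable_continuous/derivable1_diffP.
      by have [] := is_derive_abs_powR t p1.
    exact: (@cvg_comp _ _ _ (fun x => enorm (hgrad G f x)) (fun t : R => `|t| `^ p) _ _ _ (ec x) (pc _)).
  by apply/funext => y; rewrite ger0_norm// enorm_ge0.
have [M hM] := fb; exists M => x; apply: contraNle => Mx.
have -> : hgrad G f x = 0.
  apply/rowP => k; rewrite !mxE; apply/eqP; apply: contraTT Mx => /(derive_bounded_support hM).
  by rewrite -leNgt.
by rewrite enorm0 powR0 ?mulr0// gt_eqF// (lt_trans _ p1).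
Qed.

Lemma energy_inequality (eta : V -> R) e : 0 < e -> measurable_fun setT eta ->
  {ae mu, forall x, 0 <= eta x} ->
  {ae mu, forall x, p_sub_laplacian_exists G p rho F x /\
        eta x * F x `^ (p - 1) <= - p_sub_laplacian G p rho F x} ->
  (\int[mu]_x (Num.max 0 (eta x * F x `^ (p - 1)) * testfun e x
      + p * (p - 1) / 2 * remainder (f x / (F x + e)) x)%:E <=
   \int[mu]_x (rho x * enorm (hgrad G f x) `^ p)%:E)%E.
Proof.
move=> e0 meta eta0 hex.
have Cp0 : 0 <= p * (p - 1) / 2 by rewrite divr_ge0// mulr_ge0//; move: p1; lra.
have tC := testfun_Ck e0; have tb := testfun_bounded e; have t0 := testfun_ge0 e.
have wi := weak_inequality p1 p2 rho0 rhoC Fs tC tb t0 meta F0 eta0 hex.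
have [i1 _ _] := weak_identity G p1 p2 rho0 rhoC Fs tC tb t0.
have iK := cbs_integrable energy_cbs.
set h := fun x => \sum_k _ in i1.
set K := fun x => rho x * _ in iK.
pose E x := p * (p - 1) / 2 * remainder (f x / (F x + e)) x.
have mE : measurable_fun setT E.
  by apply: measurable_funM; [exact: measurable_cst|exact: measurable_remainder].
have E0 x : 0 <= E x by rewrite mulr_ge0// remainder_ge0.
(* From 0 <= E <= K - h with K and h integrable. The integrability of E permits adding its integral
   to that of h, which has no sign. *)
have iE : mu.-integrable setT (EFin \o E).
  apply: (@le_integrable _ _ _ mu setT measurableT _ (fun x => (K x)%:E + (-1)%:E * (h x)%:E)%E).
  - exact/measurable_EFinP.
  - move=> x _; rewrite /= lee_fin (ger0_norm (E0 x)) mulN1r.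
    apply: le_trans (ler_norm _).
    by have := energy_pointwise x e0; rewrite -/(K x) -/(h x) -/(E x); lra.
  - by apply: integrableD => //; exact: integrableZl.
pose A x := Num.max 0 (eta x * F x `^ (p - 1)) * testfun e x.
have A0 x : 0 <= A x by rewrite mulr_ge0// le_max lexx.
have mA : measurable_fun setT A.
  apply: measurable_funM; last exact: (continuous_measurable_rV (Ck_cont tC)).
  apply: measurable_maxr; first exact: measurable_cst.
  apply: measurable_funM => //; apply: (measurableT_comp (measurable_powR _)).
  exact: (continuous_measurable_rV (Fs 0)).
have -> : (\int[mu]_x (A x + E x)%:E = \int[mu]_x (A x)%:E + \int[mu]_x (E x)%:E)%E.
  under eq_integral do rewrite EFinD.
  apply: ge0_integralD => //.
  - by move=> x _; rewrite lee_fin.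
  - exact/measurable_EFinP.
  - by move=> x _; rewrite lee_fin.
  - exact/measurable_EFinP.
apply: le_trans (leeD wi (lexx _)) _.
rewrite -(integralD measurableT i1 iE).
apply: le_integral => //; first exact: integrableD.
by move=> x _; rewrite lee_fin; exact: energy_pointwise.
Qed.

End energy.

Section limit.
Context {R : realType} {N : nat} {Ns : seq nat} (G : stratified_group R N Ns).
Local Notation n := (N + sumn Ns)%N.
Local Notation V := 'rV[R]_n.
Local Notation mu := (lebesgue_rV n).
Variables (p : R) (rho F f eta : V -> R).
Hypotheses (p1 : 1 < p) (p2 : p < 2) (rho0 : forall x, 0 <= rho x)
  (rhoC : Ck 1 rho) (F0 : forall x, 0 <= F x) (Fs : smooth F) (fs : smooth f)
  (fb : bounded_support f) (meta : measurable_fun setT eta)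
  (eta0 : {ae mu, forall x, 0 <= eta x})
  (hex : {ae mu, forall x, p_sub_laplacian_exists G p rho F x /\
        eta x * F x `^ (p - 1) <= - p_sub_laplacian G p rho F x}).

Let eps (m : nat) : R := m.+1%:R^-1.
Let U := [set x | F x != 0].
(** The limiting integrands are cut off to the set where F does not vanish, since only there do the
    powers and quotients of F + e converge to those of F. *)
Let eta_part (x : V) : R := \1_U x * (Num.max 0 (eta x * F x `^ (p - 1)) * (`|f x| `^ p * F x `^ (- (p - 1)))).
Let remainder_part (x : V) : R := \1_U x * remainder G p rho F f (f x / F x) x.

Let eps_gt0 m : 0 < eps m. Proof. by rewrite invr_gt0. Qed.

Let eps_cvg : eps @ \oo --> 0. Proof. exact: cvg_harmonic. Qed.

Let measurable_U : measurable U.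
Proof.
have := measurableC (continuous_measurable_rV (Fs 0) measurableT (measurable_set1 0)).
by rewrite setTI; congr measurable; apply/seteqP; split => x /=; [move/eqP|move=> /eqP].
Qed.

(** The power with exponent p - 2 < 0 is discontinuous at 0, which is why c = 0 is required to force
    c_m = 0. The quotients f / (F + e) meet this condition, as they vanish together with f / F when
    F is nonzero. *)
Lemma cvg_remainder (c_ : nat -> R) (c : R) x : c_ @ \oo --> c ->
  (forall m, c = 0 -> c_ m = 0) ->
  (fun m => remainder G p rho F f (c_ m) x) @ \oo --> remainder G p rho F f c x.
Proof.
move=> cc c0.
have cX : (fun m => enorm (c_ m *: hgrad G F x)) @ \oo --> enorm (c *: hgrad G F x).
  apply: cvg_enorm => i; rewrite mxE; under eq_fun do rewrite mxE.
  by apply: cvgMl.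
have cY : (fun m => enorm (hgrad G f x - c_ m *: hgrad G F x)) @ \oo -->
    enorm (hgrad G f x - c *: hgrad G F x).
  apply: cvg_enorm => i.
  have E t : (hgrad G f x - t *: hgrad G F x) ord0 i = hgrad G f x ord0 i - t * hgrad G F x ord0 i.
    by rewrite !mxE.
  rewrite E; under eq_fun do rewrite E.
  by apply: cvgB; [exact: cvg_cst|apply: cvgMl].
have [s0|s0] := eqVneq (enorm (c *: hgrad G F x) + enorm (hgrad G f x - c *: hgrad G F x)) 0.
  (* then [c grad F = 0], hence [c_m grad F = 0] for every [m], and the sequence is constant *)
  have X0 : c *: hgrad G F x = 0.
    apply/eqP; rewrite -enorm_eq0; apply/eqP.
    by have := enorm_ge0 (c *: hgrad G F x);
       have := enorm_ge0 (hgrad G f x - c *: hgrad G F x); lra.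
  have Xm m : c_ m *: hgrad G F x = 0.
    by move/eqP: X0; rewrite scaler_eq0 => /orP[/eqP/c0 ->|/eqP ->]; rewrite ?scale0r ?scaler0.
  rewrite /remainder X0; under eq_fun do rewrite Xm.
  exact: cvg_cst.
apply: cvgMr; apply: cvgM; first by under eq_fun do rewrite expr2; rewrite expr2; exact: cvgM.
apply: cvg_powR_gt0; first by rewrite lt_def s0 addr_ge0// enorm_ge0.
exact: cvgD.
Qed.

Let seq_part (m : nat) (x : V) : R := \1_U x * (Num.max 0 (eta x * F x `^ (p - 1)) * testfun p F f (eps m) x).
Let seq_rem (m : nat) (x : V) : R := \1_U x * remainder G p rho F f (f x / (F x + eps m)) x.

Let FDeps_cvg x : (fun m => F x + eps m) @ \oo --> F x.
Proof. by rewrite -[X in _ --> X]addr0; apply: cvgD => //; exact: cvg_cst. Qed.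

Let seq_rem_cvg x : seq_rem ^~ x @ \oo --> remainder_part x.
Proof.
rewrite /seq_rem /remainder_part indicE; case: (boolP (x \in U)) => [|_]; last first.
  by under eq_fun do rewrite mul0r; rewrite mul0r; exact: cvg_cst.
rewrite inE => Ux; apply: cvgMr; apply: cvg_remainder.
  by apply: cvgMr; apply: cvgV => //; exact: FDeps_cvg.
move=> m /eqP; rewrite mulf_eq0 invr_eq0 (negPf Ux) orbF => /eqP ->.
by rewrite mul0r.
Qed.

Let seq_part_cvg x : seq_part ^~ x @ \oo --> eta_part x.
Proof.
rewrite /seq_part /eta_part indicE; case: (boolP (x \in U)) => [|_]; last first.
  by under eq_fun do rewrite mul0r; rewrite mul0r; exact: cvg_cst.
rewrite inE => Ux; do 3 apply: cvgMr.
by apply: cvg_powR_gt0; [rewrite lt_def Ux F0|exact: FDeps_cvg].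
Qed.

Let indic01 x : 0 <= (\1_U x : R) <= 1.
Proof. by rewrite indicE; case: (x \in U); rewrite ?ler01 lexx. Qed.

Let measurable_seq_rem m : measurable_fun setT (seq_rem m).
Proof.
apply: measurable_funM; first exact: measurable_indic.
exact: measurable_remainder.
Qed.

Let measurable_seq_part m : measurable_fun setT (seq_part m).
Proof.
apply: measurable_funM; first exact: measurable_indic.
apply: measurable_funM.
  apply: measurable_maxr; first exact: measurable_cst.
  apply: measurable_funM => //; apply: (measurableT_comp (measurable_powR _)).
  exact: (continuous_measurable_rV (Fs 0)).
exact: (continuous_measurable_rV (Ck_cont (testfun_Ck p1 F0 Fs fs (eps_gt0 m)))).
Qed.

Let seq_part_ge0 m x : 0 <= seq_part m x.
Proof.
have /andP[? _] := indic01 x.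
by rewrite mulr_ge0// mulr_ge0 ?testfun_ge0// le_max lexx.
Qed.

Let seq_rem_ge0 m x : 0 <= seq_rem m x.
Proof. by have /andP[? _] := indic01 x; rewrite mulr_ge0// remainder_ge0. Qed.

Let Cp0 : 0 <= p * (p - 1) / 2.
Proof. by rewrite divr_ge0// mulr_ge0//; move: p1; lra. Qed.

Let measurable_eta_part : measurable_fun setT eta_part.
Proof.
have h := @measurable_fun_cvg _ _ _ setT seq_part eta_part measurable_seq_part
  (fun x _ => @seq_part_cvg x).
exact: h.
Qed.

Let measurable_remainder_part : measurable_fun setT remainder_part.
Proof.
have h := @measurable_fun_cvg _ _ _ setT seq_rem remainder_part measurable_seq_rem
  (fun x _ => @seq_rem_cvg x).
exact: h.
Qed.

Let remainder_part_ge0 x : 0 <= remainder_part x.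
Proof. by have /andP[? _] := indic01 x; rewrite mulr_ge0// remainder_ge0. Qed.

Let eta_part_ge0 x : 0 <= eta_part x.
Proof.
have /andP[? _] := indic01 x; rewrite mulr_ge0// mulr_ge0 ?le_max ?lexx//.
by rewrite mulr_ge0// powR_ge0.
Qed.

Lemma limit_inequality :
  (\int[mu]_x (eta_part x)%:E + (p * (p - 1) / 2)%:E * \int[mu]_x (remainder_part x)%:E <=
   \int[mu]_x (rho x * enorm (hgrad G f x) `^ p)%:E)%E.
Proof.
have mp := measurable_eta_part; have mr := measurable_remainder_part.
have r0 := remainder_part_ge0; have q0 := eta_part_ge0.
have -> : (\int[mu]_x (eta_part x)%:E + (p * (p - 1) / 2)%:E * \int[mu]_x (remainder_part x)%:E =
    \int[mu]_x (eta_part x + p * (p - 1) / 2 * remainder_part x)%:E)%E.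
  rewrite -ge0_integralZl//=; last 2 first.
  - exact/measurable_EFinP.
  - by move=> x _; rewrite lee_fin.
  rewrite -ge0_integralD//.
  - by move=> x _; rewrite lee_fin.
  - exact/measurable_EFinP.
  - by move=> x _; rewrite lee_fin mulr_ge0.
  - by apply/measurable_EFinP; apply: measurable_funM => //; exact: measurable_cst.
apply: (@fatou_bound _ _ _ mu (fun m x => seq_part m x + p * (p - 1) / 2 * seq_rem m x)).
- move=> m; apply: measurable_funD; first exact: measurable_seq_part.
  by apply: measurable_funM; [exact: measurable_cst|exact: measurable_seq_rem].
- by move=> m x; rewrite addr_ge0// mulr_ge0.
- by move=> x; apply: cvgD; [exact: seq_part_cvg|apply: cvgMr; exact: seq_rem_cvg].
- move=> m.
  apply: le_trans (energy_inequality p1 p2 rho0 rhoC F0 Fs fs fb (eps_gt0 m) meta eta0 hex).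
  (* Both terms are nonnegative, so restricting them to the set where F is nonzero only lowers the
     integral. *)
  apply: nnintegral_mono => x; rewrite lee_fin; first by rewrite addr_ge0// mulr_ge0.
  have /andP[i0 i1] := indic01 x.
  have le1 (a : R) : 0 <= a -> \1_U x * a <= a.
    by move=> a0; rewrite -[leRHS]mul1r ler_wpM2r.
  apply: lerD; first by apply: le1; rewrite mulr_ge0 ?testfun_ge0// le_max lexx.
  by apply: ler_wpM2l => //; apply: le1; exact: remainder_ge0.
Qed.

Lemma hgrad_quotient x : F x != 0 ->
  F x *: hgrad G (fun z => f z / F z) x = hgrad G f x - (f x / F x) *: hgrad G F x.
Proof.
move=> Fx; apply/rowP => k; rewrite !mxE; set v := hfield G k x.
have Fd := Ck1_is_derive x v (Fs 1).
have fd := Ck1_is_derive x v (fs 1).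
have iFd : is_derive x v (fun z => (F z)^-1) (- (F x) ^- 2 * 'D_v F x).
  have [Fdr _] := Fd.
  by split; [exact: derivableV|rewrite deriveV].
by rewrite (derive_is (is_deriveM_pt fd iFd)); field.
Qed.

Hypothesis FN0 : {ae mu, forall x, F x != 0}.

Let g x := f x / F x.

Lemma eta_term : (\int[mu]_x (`|(eta x `^ p^-1 * f x)%:E| `^ p) <=
  \int[mu]_x (eta_part x)%:E)%E.
Proof.
have p0 : p != 0 by rewrite gt_eqF// (lt_trans _ p1).
apply: ae_nnintegral_mono.
- by move=> x; rewrite lee_fin powR_ge0.
- by move=> x; rewrite lee_fin; exact: eta_part_ge0.
- by apply/measurable_EFinP; exact: measurable_eta_part.
- apply: filterS2 eta0 FN0 => x e0 Fx.
  rewrite lee_fin /eta_part indicE mem_set// mul1r.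
  rewrite max_r ?mulr_ge0 ?powR_ge0// normrM (ger0_norm (powR_ge0 _ _)) powRM ?powR_ge0//.
  rewrite -powRrM mulVf// powRr1//.
  have Fp : F x `^ (p - 1) * F x `^ (- (p - 1)) = 1.
    by rewrite powRN mulfV// powR_eq0 negb_and Fx.
  move: (F x `^ (p - 1)) (F x `^ (- (p - 1))) Fp => a b ab.
  have -> : eta x * a * (`|f x| `^ p * b) = eta x * `|f x| `^ p * (a * b) by ring.
  by rewrite ab mulr1.
Qed.

(** By the quotient rule F grad (f / F) = grad f - (f / F) grad F where F is nonzero, so the
    integrands agree almost everywhere. Only the inequality is claimed: [ae_nnintegral_mono] asks
    for measurability of the right integrand alone, and the left one involves the gradient of f / F
    also at zeros of F. *)
Lemma remainder_term : (\int[mu]_x (`|(enorm ((rho x `^ 2^-1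
    * (enorm (g x *: hgrad G F x) + F x * enorm (hgrad G g x)) `^ ((p - 2) / 2)
    * `|F x|) *: hgrad G g x))%:E| `^ 2) <=
  \int[mu]_x (remainder_part x)%:E)%E.
Proof.
apply: ae_nnintegral_mono.
- by move=> x; rewrite lee_fin powR_ge0.
- by move=> x; rewrite lee_fin; exact: remainder_part_ge0.
- by apply/measurable_EFinP; exact: measurable_remainder_part.
- apply: filterS FN0 => x Fx.
  rewrite lee_fin /remainder_part indicE mem_set// mul1r /remainder -/(g x).
  have Yg : hgrad G f x - g x *: hgrad G F x = F x *: hgrad G g x.
    by rewrite -hgrad_quotient.
  rewrite Yg !enormZ (ger0_norm (F0 x)).
  set b := enorm (hgrad G g x); set S := _ + F x * b.
  rewrite (powR_mulrn 2)// real_normK ?num_real//.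
  rewrite normrM normrM !(ger0_norm (powR_ge0 _ _)) (ger0_norm (F0 x)).
  have e1 : (rho x `^ 2^-1) ^+ 2 = rho x by rewrite powR12_sqrt// sqr_sqrtr.
  have e2 : (S `^ ((p - 2) / 2)) ^+ 2 = S `^ (p - 2).
    by rewrite -(powR_mulrn 2) ?powR_ge0// -powRrM divfK.
  rewrite le_eqVlt; apply/orP; left; apply/eqP.
  by rewrite -e2 -{2}e1; ring.
Qed.

End limit.

Lemma L1loc_measurable (R : realType) n (eta : 'rV[R]_n -> R) : L1loc eta ->
  measurable_fun setT eta.
Proof.
move=> etaL.
have -> : [set: 'rV[R]_n] = \bigcup_(k : nat) cube k%:R.
  apply/esym/seteqP; split => // x _; exists (Num.truncn `|x|).+1 => // i.
  rewrite in_itv/= -ler_norml; apply: le_trans (rV_norm_coord _ _) _.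
  exact/ltW/truncnS_gt.
apply/(measurable_fun_bigcup _ (fun k => measurable_cube k%:R)) => k.
have /integrableP[+ _] := etaL _ (@compact_cube R n k%:R).
by move=> /measurable_EFinP.
Qed.

Lemma Lnorm_energy (R : realType) N Ns (G : stratified_group R N Ns) (p : R)
    (rho f : 'rV[R]_(N + sumn Ns) -> R) : p != 0 -> (forall x, 0 <= rho x) ->
  (Lnorm (lebesgue_rV (N + sumn Ns)) p%:E
     (fun x => (enorm (rho x `^ p^-1 *: hgrad G f x))%R%:E) `^ p =
   \int[lebesgue_rV (N + sumn Ns)]_x (rho x * enorm (hgrad G f x) `^ p)%R%:E)%E.
Proof.
move=> p0 rho0; rewrite poweR_Lnorm//; apply: eq_integral => x _.
rewrite -[LHS]/((`|enorm (rho x `^ p^-1 *: hgrad G f x)| `^ p)%:E).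
rewrite ger0_norm ?enorm_ge0// enormZ (ger0_norm (powR_ge0 _ _)).
by rewrite powRM ?powR_ge0 ?enorm_ge0// -powRrM mulVf// powRr1.
Qed.

Theorem mainTheorem14 (R : realType) (p : R) (p_gt1 : 1 < p) (p_lt2 : p < 2) :
  exists Cp : R, 0 < Cp /\
    (forall (n : nat) (x y : 'rV[R]_n),
      enorm x `^ p + Cp * (enorm y ^+ 2 / (enorm x + enorm y) `^ (2 - p))
        + p * enorm x `^ (p - 2) * dotv x y
      <= enorm (x + y) `^ p) /\
    (forall (N : nat) (Ns : seq nat) (G : stratified_group R N Ns)
        (rho F eta : 'rV[R]_(N + sumn Ns) -> R),
      let mu := lebesgue_rV (N + sumn Ns) in
      (forall x, 0 <= rho x) -> Ck 1 rho ->
      (forall x, 0 <= F x) -> smooth F ->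
      {ae mu, forall x, 0 <= eta x} -> L1loc eta ->
      {ae mu, forall x, F x != 0} ->
      {ae mu, forall x, p_sub_laplacian_exists G p rho F x /\
        eta x * F x `^ (p - 1) <= - p_sub_laplacian G p rho F x} ->
      forall f : 'rV[R]_(N + sumn Ns) -> R,
        smooth f -> compactly_supported f ->
        let g := fun x => f x / F x in
        (Lnorm mu p%:E (fun x => (eta x `^ p^-1 * f x)%R%:E) `^ p
         + Cp%:E * Lnorm mu 2%:E (fun x =>
             (enorm ((rho x `^ 2^-1
               * (enorm (g x *: hgrad G F x) + F x * enorm (hgrad G g x))
                   `^ ((p - 2) / 2)
               * `|F x|) *: hgrad G g x))%R%:E) `^ 2
         <= Lnorm mu p%:E (fun x =>
             (enorm (rho x `^ p^-1 *: hgrad G f x))%R%:E) `^ p)%E).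
Proof.
have p0 : p != 0 by rewrite gt_eqF// (lt_trans _ p_gt1).
exists (p * (p - 1) / 2); split; first by rewrite divr_gt0// mulr_gt0//; lra.
split=> [n x y|]; first exact: enorm_powR_ge.
move=> N Ns G rho F eta mu rho0 rhoC F0 Fs eta0 etaL FN0 hex f fs fc; cbv zeta.
have fb := compactly_supported_bounded fc.
have meta : measurable_fun setT eta by exact: L1loc_measurable.
have ineq := limit_inequality p_gt1 p_lt2 rho0 rhoC F0 Fs fs fb meta eta0 hex.
have eta_le := eta_term p_gt1 F0 Fs fs meta eta0 FN0.
have rem_le := remainder_term G p rho0 rhoC F0 Fs fs FN0.
rewrite (Lnorm_energy G f p0 rho0).
apply: le_trans ineq.
rewrite (poweR_Lnorm mu (fun x => (eta x `^ p^-1 * f x)%:E) p0).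
apply: leeD; first exact: eta_le.
apply: lee_wpmul2l; first by rewrite lee_fin divr_ge0// mulr_ge0//; lra.
rewrite poweR_Lnorm//; exact: rem_le.
Qed.
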